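(* Let $(\mathsf{L},\models)$ be a self-complementary logic on graphs for which there exists a class $\mathcal{F}$ of simple graphs such that any two simple graphs $G$ and $H$ are homomorphism indistinguishable over $\mathcal{F}$ if and only if they are $\mathsf{L}$-equivalent. Suppose that for every $k\in\mathbb{N}$ there exist graphs $G$ and $H$ which are $\mathsf{C}^k$-equivalent but not $\mathsf{L}$-equivalent. Then any two $\mathsf{L}$-equivalent graphs are quantum isomorphic.
   Context: All graphs are finite, undirected, without multiple edges; simple means without loops. $G\equiv_{\mathcal{F}}H$ (homomorphism indistinguishability over $\mathcal{F}$) means $\hom(F,G)=\hom(F,H)$ for all $F\in\mathcal{F}$, where $\hom$ counts homomorphisms. A logic on graphs is a pair $(\mathsf{L},\models)$ of a class of sentences and an isomorphism-invariant relation between graphs and sentences; $G,H$ are $\mathsf{L}$-equivalent if $G\models\phi\iff H\models\phi$ for all $\phi\in\mathsf{L}$. It is self-complementary if for every $\phi\in\mathsf{L}$ there is $\overline\phi\in\mathsf{L}$ with $G\models\phi \iff \overline G\models\overline\phi$ for all simple graphs $G$, $\overline G$ being the complement graph. $\mathsf{C}^k$ is the $k$-variable fragment of first-order logic over the signature $\{E\}$ extended by counting quantifiers $\exists^{\geq n}x$; $\mathsf{C}^k$-equivalence means satisfying the same $\mathsf{C}^k$ sentences. Graphs $G,H$ are quantum isomorphic if there is a unital C*-algebra $\mathcal{A}$ and projections $u_{gh}\in\mathcal{A}$ ($g\in V(G)$, $h\in V(H)$) with $\sum_{h}u_{gh}=1$ for every $g$, $\sum_g u_{gh}=1$ for every $h$,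 and $u_{gh}u_{g'h'}=0$ whenever $\mathrm{rel}(g,g')\neq\mathrm{rel}(h,h')$, where $\mathrm{rel}$ records whether two vertices are equal, adjacent, or distinct and non-adjacent.
   Formalization: The C^k-equivalent but not L-equivalent graphs, and the L-equivalent graphs in the conclusion, are required to be simple; with loops allowed the claim is false, since the hypotheses do not control the logic on graphs with loops. *)

(* Defs.v *)
From HB Require Import structures.
From mathcomp Require Import all_boot all_order all_algebra.
From mathcomp Require Import complex.
From mathcomp Require Import Rstruct.

Set Implicit Arguments.
Unset Strict Implicit.
Unset Printing Implicit Defensive.

Import Order.TTheory GRing.Theory Num.Theory.

Record graph := Graph {
  vertex : finType;
  adj : rel vertex;
  adj_sym : symmetric adj
}.

Definition simple (G : graph) : Prop := forall x : vertex G, ~~ adj x x.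

Definition hom (F G : graph) : nat :=
  #|[set f : {ffun vertex F -> vertex G} |
       [forall x, forall y, adj x y ==> adj (f x) (f y)]]|.

Definition hom_indist (Fc : graph -> Prop) (G H : graph) : Prop :=
  forall F, Fc F -> hom F G = hom F H.

Definition isomorphic (G H : graph) : Prop :=
  exists f : vertex G -> vertex H,
    bijective f /\ forall x y, adj x y = adj (f x) (f y).

Definition compl_adj (G : graph) : rel (vertex G) :=
  fun x y => (x != y) && ~~ adj x y.

Lemma compl_adj_sym (G : graph) : symmetric (@compl_adj G).
Proof. by move=> x y; rewrite /compl_adj eq_sym adj_sym. Qed.

Definition compl (G : graph) : graph := @Graph (vertex G) (@compl_adj G) (@compl_adj_sym G).

Definition is_logic (L : Type) (models : graph -> L -> Prop) : Prop :=
  forall G H, isomorphic G H -> forall phi, models G phi <-> models H phi.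

Definition L_equiv (L : Type) (models : graph -> L -> Prop) (G H : graph) : Prop :=
  forall phi, models G phi <-> models H phi.

Definition self_complementary (L : Type) (models : graph -> L -> Prop) : Prop :=
  forall phi : L, exists phibar : L,
    forall G, simple G -> (models G phi <-> models (compl G) phibar).

Inductive cform :=
  | CEq of nat & nat
  | CAdj of nat & nat
  | CNot of cform
  | CAnd of cform & cform
  | CExGe of nat & nat & cform.      (* CExGe n i phi : exists^{>= n} x_i. phi *)

Fixpoint cvars (phi : cform) : seq nat :=
  match phi with
  | CEq i j | CAdj i j => [:: i; j]
  | CNot psi => cvars psi
  | CAnd psi chi => cvars psi ++ cvars chi
  | CExGe _ i psi => i :: cvars psi
  end.

Fixpoint cfv (phi : cform) : seq nat :=
  match phi with
  | CEq i j | CAdj i j => [:: i; j]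
  | CNot psi => cfv psi
  | CAnd psi chi => cfv psi ++ cfv chi
  | CExGe _ i psi => [seq j <- cfv psi | j != i]
  end.

(* satisfaction under a partial assignment (unassigned atoms are false;
   this never matters for sentences) *)
Fixpoint csat (G : graph) (a : nat -> option (vertex G)) (phi : cform) : bool :=
  match phi with
  | CEq i j => if (a i, a j) is (Some u, Some v) then u == v else false
  | CAdj i j => if (a i, a j) is (Some u, Some v) then adj u v else false
  | CNot psi => ~~ csat a psi
  | CAnd psi chi => csat a psi && csat a chi
  | CExGe n i psi =>
      n <= #|[pred v : vertex G |
                csat (fun j => if j == i then Some v else a j) psi]|
  end.

Definition Ck_sentence (k : nat) (phi : cform) : bool :=
  (cfv phi == [::]) && all (fun i => i < k) (cvars phi).

Definition Ck_models (G : graph) (phi : cform) : bool :=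
  csat (fun _ => None : option (vertex G)) phi.

Definition Ck_equiv (k : nat) (G H : graph) : Prop :=
  forall phi, Ck_sentence k phi -> Ck_models G phi = Ck_models H phi.

(* calg is a (nonzero, unital, associative) algebra over CC;           *)
Local Open Scope ring_scope.
Local Open Scope complex_scope.

Definition CC := (Rdefinitions.R)[i].

Record cstarAlg := CstarAlg {
  calg :> algType CC;
  cstar : calg -> calg;
  cnorm : calg -> Rdefinitions.R;
  cstarK : involutive cstar;
  cstarD : forall x y, cstar (x + y) = cstar x + cstar y;
  cstarZ : forall (c : CC) x, cstar (c *: x) = c^* *: cstar x;
  cstarM : forall x y, cstar (x * y) = cstar y * cstar x;
  cnorm_eq0 : forall x, cnorm x = 0 -> x = 0;
  cnormD : forall x y, cnorm (x + y) <= cnorm x + cnorm y;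
  cnormZ : forall (c : CC) x, cnorm (c *: x) = ComplexField.Normc.normc c * cnorm x;
  cnormM : forall x y, cnorm (x * y) <= cnorm x * cnorm y;
  cnormC : forall x, cnorm (cstar x * x) = cnorm x ^+ 2;
  ccomplete : forall u : nat -> calg,
    (forall e : Rdefinitions.R, 0 < e -> exists N, forall m n,
        (N <= m)%N -> (N <= n)%N -> cnorm (u m - u n) < e) ->
    exists l, forall e : Rdefinitions.R, 0 < e -> exists N, forall n,
        (N <= n)%N -> cnorm (u n - l) < e
}.

Definition vrel (G : graph) (x y : vertex G) : nat :=
  if x == y then 0 else if adj x y then 1 else 2.

Definition quantum_isomorphic (G H : graph) : Prop :=
  exists (A : cstarAlg) (u : vertex G -> vertex H -> A),
    [/\ (forall g h, cstar (u g h) = u g h /\ u g h * u g h = u g h),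
        (forall g, \sum_(h : vertex H) u g h = 1),
        (forall h, \sum_(g : vertex G) u g h = 1) &
        (forall g g' h h', vrel g g' <> vrel h h' -> u g h * u g' h' = 0)].

(* Main.v *)
Require Import Defs.
From HB Require Import structures.
From mathcomp Require Import all_boot all_order all_algebra.
From mathcomp Require Import complex.
From mathcomp Require Import Rstruct.
From mathcomp Require Import boolp zify ring lra generic_quotient reals.

Set Implicit Arguments.
Unset Strict Implicit.
Unset Printing Implicit Defensive.

(* Idea. Call a simple graph F closed if hom(F, -) is constant on L-equivalence classes. Self-complementarity
   makes L-equivalence invariant under G |-> complement of G x K; Moebius inversion over the graphs K shows that
   closed graphs are closed under deleting and contracting edges, so hom counts of all minors with equality
   and adjacency constraints agree on L-equivalent G and H. If all closed graphs had treewidth less than k, then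
   C^k-equivalence would imply L-equivalence; so treewidth is unbounded, and by the grid theorem closed
   graphs have arbitrarily large ladder-like minors. Ladders simulate every closed planar tensor network built
   from the equality and adjacency tensors, so all of these have the same value on G and on H.
   The pairs (T_G, T_H) of planar tensors with n open wires therefore span isometric spaces on both sides; for
   an orthonormal basis (T_i, S_i) put W_n(x, y) = sum_i T_i(x) S_i(y). The numbers
   phi((g_1,h_1)...(g_n,h_n)) = W_n(g_1...g_n, h_1...h_n) define a state on the *-algebra generated by the
   entries u_gh of a quantum isomorphism: the relations hold under phi by adjointness of the planar
   operations, and positivity follows from the sum of squares in intertwiner_psd. The GNS construction
   gives operators on a pre-Hilbert space, and bounded sequences of adjointable operators modulo those of
   norm tending to zero form a (complete) C*-algebra containing them. *)

(** * Menger's theorem *)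

(** The class over which indistinguishability is given may be quite irregular. Closed graphs are
    therefore defined by the equivalence relation itself, and they turn out to be closed under
    minors whatever that class is. Products enter because homomorphism counts into [cross G K]
    factor; the loops and non-edges of [K] then act as conditions on colours. Words stand in for
    planar graphs: a ladder evaluates a word like a machine whose registers are its columns, each
    layer comparing two neighbours or forgetting one register, so that no topological notion of
    planarity is involved. The obstacle at the end is to obtain operators from equal numbers. The
    state is written down directly from the isometry, which turns each relation into a statement
    about adjoint operations; only its positivity is not formal, and it uses that one factor of a
    basis pair can be moved across an intertwiner. Planar tensors have natural entries, so all of
    this is real linear algebra; complex scalars appear only with the pre-Hilbert space. *)

Lemma subset_of_card (T : finType) (A : {set T}) k : k <= #|A| ->
  exists2 B : {set T}, B \subset A & #|B| = k.
Proof.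
case/card_geqP => s [us <- sA]; exists [set x in s].
  by apply/subsetP => x; rewrite inE; apply: sA.
by rewrite cardsE; apply/card_uniqP.
Qed.

Section Menger.
Variable V : finType.
Implicit Types (e : rel V) (A B S : {set V}) (s : seq V).

Definition separates e A B S : Prop :=
  forall x p, x \in A -> path e x p -> last x p \in B -> has (mem S) (x :: p).

Definition path_from e A (b : V) s : bool :=
  if s is x :: t then [&& x \in A, path e x t, last x t == b & uniq s] else false.

(** Paths are indexed by their final vertices, so a linkage onto [B'] has as many paths as [B'] has
    elements and no bijection between sources and targets has to be carried along. *)
Definition linkage e A B (p : V -> seq V) : Prop :=
  (forall b, b \in B -> path_from e A b (p b)) /\
  (forall b c v, b \in B -> c \in B -> v \in p b -> v \in p c -> b = c).

Lemma first_hit (P : pred V) x p : has P (x :: p) ->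
  exists p1 p2, [/\ p = p1 ++ p2, P (last x p1) & ~~ has P (belast x p1)].
Proof.
elim: p x => [|y p IH] x /=; first by rewrite orbF => Px; exists [::], [::].
case Px: (P x); first by exists [::], (y :: p).
move=> /= /IH [p1 [p2 [-> H1 H2]]].
by exists (y :: p1), p2; rewrite /= Px.
Qed.

Lemma last_hit (P : pred V) x p : has P (x :: p) ->
  exists p1 p2, [/\ p = p1 ++ p2, P (last x p1) & ~~ has P p2].
Proof.
elim: p x => [|y p IH] x; first by rewrite /= orbF => Px; exists [::], [::].
case Hp: (has P (y :: p)).
  by move=> _; have [p1 [p2 [-> H1 H2]]] := IH _ Hp; exists (y :: p1), p2.
rewrite -cat1s has_cat Hp orbF /= orbF => Px.
by exists [::], (y :: p); split=> //; rewrite Hp.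
Qed.

Definition del_edge e x y : rel V := fun u v => e u v && ~~ ((u == x) && (v == y)).

Lemma del_edge_sub e x y : subrel (del_edge e x y) e.
Proof. by move=> u v /andP[]. Qed.

Lemma path_del_edge_src e x y u p : x \notin belast u p -> path e u p -> path (del_edge e x y) u p.
Proof.
elim: p u => //= v p IH u; rewrite inE negb_or => /andP[xu xp] /andP[euv pp].
by rewrite IH // /del_edge euv eq_sym (negbTE xu).
Qed.

Lemma path_del_edge_tgt e x y u p : y \notin p -> path e u p -> path (del_edge e x y) u p.
Proof.
elim: p u => //= v p IH u; rewrite inE negb_or => /andP[yv yp] /andP[euv pp].
by rewrite IH // /del_edge euv [v == y]eq_sym (negbTE yv) andbF.
Qed.

Lemma linkage_sub e e' A B p : subrel e e' -> linkage e A B p -> linkage e' A B p.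
Proof.
move=> sub [H1 H2]; split=> // b /H1; rewrite /path_from; case: (p b) => // x t.
by case/and4P => -> /(sub_path sub) -> -> ->.
Qed.

Lemma path_from_end e A b s : path_from e A b s -> b \in s.
Proof. by case: s => //= x t /and4P[_ _ /eqP <- _]; apply: mem_last. Qed.

(** The [p]-path up to [v] followed by the [q]-path from [v] on leads from [A] to [B] and must meet
    [S :&: T]. A meeting vertex on the first portion is the end [b], and then it is [v]; one
    strictly later would be a second vertex of [T] on the [q]-path, which meets [T] only at its
    start. *)
Lemma linkage_cross e A B S T b c (p q : V -> seq V) v :
  separates e A B (S :&: T) -> linkage e A S p -> (forall d, d \in B -> path_from e T d (q d)) ->
  (forall d, d \in B -> forall t, t \in T -> t \in q d -> t = head t (q d)) ->
  b \in S -> c \in B -> v \in p b -> v \in q c -> [/\ v = b, v \in T & v = head v (q c)].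
Proof.
move=> sep [p1 p2] q1 q2 bS cB vp vq.
have := p1 _ bS; have qc := q1 _ cB; have q2c := q2 _ cB.
case Ep: (p b) vp => [|x t] // vp /and4P[xA pt /eqP lt ut].
case Eq: (q c) vq qc q2c => [|y r] // vq /and4P[yT pr /eqP lr ur] q2c.
case/splitPl: vp Ep pt lt ut => t1 t2 lt1 Ep.
rewrite cat_path last_cat lt1 => /andP[pt1 pt2] lt2 ut.
case/splitPl: vq Eq pr lr ur q2c => r1 r2 lr1 Eq.
rewrite cat_path last_cat lr1 => /andP[pr1 pr2] lr2 ur q2c.
have := sep x (t1 ++ r2) xA; rewrite cat_path lt1 pt1 pr2 last_cat lt1 lr2.
move=> /(_ isT cB) /hasP[w ww]; rewrite /= inE => /andP[wS wT].
have : w \in x :: t1 \/ w \in r2.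
  by move: ww; rewrite -cat_cons mem_cat => /orP.
move=> [w1|w2].
  have wb : w = b by apply: (p2 _ _ w) => //; [exact: path_from_end (p1 _ wS)|rewrite Ep -cat_cons mem_cat w1].
  have vb : v = b.
    case: t2 ut pt2 lt2 {Ep pt1} => [|z t2] //= /andP[xt ut] _ lt2.
    move: w1; rewrite inE => /orP[/eqP wx|w1].
      by move: xt; rewrite mem_cat -wx wb -lt2 mem_last orbT.
    move: ut; rewrite cat_uniq => /and3P[_ /hasPn nh _].
    by have := nh b; rewrite -{1}lt2 mem_last -wb w1 => /(_ isT).
  have vw : v = w by rewrite wb.
  rewrite vb; split => //; first by rewrite -wb.
  by rewrite -vb; apply: q2c; rewrite ?vw // -vw -lr1 -cat_cons mem_cat mem_last.
have := q2c w wT; rewrite -cat_cons mem_cat w2 orbT => /(_ isT) /= wy.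
by move: ur; rewrite /= mem_cat -wy w2 orbT.
Qed.

(** Induction on the number of edges, for directed relations. If after deletion of the edge from [x]
    to [y] a set [S] with fewer than [k] elements separates, then [x |: S] and [y |: S] have exactly
    [k] elements. Linkages from [A] to the first set and from the second set to [B] exist without
    that edge and are spliced along it. *)
Lemma menger e A B k : (forall S, separates e A B S -> k <= #|S|) ->
  exists B' p, [/\ B' \subset B, #|B'| = k & linkage e A B' p].
Proof.
have [n] := ubnP #|[set uv | e uv.1 uv.2]|.
elim: n => // n IH in e A B *; rewrite ltnS => en sepk.
case: (pickP [pred uv | e uv.1 uv.2 && (uv.1 != uv.2)]) => [[x y] /= /andP[exy xy]|e0]; last first.
  (* Only loops are left, so every path is constant and [A :&: B] separates. *)
  have: k <= #|A :&: B|.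
    apply: sepk => u p uA pp lB; rewrite /= !inE uA.
    suff lu : last u p = u by rewrite -lu lB.
    elim: p u {uA lB} pp => //= v p IHp u /andP[uv /IHp ->].
    by have := e0 (u, v); rewrite /= uv => /negbFE/eqP.
  move=> /subset_of_card [B' /subsetP sB' cB'].
  exists B', (fun b => [:: b]); split=> //.
    by apply/subsetP => b /sB'; rewrite inE => /andP[].
  split=> [b /sB'|b c v _ _]; first by rewrite inE /= eqxx => /andP[->].
  by rewrite !inE => /eqP -> /eqP.
set e' := del_edge e x y.
have e'n : #|[set uv | e' uv.1 uv.2]| < n.
  apply: leq_trans en; apply: proper_card; apply/properP; split.
    by apply/subsetP => -[u v]; rewrite !inE => /andP[].
  by exists (x, y); rewrite !inE //= /e' /del_edge !eqxx andbF.
have [sep'|] := EM (forall S, separates e' A B S -> k <= #|S|).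
  have [B' [p [sB cB lp]]] := IH e' A B e'n sep'.
  by exists B', p; split=> //; apply: linkage_sub lp; apply: del_edge_sub.
move=> /existsNP[S] /not_implyP[sepS /negP]; rewrite -ltnNge => Sk.
have sepx : separates e A B (x |: S).
  move=> u p uA pp lB; apply: contraT => /hasPn nh.
  have xp : x \notin belast u p.
    by apply/negP => /mem_belast /nh; rewrite /= !inE eqxx.
  have /hasP[w w1 w2] := sepS u p uA (path_del_edge_src y xp pp) lB.
  by have := nh w w1; rewrite /= in w2 *; rewrite inE w2 orbT.
have sepy : separates e A B (y |: S).
  move=> u p uA pp lB; apply: contraT => /hasPn nh.
  have yp : y \notin p.
    by apply/negP => yp; have := nh y; rewrite /= !inE yp eqxx orbT => /(_ isT).
  have /hasP[w w1 w2] := sepS u p uA (path_del_edge_tgt x yp pp) lB.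
  by have := nh w w1; rewrite /= in w2 *; rewrite inE w2 orbT.
have := sepk _ sepx; rewrite cardsU1 => kx.
have := sepk _ sepy; rewrite cardsU1 => ky.
have xS : x \notin S by case: (x \in S) kx => //; lia.
have yS : y \notin S by case: (y \in S) ky => //; lia.
have cS : #|S|.+1 = k by move: kx; rewrite xS; lia.
have [B1 [p [sB1 cB1 lp]]] : exists B' p, [/\ B' \subset x |: S, #|B'| = k & linkage e' A B' p].
  (* A separator towards [x |: S] in the smaller relation also separates [A] from [B] in [e]: up to
     its first vertex in [x |: S] a path cannot use the deleted edge, which starts at [x]. *)
  apply: IH e'n _ => T sepT; apply: sepk => u q uA pq lB.
  have [q1 [q2 [Eq lq1 nq1]]] := first_hit (sepx u q uA pq lB).
  have xq1 : x \notin belast u q1.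
    by apply/negP => xq; case/hasP: nq1; exists x => //; rewrite /= !inE eqxx.
  move: pq; rewrite Eq cat_path => /andP[pq1 _].
  have := sepT u q1 uA (path_del_edge_src y xq1 pq1) lq1.
  by rewrite -cat_cons has_cat => ->.
have {B1 sB1 cB1} lp : linkage e' A (x |: S) p.
  suff -> : x |: S = B1 by [].
  by apply/esym/eqP; rewrite eqEcard sB1 cardsU1 xS cB1 -cS add1n leqnn.
have [B' [q [sB' cB' lq]]] : exists B' q, [/\ B' \subset B, #|B'| = k & linkage e' (y |: S) B' q].
  apply: IH e'n _ => T sepT; apply: sepk => u q uA pq lB.
  have [q1 [q2 [Eq lq1 nq1]]] := last_hit (sepy u q uA pq lB).
  have yq2 : y \notin q2.
    by apply/negP => yq; case/hasP: nq1; exists y => //; rewrite /= !inE eqxx.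
  move: pq lB; rewrite Eq cat_path last_cat => /andP[_ pq2] lB.
  have := sepT _ q2 lq1 (path_del_edge_tgt x yq2 pq2) lB.
  rewrite -cat_cons has_cat [has _ (_ :: q2)]/= => /orP[h|->]; last by rewrite orbT.
  suff -> : has (mem T) (u :: q1) by [].
  by apply/hasP; exists (last u q1) => //; apply: mem_last.
have [q1 q2] := lq.
pose st b := head x (q b).
have stq b : b \in B' -> st b \in q b.
  by move/q1; rewrite /st; case: (q b) => //= ? ? _; rewrite mem_head.
have stS b : b \in B' -> st b \in y |: S.
  by move/q1; rewrite /st; case: (q b) => //= ? ? /and4P[].
have st_inj : {in B' &, injective st}.
  by move=> b c bB cB E; apply: (q2 _ _ (st b)) => //; [exact: stq|rewrite E; exact: stq].
have stim : st @: B' = y |: S.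
  apply/eqP; rewrite eqEcard; apply/andP; split.
    by apply/subsetP => _ /imsetP[b bB ->]; apply: stS.
  by rewrite card_in_imset // cB' cardsU1 yS -cS.
have qT d : d \in B' -> forall t, t \in y |: S -> t \in q d -> t = head t (q d).
  move=> dB t; rewrite -stim => /imsetP[c cB ->] /(q2 c d _ cB dB (stq c cB)) E.
  by rewrite -E /st; case: (q c) (q1 c cB).
have sepS' : separates e' A B' ((x |: S) :&: (y |: S)).
  move=> u r uA pr lB; have /hasP[w w1 w2] := sepS u r uA pr (subsetP sB' _ lB).
  by apply/hasP; exists w => //; rewrite /= !inE in w2 *; rewrite w2 !orbT.
have cross b c v := linkage_cross (b := b) (c := c) (v := v) sepS' lp q1 qT.
have headst c v : c \in B' -> head v (q c) = st c.
  by move/q1; rewrite /st; case: (q c).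
(* The deleted edge is reinstated in the single path through [y]. Every other path is glued at the
   vertex of [S] where its halves meet, and that vertex is dropped from the second half. *)
exists B', (fun b => if st b == y then p x ++ q b else p (st b) ++ behead (q b)).
have [p1 p2] := lp.
have xp b v : b \in B' -> st b = y -> v \in p x -> v \in q b -> False.
  move=> bB bx vp vq; have [] := cross x b v _ bB vp vq; first by rewrite setU11.
  move=> vx _; rewrite headst // bx => vy.
  by move: xy; rewrite -vx vy eqxx.
have sp b v : b \in B' -> st b != y -> v \in p (st b) -> v \in q b -> v = st b.
  move=> bB by' vp vq; have sS : st b \in S by have := stS b bB; rewrite !inE (negbTE by').
  by have [] := cross (st b) b v _ bB vp vq; rewrite // inE sS orbT.
have pq b v (s0 : V) : b \in B' -> s0 \in x |: S -> v \in p s0 -> v \in q b -> v = s0 /\ st b = s0.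
  move=> bB sS vp vq; have [vs _] := cross s0 b v sS bB vp vq.
  by rewrite headst // => vst; split=> //; rewrite -vst vs.
pose src b := if st b == y then x else st b.
have srcS b : b \in B' -> src b \in x |: S.
  move=> bB; rewrite /src; case: eqP => [_|/eqP ny]; first by rewrite setU11.
  by have := stS b bB; rewrite !inE (negbTE ny) => /= ->; rewrite orbT.
have src_inj : {in B' &, injective src}.
  move=> b c bB cB; rewrite /src; case: eqP => [by1|ny]; case: eqP => [cy|nc] E.
  - by apply: st_inj; rewrite // by1 cy.
  - by have := stS c cB; rewrite !inE -E (negbTE xS) (negbTE xy).
  - by have := stS b bB; rewrite !inE E (negbTE xS) (negbTE xy).
  - exact: st_inj.
split=> //; split.
  move=> b bB; have := p1 _ (srcS b bB); have := q1 b bB.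
  rewrite /src; case: eqP => [by1|nb].
    rewrite /st in by1; case Eq: (q b) by1 => [|y' t] // by1.
    have {by1} E : y' = y := by1; rewrite {}E in Eq *.
    case/and4P => _ pt /eqP lt ut.
    case Ep: (p x) => [|z r] // /and4P[zA pr /eqP lr ur].
    rewrite /= zA cat_path (sub_path _ pr) ?lr; last exact: del_edge_sub.
    rewrite /= exy (sub_path _ pt) ?last_cat /= ?lt ?eqxx /=; last exact: del_edge_sub.
    rewrite -[_ && uniq _]/(uniq ((z :: r) ++ (y :: t))) cat_uniq ur -Ep.
    rewrite ut andbT.
    by apply/hasPn => v vt; apply/negP => vp; apply: (xp b v bB _ vp); rewrite /st Eq.
  rewrite /st in nb *; case Eq: (q b) nb => [|y' t] // nb.
  case/and4P => _ pt /eqP lt ut.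
  case Ep: (p y') => [|z r] // /and4P[zA pr /eqP lr ur].
  rewrite /= zA cat_path (sub_path _ pr) ?lr; last exact: del_edge_sub.
  rewrite (sub_path _ pt) ?last_cat ?lr ?lt ?eqxx /=; last exact: del_edge_sub.
  rewrite -[_ && uniq _]/(uniq ((z :: r) ++ t)) cat_uniq ur -Ep.
  move: ut; rewrite cons_uniq => /andP[yt ->]; rewrite andbT.
  apply/hasPn => v vt; apply/negP => vp.
  have vy : v = st b by apply: (sp b v bB); rewrite /st Eq ?inE ?vt ?orbT //; apply/eqP.
  by rewrite /st Eq /= in vy; rewrite -vy vt in yt.
have mem_r b v : b \in B' -> v \in (if st b == y then p x ++ q b else p (st b) ++ behead (q b)) ->
    v \in p (src b) \/ v \in q b.
  move=> bB; rewrite /src; case: ifP => _; rewrite mem_cat => /orP[]; try by [left|right].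
  by move/mem_behead; right.
have pq_case b c v : b \in B' -> c \in B' -> v \in p (src b) -> v \in q c -> b = c.
  move=> bB cB vp vq; have [vs stc] := pq c v _ cB (srcS b bB) vp vq.
  move: stc; rewrite /src; case: eqP => [by1|nb] stc; last by apply: st_inj.
  by have := stS c cB; rewrite !inE stc (negbTE xS) (negbTE xy).
move=> b c v bB cB /(mem_r b v bB) vb /(mem_r c v cB) vc.
case: vb vc => [vb|vb] [vc|vc].
- by apply: src_inj => //; apply: (p2 _ _ v) => //; apply: srcS.
- exact: (pq_case b c v).
- by apply/esym; apply: (pq_case c b v).
- exact: (q2 b c v).
Qed.
End Menger.

(** * Tree decompositions and the grid theorem *)

Section Connectivity.
Variables (V : finType) (e : rel V).
Hypothesis e_sym : symmetric e.
Implicit Types (A B C D S U X : {set V}).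

Definition inset A : rel V := fun x y => [&& x \in A, y \in A & e x y].
Definition conn A : Prop := {in A &, forall x y, connect (inset A) x y}.
Definition nbh C : {set V} := [set x | (x \notin C) && [exists y in C, e x y]].
Definition component U C : Prop :=
  [/\ C \subset U, C != set0, conn C & forall x y, x \in C -> y \in U -> e x y -> y \in C].

Lemma inset_sym A : symmetric (inset A).
Proof. by move=> x y; rewrite /inset e_sym andbCA. Qed.

Lemma connect_inset_sym A : connect_sym (inset A).
Proof. exact/sym_connect_sym/inset_sym. Qed.

Lemma inset_sub A B : A \subset B -> subrel (inset A) (inset B).
Proof. by move=> /subsetP s x y /and3P[/s xA /s yA exy]; apply/and3P. Qed.

Lemma connect_inset_mono A B : A \subset B -> subrel (connect (inset A)) (connect (inset B)).
Proof.
by move=> s; apply: connect_sub => x y /(inset_sub s) xy; apply: connect1.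
Qed.

Lemma path_inset A x p : x \in A -> path (inset A) x p -> {subset x :: p <= A}.
Proof.
elim: p x => [|y p IH] x xA /=; first by move=> _ z; rewrite inE => /eqP ->.
case/andP => /and3P[_ yA _] /(IH _ yA) s z; rewrite inE => /orP[/eqP ->//|]; exact: s.
Qed.

Lemma path_inset_e A x p : path (inset A) x p -> path e x p.
Proof. by apply: sub_path => u v /and3P[]. Qed.

Lemma path_insetI A x p : {subset x :: p <= A} -> path e x p -> path (inset A) x p.
Proof.
elim: p x => //= y p IH x s /andP[exy pp]; rewrite IH //; last by move=> z zp; apply: s; rewrite inE zp orbT.
by rewrite andbT /inset exy !s // !inE eqxx ?orbT.
Qed.

Lemma conn1 x : conn [set x].
Proof. by move=> y z; rewrite !inE => /eqP -> /eqP ->; apply: connect0. Qed.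

Lemma conn_union A B x y : conn A -> conn B -> x \in A -> y \in B -> (x == y) || e x y -> conn (A :|: B).
Proof.
move=> cA cB xA yB xy.
have AU := subsetUl A B; have BU := subsetUr A B.
have cxy : connect (inset (A :|: B)) x y.
  case/orP: xy => [/eqP ->|xy]; first exact: connect0.
  by apply: connect1; rewrite /inset !inE xA yB xy orbT.
have toy z : z \in A :|: B -> connect (inset (A :|: B)) z y.
  rewrite inE => /orP[zA|zB]; last exact: connect_inset_mono BU _ _ (cB _ _ zB yB).
  exact: connect_trans (connect_inset_mono AU (cA _ _ zA xA)) cxy.
move=> u v /toy uy /toy vy; apply: connect_trans uy _.
by rewrite connect_inset_sym.
Qed.

Lemma conn_path x p : path e x p -> conn [set z in x :: p].
Proof.
elim: p x => [|y p IH] x /=; first by move=> _; rewrite (_ : [set _ in _] = [set x]) => [|]; [exact: conn1|apply/setP => z; rewrite !inE].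
case/andP => exy /IH c.
have -> : [set z in [:: x, y & p]] = [set x] :|: [set z in y :: p].
  by apply/setP => z; rewrite !inE.
by apply: (conn_union (x := x) (y := y)); rewrite ?inE ?eqxx ?exy ?orbT //; apply: conn1.
Qed.

Lemma comp_exists U x : x \in U -> exists2 C, component U C & x \in C.
Proof.
move=> xU; pose C := [set y in U | connect (inset U) x y].
have xC : x \in C by rewrite !inE xU connect0.
exists C => //; split.
- by apply/subsetP => y; rewrite inE => /andP[].
- by apply/set0Pn; exists x.
- have toC y : y \in C -> connect (inset C) x y.
    rewrite inE => /andP[yU /connectP[p pp ly]].
    apply/connectP; exists p => //; apply: path_insetI (path_inset_e pp) => z zp.
    rewrite inE (path_inset xU pp zp) /=.
    by move: pp; case/splitPl: zp => p1 p2 <-; rewrite cat_path => /andP[pp _]; apply/connectP; exists p1.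
  by move=> u v /toC; rewrite connect_inset_sym => cu /toC; apply: connect_trans.
- move=> u v; rewrite !inE => /andP[uU xu] vU euv; rewrite vU.
  by apply: connect_trans xu _; apply: connect1; rewrite /inset uU vU.
Qed.

Lemma conn_closed C D : conn C -> D \subset C -> D != set0 ->
  (forall x y, x \in D -> y \in C -> e x y -> y \in D) -> D = C.
Proof.
move=> cC DC /set0Pn[x xD] cl; apply/eqP; rewrite eqEsubset DC; apply/subsetP => y yC.
have /connectP[p pp ->] := cC _ _ (subsetP DC _ xD) yC.
elim: p x xD pp => //= z p IH x xD /andP[/and3P[_ zC exz]]; apply: IH; exact: cl exz.
Qed.

(* Recursive form of a tree decomposition with bags of size at most k: S is the current bag and U is the set
   of vertices that have not occurred in a bag yet. *)
Inductive dec k : {set V} -> {set V} -> Prop :=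
| dec0 S of #|S| <= k : dec k set0 S
| dec_forget U S S' of S' \subset S & #|S| <= k &
    (forall x y, x \in U -> e x y -> y \in U :|: S') & dec k U S' : dec k U S
| dec_intro U S v of v \in U & #|S| <= k & dec k (U :\ v) (v |: S) : dec k U S
| dec_union U1 U2 S of [disjoint U1 & U2] &
    (forall x y, x \in U1 -> y \in U2 -> ~~ e x y) & dec k U1 S & dec k U2 S : dec k (U1 :|: U2) S.

Lemma dec_card k U S : dec k U S -> #|S| <= k.
Proof. by elim. Qed.

Lemma dec_components k U S : #|S| <= k ->
  (forall C, component U C -> dec k C S) -> dec k U S.
Proof.
move=> Sk; have [n] := ubnP #|U|; elim: n => // n IH in U *; rewrite ltnS => Un cU.
case: (set_0Vmem U) => [->|[x xU]]; first exact: dec0.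
have [C cC xC] := comp_exists xU; have [CU C0 connC clC] := cC.
have -> : U = C :|: (U :\: C) by apply/setP => z; rewrite !inE; case zC: (z \in C) => //; rewrite (subsetP CU).
apply: dec_union; last 2 first.
- exact: cU.
- apply: IH => [|D [DU D0 connD clD]].
    apply: leq_trans Un; apply: proper_card; apply/properP; split; first exact: subsetDl.
    by exists x; rewrite // inE xC.
  apply: cU; split=> //; first exact: subset_trans DU (subsetDl _ _).
  move=> u v uD vU euv; apply: (clD u) => //; rewrite inE vU andbT; apply/negP => vC.
  have uU := subsetP DU _ uD; rewrite inE in uU; case/andP: uU => /negP uC uU.
  by apply: uC; apply: (clC v); rewrite // e_sym.
- by rewrite -setI_eq0; apply/eqP/setP => z; rewrite !inE; case: (z \in C).
- move=> u v uC; rewrite inE => /andP[vC vU]; apply/negP => euv; case/negP: vC; exact: clC euv.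
Qed.

Lemma dec_intros k U S X : S \subset U -> #|S :|: X| <= k -> dec k (U :\: S) (S :|: X) -> dec k U X.
Proof.
have [n] := ubnP #|S|; elim: n => // n IH in U S X *; rewrite ltnS => Sn SU.
case: (set_0Vmem S) => [->|[s sS] Sk D]; first by rewrite set0U setD0.
have Xk : #|X| <= k by apply: leq_trans Sk; apply/subset_leq_card/subsetUr.
apply: (dec_intro (v := s)) => //; first exact: (subsetP SU).
have E : (S :\ s) :|: (s |: X) = S :|: X.
  by apply/setP => z; rewrite !inE; case: eqP => //= ->; rewrite sS.
apply: (IH _ (S :\ s)); rewrite ?E //.
- by rewrite (cardsD1 s) sS in Sn.
- exact: setSD.
- suff -> : U :\ s :\: (S :\ s) = U :\: S by [].
  by apply/setP => z; rewrite !inE; case: eqP => //= ->; rewrite sS.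
Qed.

Lemma separates_sym A B S (W : {set V}) : separates (inset W) A B S -> separates (inset W) B A S.
Proof.
move=> sep x p xB pp lA.
have := sep (last x p) (rev (belast x p)) lA.
rewrite rev_path (eq_path (e' := inset W)); last by move=> u v; rewrite /= inset_sym.
move=> /(_ pp); have -> : last (last x p) (rev (belast x p)) = x.
  by case: p {pp lA} => //= y p; rewrite rev_cons last_rcons.
move=> /(_ xB) /hasP[z zz zS]; apply/hasP; exists z => //.
move: zz; rewrite -[_ :: rev _]rev_rcons -lastI mem_rev; exact.
Qed.

End Connectivity.

(** * Binary trees in a graph: growing them and dividing them *)

Section BinaryTrees.
Variables (V : finType) (e : rel V).
Hypothesis e_sym : symmetric e.
Implicit Types (A C S T U X Y Z : {set V}).

(** At most two children at each node: the bounded degree is what allows a tree to be divided into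
    pieces of comparable weight. *)
Inductive btree := Empty | Node of V & btree & btree.

Fixpoint nodes t : seq V := if t is Node v l r then v :: nodes l ++ nodes r else [::].

Definition root_adj v t : bool := if t is Node w _ _ then e v w else true.

Fixpoint tree_in t : bool :=
  if t is Node v l r then [&& root_adj v l, root_adj v r, tree_in l & tree_in r] else true.

Definition is_empty t := if t is Empty then true else false.

(** A node is open while one of its child slots is free. A leaf has two free slots, so it stays open
    after one child has been attached to it. *)
Fixpoint open t : seq V :=
  if t is Node v l r then
    (if is_empty l || is_empty r then [:: v] else [::]) ++ open l ++ open r
  else [::].
Fixpoint leaves t : seq V :=
  if t is Node v l r then
    (if is_empty l && is_empty r then [:: v] else [::]) ++ leaves l ++ leaves r
  else [::].

Lemma leaves_open t : {subset leaves t <= open t}.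
Proof.
elim: t => //= v l IHl r IHr x; rewrite !mem_cat => /or3P[|/IHl ->|/IHr ->]; rewrite ?orbT //.
by case: (is_empty l); case: (is_empty r) => //= ->.
Qed.

Lemma open_nodes t : {subset open t <= nodes t}.
Proof.
elim: t => //= v l IHl r IHr x; rewrite inE !mem_cat => /or3P[|/IHl ->|/IHr ->]; rewrite ?orbT //.
by case: ifP => // _; rewrite inE => ->.
Qed.

Definition good_tree t : Prop := tree_in t /\ uniq (nodes t).

(** The clauses on [open] and [leaves] record what survives: [x] may have used its last free slot,
    unless it was a leaf, and it is the only node that may cease to be open or a leaf. *)
Lemma attach_leaf x v t : good_tree t -> x \in open t -> e x v -> v \notin nodes t ->
  exists t', [/\ good_tree t', perm_eq (nodes t') (v :: nodes t), v \in leaves t',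
    {in open t, forall y, (y != x) || (x \in leaves t) -> y \in open t'} &
    {in leaves t, forall y, y != x -> y \in leaves t'}].
Proof.
(* The induction also needs an unchanged root, so that the enlarged subtree still fits below its
   parent. *)
suff H : tree_in t -> uniq (nodes t) -> x \in open t -> e x v -> v \notin nodes t ->
  exists t', [/\ tree_in t', ~~ is_empty t', forall u, root_adj u t' = root_adj u t,
    perm_eq (nodes t') (v :: nodes t) &
    [/\ v \in leaves t',
    {in open t, forall y, (y != x) || (x \in leaves t) -> y \in open t'} &
    {in leaves t, forall y, y != x -> y \in leaves t'}]].
  move=> [H1 H2] H3 H4 H5; have [t' [T1 _ _ T2 [T3 T4 T5]]] := H H1 H2 H3 H4 H5.
  exists t'; split=> //; split=> //; by rewrite (perm_uniq T2) /= H5.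
elim: t => // w l IHl r IHr /= /and4P[wl wr tl tr] /andP[wlr].
rewrite cat_uniq => /and3P[ul /hasPn lr ur] xo exv.
rewrite inE mem_cat !negb_or => /and3P[vw vl vr].
have [xw|xw] := eqVneq x w.
  subst w; have xl : x \notin nodes l by apply: contraNN wlr; rewrite mem_cat => ->.
  have xr : x \notin nodes r by apply: contraNN wlr; rewrite mem_cat => ->; rewrite orbT.
  have xlr : x \notin open l ++ open r.
    by rewrite mem_cat negb_or; apply/andP; split; [apply: contraNN xl|apply: contraNN xr]; apply: open_nodes.
  have xlr' : x \notin leaves l ++ leaves r.
    by apply: contraNN xlr; rewrite !mem_cat => /orP[]/leaves_open ->; rewrite ?orbT.
  case: ifP xo => [lre _|_ xo]; last by case/negP: xlr.
  rewrite [x \in _ ++ (leaves _ ++ _)]mem_cat (negbTE xlr') orbF.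
  case: l {IHl} => [|l0 l1 l2] in wl tl ul lr vl wlr xl xlr xlr' lre *.
    exists (Node x (Node v Empty Empty) r); split=> //=; first by rewrite exv wr tr.
      by apply/permP => a /=; rewrite addnCA.
    split; first by rewrite mem_head.
      move=> y; rewrite !inE; case: (is_empty r) => /=; rewrite !inE; first by case/orP => ->; rewrite ?orbT.
      by case/orP => [->//|->]; rewrite orbT.
    move=> y; case: (is_empty r) => /=; rewrite !inE => yr yx; last by rewrite yr orbT.
    by case/orP: yr yx => [->|->]; rewrite ?orbT.
  case: r {IHr} => [|r0 r1 r2] in wr tr ur lr vr wlr xr xlr xlr' lre *; last by [].
  exists (Node x (Node l0 l1 l2) (Node v Empty Empty)); split=> //=.
  - by move: wl tl => /= -> /and4P[-> -> -> ->]; rewrite exv.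
  - by rewrite ?cats0 -!cat_cons cats1 perm_rcons.
  split; first by rewrite !mem_cat inE eqxx !orbT.
    move=> y yo; rewrite /= ?orbF => yx; move: yo; rewrite inE (negbTE yx) /= ?cats0.
    by rewrite !(mem_cat, inE) /= => ->; rewrite ?orbT.
  by move=> y; rewrite ?cats0 !(mem_cat, inE) /= => ->.
have xw' : x \in open l ++ open r.
  by move: xo; rewrite mem_cat; case: ifP => //= _; rewrite inE (negbTE xw).
have xleaf : (x \in leaves l ++ leaves r) =
   (x \in (if is_empty l && is_empty r then [:: w] else [::]) ++ leaves l ++ leaves r).
  by rewrite [in RHS]mem_cat; case: ifP => //= _; rewrite inE (negbTE xw).
rewrite -xleaf.
have dis y : y \in nodes l -> y \in nodes r -> False by move=> yl yr; move: (lr y yr); rewrite /= yl.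
move: xw'; rewrite mem_cat => /orP[xl|xr].
  have [l' [L1 L2 L3 L4 [L5 L6 L7]]] := IHl tl ul xl exv vl.
  exists (Node w l' r); split=> //=; first by rewrite L3 wl wr L1.
    by apply/permP => a /=; have /permP/(_ a) /= := L4; rewrite !count_cat => ->; rewrite -addnA addnCA.
  have el : is_empty l = false by case: (l) xl.
  rewrite el /= (negbTE L2) /=; split; first by rewrite mem_cat L5.
    move=> y; rewrite !mem_cat => /or3P[->//|yl|->]; last by rewrite !orbT.
    move=> h; rewrite (L6 y yl) ?orbT //; case/orP: h => [->//|].
    case/orP=> [->|xr]; first by rewrite orbT.
    by case: (dis x (open_nodes xl) (open_nodes (leaves_open xr))).
  by move=> y; rewrite !mem_cat => /orP[yl yx|->]; rewrite ?orbT // (L7 y yl yx).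
have [r' [L1 L2 L3 L4 [L5 L6 L7]]] := IHr tr ur xr exv vr.
exists (Node w l r'); split=> //=; first by rewrite L3 wl wr tl L1.
  by apply/permP => a /=; have /permP/(_ a) /= := L4; rewrite !count_cat => ->; rewrite [count _ _ + _]addnCA addnCA.
have er : is_empty r = false by case: (r) xr.
rewrite er !andbF !orbF /= (negbTE L2) andbF /=; split; first by rewrite mem_cat L5 orbT.
  move=> y; rewrite orbF !mem_cat => /or3P[->//|->|yl]; first by rewrite orbT.
  move=> h; rewrite (L6 y yl) ?orbT //; case/orP: h => [->//|].
  case/orP=> [xl|->]; last by rewrite orbT.
  by case: (dis x (open_nodes (leaves_open xl)) (open_nodes xr)).
by move=> y; rewrite !mem_cat => /orP[->//|yl yx]; rewrite (L7 y yl yx) orbT.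
Qed.

Lemma attach_path x s t : good_tree t -> x \in open t -> path e x s -> s != [::] -> uniq s ->
  {in s, forall v, v \notin nodes t} ->
  exists t', [/\ good_tree t', nodes t' =i s ++ nodes t, last x s \in leaves t',
    {in open t, forall y, (y != x) || (x \in leaves t) -> y \in open t'} &
    {in leaves t, forall y, y != x -> y \in leaves t'}].
Proof.
elim: s x t => // v s IH x t gt xo /= /andP[exv ps] _ /andP[vs us] dis.
have [t1 [g1 n1 v1 o1 l1]] := attach_leaf gt xo exv (dis v (mem_head _ _)).
case: (eqVneq s [::]) => [->|s0].
  by exists t1; split=> // y; rewrite (perm_mem n1).
have [|t2 [g2 n2 v2 o2 l2]] := IH v t1 g1 (leaves_open v1) ps s0 us.
  move=> w ws; rewrite (perm_mem n1) inE negb_or dis ?inE ?ws ?orbT //.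
  by rewrite andbT; apply: contraNneq vs => <-.
have vt y : y \in nodes t -> y != v.
  by move=> yt; apply: contraNneq (dis v (mem_head _ _)) => <-.
exists t2; split=> //.
- by move=> y; rewrite n2 !(mem_cat, inE) (perm_mem n1) inE orbCA.
- by move=> y yo h; apply: o2; [exact: o1|rewrite v1 orbT].
- by move=> y yl yx; apply: l2; [exact: l1|exact/vt/open_nodes/leaves_open].
Qed.

Lemma attach_paths (ss : seq V) (y : V -> V) (r : V -> seq V) t : good_tree t -> uniq ss ->
  {in ss, forall s, [/\ y s \in open t, path e (y s) (r s), r s != [::], uniq (r s) & last (y s) (r s) = s]} ->
  {in ss, forall s v, v \in r s -> v \notin nodes t} ->
  {in ss &, forall s s' v, v \in r s -> v \in r s' -> s = s'} ->
  {in ss &, injective y} ->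
  exists t', [/\ good_tree t', forall v, v \in nodes t' -> v \in nodes t \/ exists2 s, s \in ss & v \in r s,
    {subset nodes t <= nodes t'}, {subset ss <= leaves t'} &
    {in open t, forall x, (forall s, s \in ss -> x != y s) -> x \in open t'}].
Proof.
move=> gt; elim: ss => [|s ss IH] /=.
  by move=> _ _ _ _ _; exists t; split=> // v; left.
case/andP => sss uss H1 H2 H3 H4.
have [||||t1 [g1 n1 n1' l1 o1]] := IH uss.
- by move=> u us; apply: H1; rewrite inE us orbT.
- by move=> u us; apply: H2; rewrite inE us orbT.
- by move=> u u' us us'; apply: H3; rewrite inE ?us ?us' orbT.
- by move=> u u' us us'; apply: H4; rewrite inE ?us ?us' orbT.
have ssub u : u \in ss -> u \in s :: ss by rewrite inE => ->; rewrite orbT.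
have [so sp s0 su sl] := H1 s (mem_head _ _).
have lastr u : u \in s :: ss -> u \in r u.
  by move=> uss'; have [_ _ r0 _ {1}<-] := H1 u uss'; case: (r u) r0 => //= a b _; apply: mem_last.
have sne u : u \in ss -> s != u by move=> us; apply: contraNneq sss => ->.
have [||t2 [g2 n2 l2 o2 l2']] := @attach_path (y s) (r s) t1 g1 _ sp s0 su.
- apply: o1 => // u us; apply: contraNneq (sne u us) => E.
  by apply/eqP; apply: H4 => //; rewrite ?mem_head ?ssub.
- move=> v vr; apply/negP => /n1[|[u us vu]]; first by apply/negP; apply: (H2 s); rewrite ?mem_head.
  by move/eqP: (sne u us); apply; apply: (H3 s u _ _ v); rewrite ?mem_head ?ssub.
exists t2; split=> //.
- move=> v; rewrite n2 mem_cat => /orP[vs|/n1[|[u us vu]]]; [|by left|].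
    by right; exists s; rewrite ?mem_head.
  by right; exists u; rewrite ?ssub.
- by move=> v vt; rewrite n2 mem_cat n1' ?orbT.
- move=> u; rewrite inE => /orP[/eqP ->|us]; first by rewrite -{1}sl.
  apply: l2' (l1 u us) _; apply/negP => /eqP E.
  by have := H2 u (ssub u us) u (lastr u (ssub u us)); rewrite E open_nodes.
- move=> x xo h; apply: o2; last by rewrite h ?mem_head.
  by apply: o1 => // u us; apply: h; apply: ssub.
Qed.

(** Pieces are cut off from the leaves upwards; [R] is the unfinished piece at the root. A node
    together with the unfinished pieces of its children has at most [1 + 2 * (k - 1)] elements of
    [X], so a piece that is cut off as soon as it has [k] of them never has more than [2 * k]. The
    counting clause expresses that the pieces are disjoint and lie in the tree. *)
Lemma split_tree k X t : 0 < k -> tree_in t -> uniq (nodes t) ->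
  exists (ps : seq {set V}) (R : {set V}),
  [/\ forall P, P \in R :: ps -> conn e P,
      if t is Node w _ _ then R = set0 \/ w \in R else R = set0,
      forall P, P \in ps -> k <= #|P :&: X|,
      forall x, count (fun P : {set V} => x \in P) (R :: ps) <= count_mem x (nodes t) &
      count (mem X) (nodes t) <= size ps * (2 * k) + #|R :&: X| /\ #|R :&: X| < k].
Proof.
move=> k0; elim: t => [_ _|v l IHl r IHr /= /and4P[vl vr /IHl HL /IHr HR]].
  exists [::], set0; split=> //; last by rewrite set0I cards0.
    by move=> P; rewrite inE => /eqP -> x y; rewrite inE.
  by move=> x; rewrite /= inE.
case/andP; rewrite mem_cat negb_or cat_uniq => /andP[v'l v'r] /and3P[ul /hasPn lr ur].
have [pl [L [l1 l2 l3 l4 [l5 l6]]]] := HL ul.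
have [pr [R [r1 r2 r3 r4 [r5 r6]]]] := HR ur.
have Ll x : x \in L -> x \in nodes l.
  by move=> xL; rewrite -has_pred1 has_count; apply: leq_trans (l4 x); rewrite /= xL.
have Rr x : x \in R -> x \in nodes r.
  by move=> xR; rewrite -has_pred1 has_count; apply: leq_trans (r4 x); rewrite /= xR.
pose M := v |: (L :|: R).
have join (N P : {set V}) t : v \in N -> conn e N -> conn e P -> root_adj v t ->
    (if t is Node w _ _ then P = set0 \/ w \in P else P = set0) -> conn e (N :|: P).
  case: t => [|w a b] vN cN cP /= vt; first by move=> ->; rewrite setU0.
  case=> [->|wP]; first by rewrite setU0.
  by apply: (conn_union e_sym (x := v) (y := w)); rewrite // vt orbT.
have cM : conn e M.
  rewrite /M setUA; apply: (join _ _ r); rewrite ?inE ?eqxx //.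
    by apply: (join _ _ l); rewrite ?inE ?eqxx //; [exact: conn1|apply: l1; rewrite mem_head].
  by apply: r1; rewrite mem_head.
have MX : #|M :&: X| = (v \in X) + (#|L :&: X| + #|R :&: X|).
  have -> : M :&: X = ([set v] :&: X) :|: ((L :&: X) :|: (R :&: X)) by rewrite -!setIUl.
  have -> : (v \in X) = #|[set v] :&: X| :> nat.
    case vX: (v \in X); last by rewrite (_ : _ :&: _ = set0) ?cards0 //; apply/setP => x; rewrite !inE; case: eqP => // ->; rewrite vX.
    by rewrite (_ : _ :&: _ = [set v]) ?cards1 //; apply/setP => x; rewrite !inE; case: eqP => // ->; rewrite vX.
  rewrite !cardsU (_ : (L :&: X) :&: (R :&: X) = set0) ?cards0 ?subn0; last first.
    apply/setP => x; rewrite !inE; apply/negP => /andP[/andP[/Ll xl _] /andP[/Rr xr _]].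
    by move: (lr x xr); rewrite /= xl.
  rewrite (_ : ([set v] :&: X) :&: _ = set0) ?cards0 ?subn0 //.
  apply/setP => x; rewrite !inE; apply/negP => /andP[/andP[/eqP -> _]] /orP[]/andP[].
    by move/Ll; rewrite (negbTE v'l).
  by move/Rr; rewrite (negbTE v'r).
have cM' x : (x \in M) <= (v == x) + ((x \in L) + (x \in R)).
  by rewrite !inE eq_sym; case: eqP => //; case: (x \in L); case: (x \in R).
have aux (a b c d p q u w : nat) : a <= b + (c + d) -> c + p <= u -> d + q <= w -> a + (p + q) <= b + (u + w) by clear; lia.
have cps P : P \in pl ++ pr -> conn e P.
  by rewrite mem_cat => /orP[h|h]; [apply: l1|apply: r1]; rewrite inE h orbT.
have kps P : P \in pl ++ pr -> k <= #|P :&: X| by rewrite mem_cat => /orP[/l3|/r3].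
case: (leqP k #|M :&: X|) => Mk.
  exists (M :: (pl ++ pr)), set0; split.
  - move=> P; rewrite !inE => /or3P[/eqP ->|/eqP ->//|/cps //].
    by move=> x y; rewrite inE.
  - by left.
  - by move=> P; rewrite inE => /orP[/eqP ->//|/kps].
  - by move=> x; rewrite /= !count_cat inE; apply: (aux _ _ _ _ _ _ _ _ (cM' x) (l4 x) (r4 x)).
  - rewrite set0I cards0; split=> //; rewrite /= count_cat size_cat.
    move: l5 l6 r5 r6 => /=; have : (v \in X) <= 1 by case: (v \in X).
    move: (v \in X : nat) (count _ (nodes l)) (count _ (nodes r)) #|L :&: X| #|R :&: X|.
    by move: (size pl) (size pr); clear; move=> *; nia.
exists (pl ++ pr), M; split=> //.
- by move=> P; rewrite inE => /orP[/eqP ->|/cps].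
- by right; rewrite !inE eqxx.
- by move=> x; rewrite /= !count_cat; apply: (aux _ _ _ _ _ _ _ _ (cM' x) (l4 x) (r4 x)).
- split=> //; rewrite /= count_cat size_cat MX.
  move: l5 r5 => /=; move: (v \in X : nat) (count _ (nodes l)) (count _ (nodes r)) #|L :&: X| #|R :&: X|.
  by move: (size pl) (size pr); clear; move=> *; nia.
Qed.

Lemma split_tree_sets k m X t : 0 < k -> good_tree t -> {subset X <= nodes t} ->
  m * (2 * k) + k <= #|X| ->
  exists A : nat -> {set V}, [/\ forall i, i < m -> conn e (A i),
    forall i, i < m -> {subset A i <= nodes t},
    forall i, i < m -> k <= #|A i :&: X| &
    forall i j, i < m -> j < m -> i != j -> [disjoint A i & A j]].
Proof.
move=> k0 [tt ut] Xt mX; have [ps [R [p1 _ p3 p4 [p5 p6]]]] := split_tree X k0 tt ut.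
have sm : m <= size ps.
  have cX : count (mem X) (nodes t) = #|X|.
    rewrite -size_filter -(card_uniqP _) ?filter_uniq //; apply: eq_card => x.
    by rewrite mem_filter /=; case xX: (x \in X) => //=; apply: Xt.
  by rewrite cX in p5; nia.
have nps i : i < m -> nth set0 ps i \in ps by move=> im; rewrite mem_nth // (leq_trans im).
exists (nth set0 ps); split.
- by move=> i /nps ips; apply: p1; rewrite inE ips orbT.
- move=> i /nps ips x xi; rewrite -has_pred1 has_count; apply: leq_trans (p4 x).
  by rewrite -has_count; apply/hasP; exists (nth set0 ps i); rewrite // inE ips orbT.
- by move=> i /nps/p3.
- have main i j : i < j -> j < m -> [disjoint nth set0 ps i & nth set0 ps j].
    move=> ij jm; rewrite -setI_eq0; apply/eqP/setP => x; rewrite !inE; apply/negP => /andP[xi xj].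
    have := p4 x; rewrite (count_uniq_mem _ ut) /= => h.
    have : 2 <= count (fun P : {set V} => x \in P) ps.
      have jp := leq_trans jm sm.
      rewrite -(cat_take_drop j ps) count_cat (drop_nth set0 jp) /= xj addnA.
      suff : 0 < count (fun P : {set V} => x \in P) (take j ps) by lia.
      rewrite -has_count; apply/hasP; exists (nth set0 ps i) => //.
      by rewrite -(nth_take _ ij) mem_nth // size_take jp.
    by case: (x \in nodes t) h => /=; lia.
  move=> i j im jm; rewrite neq_ltn => /orP[ij|ji]; first exact: main.
  by rewrite disjoint_sym; apply: main.
Qed.
End BinaryTrees.

(** * Meshes: a tree with a highly linked set of nodes, or else a tree decomposition *)

Section Mesh.
Variables (V : finType) (e : rel V) (h k : nat).
Hypothesis e_sym : symmetric e.
Hypothesis k_gt0 : 0 < k.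
Implicit Types (A B C S T U X Y Z W : {set V}).

Definition linked_through C X : Prop :=
  forall Y Z, Y \subset X -> Z \subset X -> [disjoint Y & Z] -> #|Y| = k -> #|Z| = k ->
  exists p, linkage (inset e (C :|: (Y :|: Z))) Y Z p.

(** The linkages run through [C], off the tree, and may meet the tree only in [Y :|: Z]. Tree and
    linkages can thus serve as separate parts of a minor. *)
Definition mesh : Prop := exists C X t,
  [/\ good_tree e t, {subset X <= nodes t}, {in C, forall v, v \notin nodes t}, #|X| = h &
      linked_through C X].

Lemma min_separator (r : rel V) A B : exists2 S, separates r A B S &
  forall S', separates r A B S' -> #|S| <= #|S'|.
Proof.
have sA : `[< separates r A B A >] by apply/asboolP => x p xA _ _; rewrite /= xA.
case: (arg_minnP (fun S : {set V} => #|S|) (P := fun S => `[< separates r A B S >]) sA) => S /asboolP sS mS.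
by exists S => // S' sS'; apply: mS; apply/asboolP.
Qed.

Lemma linkage_to_separator (r : rel V) A B S : separates r A B S ->
  (forall S', separates r A B S' -> #|S| <= #|S'|) -> exists p, linkage r A S p.
Proof.
move=> sS mS; have [|B' [p [BS cB lp]]] := @menger V r A S #|S|.
  move=> T sT; apply: mS => x p xA pp lB.
  have [p1 [p2 [Ep l1 _]]] := first_hit (sS x p xA pp lB).
  move: pp; rewrite Ep cat_path => /andP[pp1 _].
  by have := sT x p1 xA pp1 l1; rewrite -cat_cons has_cat => ->.
exists p; suff -> : S = B' by [].
by apply/esym/eqP; rewrite eqEcard BS cB leqnn.
Qed.

(* One component C' of C - S on the Z-side of a minimum Y-Z separator S: the tree is extended by the
   linkage from Y to S. *)
Lemma extend_tree C X t Y Z S D : good_tree e t -> {in C, forall v, v \notin nodes t} ->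
  {subset X <= open t} -> Y \subset X -> Z \subset X -> conn e C -> X \subset nbh e C ->
  (forall x, x \in X -> x \notin C) ->
  separates (inset e (C :|: (Y :|: Z))) Y Z S -> S \subset C :|: (Y :|: Z) ->
  (exists p, linkage (inset e (C :|: (Y :|: Z))) Y S p) ->
  component e (C :\: S) D -> (forall x y, x \in D -> y \in Y -> y \notin S -> ~~ e x y) ->
  nbh e D \subset X :|: S -> S :&: C != set0 ->
  exists t', [/\ good_tree e t', {in D, forall v, v \notin nodes t'}, {subset nbh e D <= open t'} &
    exists2 x, x \in nbh e D & x \in leaves t'].
Proof.
move=> gt Ct Xo YX ZX cC XN XC sep SW [p [p1 p2]] [DC D0 cD clD] DY ND SC.
set W := C :|: (Y :|: Z) in sep SW p1 p2.
have lasthit s : s \in S -> exists y r, [/\ y \in Y, y \in p s, path (inset e W) y r,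
    last y r = s & [/\ uniq (y :: r), {subset r <= p s} & {in r, forall v, v \notin Y}]].
  move=> sS; have := p1 s sS; case Ep: (p s) => [|x q] // /and4P[xY pq /eqP lq uq].
  have hY : has (mem Y) (x :: q) by rewrite /= xY.
  have [q1 [q2 [Eq lq1 nq2]]] := last_hit hY.
  exists (last x q1), q2; rewrite Eq -cat_cons in uq *; split=> //.
  - by rewrite mem_cat mem_last.
  - by move: pq; rewrite Eq cat_path => /andP[].
  - by rewrite -lq Eq last_cat.
  - split.
    + move: uq; rewrite lastI cat_rcons cat_uniq => /and3P[_ _]; exact.
    + by move=> v vq; rewrite mem_cat vq orbT.
    + by move=> v vq; apply: (hasPn nq2).
pose good s y r := [/\ y \in Y, y \in p s, path (inset e W) y r,
    last y r = s & [/\ uniq (y :: r), {subset r <= p s} & {in r, forall v, v \notin Y}]].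
have /choice[f fP] : forall s, exists yr : V * seq V, s \in S -> good s yr.1 yr.2.
  move=> s.
  case sS: (s \in S); last by exists (s, [::]).
  by have [y [r H]] := lasthit s sS; exists (y, r).
have ps_end s : s \in S -> s \in p s by move=> sS; apply: path_from_end (p1 s sS).
have S_once s s' : s \in S -> s' \in S -> s' \in p s -> s' = s.
  by move=> sS sS' s'p; apply: (p2 s' s s'); rewrite ?ps_end.
have rC s : s \in S -> s \in C -> {subset (f s).2 <= C}.
  move=> sS sC; have [yY yp py ly [uy rp rY]] := fP s sS => v vr.
  have yW : (f s).1 \in W by rewrite !inE yY orbT.
  have := path_inset yW py (_ : v \in (f s).1 :: (f s).2); rewrite inE vr orbT => /(_ isT).
  rewrite !inE (negbTE (rY v vr)) /= => /orP[//|vZ].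
  case/splitPr: vr py ly uy rp rY => r1 r2; rewrite cat_path /= => /and3P[py1 ev py2] ly uy rp rY.
  have pv : path (inset e W) (f s).1 (rcons r1 v) by rewrite rcons_path py1.
  have := sep (f s).1 (rcons r1 v) yY pv; rewrite last_rcons => /(_ vZ) /hasP[w ww wS].
  have wp : w \in p s.
    move: ww; rewrite inE mem_rcons => /orP[/eqP -> //|wr]; apply: rp.
    by move: wr; rewrite inE mem_cat inE => /orP[->|->]; rewrite ?orbT.
  have ws := S_once s w sS wS wp; subst w.
  have vs : v != s.
    by apply: contraL sC => /eqP <-; apply: XC; apply: (subsetP ZX).
  case: r2 ly uy {py2 rp rY} => [|z r2]; first by rewrite last_cat /= => E; rewrite E eqxx in vs.
  rewrite last_cat => ly.
  rewrite -[_ && _]/(uniq ((f s).1 :: (r1 ++ v :: z :: r2))) -cat_rcons -cat_cons cat_uniq.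
  case/and3P=> _ /hasPn u2 _; have sz : s \in z :: r2 by rewrite -ly /= mem_last.
  have := u2 s sz; by rewrite /= in ww *; rewrite ww.
have inj s s' : s \in S -> s' \in S -> (f s).1 = (f s').1 -> s = s'.
  move=> sS sS' E; have [_ y1 _ _ _] := fP s sS; have [_ y2 _ _ _] := fP s' sS'.
  by apply: (p2 _ _ (f s).1); rewrite // E.
have yt s : s \in S -> (f s).1 \in open t.
  by move=> sS; have [yY _ _ _ _] := fP s sS; apply: Xo; apply: (subsetP YX).
have [|||||t' [g' n' nn' l' o']] := @attach_paths V e (enum (S :&: C)) (fun s => (f s).1) (fun s => (f s).2) t gt.
- exact: enum_uniq.
- move=> s; rewrite mem_enum inE => /andP[sS sC].
  have [yY yp py ly [uy rp rY]] := fP s sS; split=> //; first exact: yt.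
  + exact: path_inset_e py.
  + by apply: contraTneq sC => r0; rewrite -ly r0 /=; apply: XC; apply: (subsetP YX).
  + by case/andP: uy.
- move=> s; rewrite mem_enum inE => /andP[sS sC] v /(rC s sS sC); exact: Ct.
- move=> s s'; rewrite !mem_enum !inE => /andP[sS sC] /andP[sS' sC'] v vr vr'.
  have [_ _ _ _ [_ rp _]] := fP s sS; have [_ _ _ _ [_ rp' _]] := fP s' sS'.
  by apply: (p2 _ _ v); rewrite ?rp ?rp'.
- by move=> s s'; rewrite !mem_enum !inE => /andP[sS _] /andP[sS' _]; apply: inj.
(* The vertex before the first entry into [D] would either lie in [Y] outside [S] and be adjacent to
   [D], which is excluded, or lie in [C :\: S] and so belong to the component [D] itself. *)
have offD s v : s \in S -> s \in C -> v \in (f s).2 -> v \notin D.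
  move=> sS sC vr; apply/negP => vD.
  have [yY yp py ly [uy rp rY]] := fP s sS.
  have yS : (f s).1 \notin S.
    apply/negP => yS; have ys := S_once s _ sS yS yp.
    by have := XC _ (subsetP YX _ yY); rewrite ys sC.
  have hD : has (mem D) ((f s).1 :: (f s).2) by apply/hasP; exists v; rewrite ?inE ?vr ?orbT.
  have [q1 [q2 [Eq lq nq]]] := first_hit hD.
  have yD : (f s).1 \notin D.
    by apply: contra (XC _ (subsetP YX _ yY)) => /(subsetP DC); rewrite inE => /andP[].
  case/lastP: q1 => [|q1 w] in Eq lq nq; first by rewrite /= (negbTE yD) in lq.
  rewrite last_rcons in lq; rewrite belast_rcons in nq.
  move: py ly uy; rewrite Eq cat_path rcons_path last_cat last_rcons => /andP[/andP[_ /and3P[_ _ euw]] _] ls.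
  rewrite cat_rcons -cat_cons cat_uniq => /and3P[_ /hasPn nn _].
  have uq : last (f s).1 q1 \in (f s).1 :: q1 by apply: mem_last.
  have us : last (f s).1 q1 != s.
    apply/eqP => E; have /nn/negP : last (f s).1 q1 \in w :: q2 by rewrite E -{1}ls mem_last.
    by apply; exact: uq.
  have uD : last (f s).1 q1 \notin D by apply: (hasPn nq).
  move: uq; rewrite inE => /orP[/eqP Ey|uq].
    by have /negP[] := DY w (f s).1 lq yY yS; rewrite e_sym -Ey.
  have ur : last (f s).1 q1 \in (f s).2 by rewrite Eq mem_cat mem_rcons inE uq orbT.
  case/negP: uD; apply: (clD w) => //; last by rewrite e_sym.
  rewrite inE (rC s sS sC) // andbT; apply: contraNN us => uS; apply/eqP.
  by apply: S_once => //; apply: rp.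
exists t'; split=> //.
- move=> v vD; apply/negP => /n'[|[s]].
    by apply/negP/Ct; have := subsetP DC _ vD; rewrite inE => /andP[].
  rewrite mem_enum inE => /andP[sS sC] vr; by have := offD s v sS sC vr; rewrite vD.
- move=> x xN; case xSC: (x \in S :&: C); first by apply/leaves_open/l'; rewrite mem_enum.
  have xX : x \in X.
    have := subsetP ND _ xN; rewrite inE => /orP[//|xS].
    move: xSC; rewrite inE xS /= => xC; have := subsetP SW _ xS; rewrite !inE xC /=.
    by case/orP; apply/subsetP.
  apply: o'; first exact: Xo.
  move=> s; rewrite mem_enum inE => /andP[sS sC]; apply/eqP => xy.
  have [yY yp _ _ _] := fP s sS.
  have yS : (f s).1 \notin S.
    apply/negP => yS; have ys := S_once s _ sS yS yp.
    by have := XC _ (subsetP YX _ yY); rewrite ys sC.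
  move: xN; rewrite inE xy => /andP[_ /existsP[d /andP[dD edy]]].
  by have := DY d _ dD yY yS; rewrite e_sym edy.
(* Some vertex of [S :&: C] is adjacent to [D], since otherwise [D] would be all of the connected
   set [C]. The path that ends there makes it a leaf. *)
- have [[s [d [sS dD eds]]]|no] := EM (exists s d, [/\ s \in S :&: C, d \in D & e d s]).
    exists s; last by apply: l'; rewrite mem_enum.
    rewrite inE; apply/andP; split; last by apply/existsP; exists d; rewrite dD e_sym.
    by apply: contraTN sS => /(subsetP DC); rewrite !inE => /andP[/negbTE ->].
  have DsC : D \subset C by apply: subset_trans DC (subsetDl _ _).
  have E : D = C.
    apply: conn_closed cC DsC D0 _ => x y xD yC exy.
    case yS: (y \in S); last by apply: (clD x); rewrite // inE yS.
    by case: no; exists y, x; rewrite inE yS.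
  case/set0Pn: SC => s; rewrite inE => /andP[sS]; rewrite -E => /(subsetP DC).
  by rewrite inE sS.
Qed.

(** The tree has been grown around [C] so that the neighbours of [C] are open nodes and one of them
    is a leaf. While [X] has fewer than [h] elements, a vertex of [C] next to that leaf joins both
    the tree and the bag. Once it has [h], either [X] is linked through [C], which is a mesh, or a
    separator with fewer than [k] vertices joins the bag, which then has at most [h + k]
    vertices. *)
Lemma mesh_or_dec n C X t : #|C| < n -> conn e C -> C != set0 -> X = nbh e C -> good_tree e t ->
  {in C, forall v, v \notin nodes t} -> {subset X <= open t} ->
  (exists2 x, x \in X & x \in leaves t) -> #|X| <= h -> mesh \/ dec e (h + k) C X.
Proof.
elim: n => // n IH in C X t *; rewrite ltnS => Cn cC C0 XE gt Ct Xo [x xX xl] Xh.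
have XC y : y \in X -> y \notin C by rewrite XE inE => /andP[].
have [|noM] := EM mesh; [by left|right].
have clX x' y : x' \in C -> e x' y -> y \in C :|: X.
  move=> xC exy; rewrite XE !inE; case: (y \in C) => //=.
  by apply/existsP; exists x'; rewrite xC e_sym.
case: (ltnP #|X| h) => Xh'.
  have /existsP[v /andP[vC evx]] : [exists v in C, e x v] by move: xX; rewrite XE inE => /andP[].
  have vX : v \notin X by apply: contraL vC; apply: XC.
  apply: (dec_intro (v := v)) => //; first by rewrite (leq_trans Xh) // leq_addr.
  apply: dec_components => //; first by rewrite cardsU1 vX add1n (leq_trans Xh') ?leq_addr.
  move=> D [DC D0 cD clD].
  have DC' : D \subset C by apply: subset_trans DC (subsetDl _ _).
  have vD : v \notin D by apply/negP => /(subsetP DC); rewrite !inE eqxx.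
  have ND : nbh e D \subset v |: X.
    apply/subsetP => y; rewrite inE => /andP[yD /existsP[d /andP[dD edy]]].
    rewrite e_sym in edy; have := clX d y (subsetP DC' _ dD) edy; rewrite !inE; case: eqP => //= /eqP yv /orP[yC|//].
    by case/negP: yD; apply: clD edy => //; rewrite !inE yv.
  have vN : v \in nbh e D.
    rewrite inE vD /=; apply: contraT => /existsPn nv.
    have E : D = C.
      apply: conn_closed cC DC' D0 _ => y z yD zC eyz.
      apply: (clD y) => //; rewrite !inE zC andbT; apply: contraNneq (nv y) => <-.
      by rewrite yD e_sym.
    by rewrite E vC in vD.
  have [t1 [g1 n1 v1 o1 l1]] := attach_leaf gt (Xo x xX) evx (Ct v vC).
  have vNn : v \in leaves t1 by [].
  have Dt1 : {in D, forall w, w \notin nodes t1}.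
    move=> w wD; rewrite (perm_mem n1) inE negb_or (Ct w (subsetP DC' _ wD)) andbT.
    by apply: contraNneq vD => <-.
  have No : {subset nbh e D <= open t1}.
    move=> y /(subsetP ND); rewrite !inE => /orP[/eqP ->|yX]; first exact: leaves_open.
    by apply: o1; rewrite ?Xo // xl orbT.
  have Nh : #|nbh e D| <= h.
    by apply: leq_trans (subset_leq_card ND) _; rewrite cardsU1 vX.
  have Dn : #|D| < n.
    apply: leq_trans Cn; apply: proper_card; apply/properP; split=> //; by exists v.
  have [//|D'] := IH D (nbh e D) t1 Dn cD D0 erefl g1 Dt1 No (ex_intro2 _ _ v vN vNn) Nh.
  apply: dec_forget D' => //; first by rewrite cardsU1 vX add1n (leq_trans Xh') ?leq_addr.
  move=> y z yD eyz; rewrite inE; case zD: (z \in D) => //=; rewrite inE zD.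
  by apply/existsP; exists y; rewrite yD e_sym.
have Xeq : #|X| = h by apply/eqP; rewrite eqn_leq Xh.
have Xn : {subset X <= nodes t} by move=> y /Xo/open_nodes.
have : ~ linked_through C X by move=> L; apply: noM; exists C, X, t; split.
case/existsNP => Y /existsNP[Z] /not_implyP[YX] /not_implyP[ZX] /not_implyP[YZ].
case/not_implyP => Yk /not_implyP[Zk] noL.
set W := C :|: (Y :|: Z) in noL.
have [S sepS minS] := min_separator (inset e W) Y Z.
have sepS' := separates_sym e_sym sepS.
have minS' T : separates (inset e W) Z Y T -> #|S| <= #|T| by move/(separates_sym e_sym); apply: minS.
have Sk : #|S| < k.
  rewrite ltnNge; apply/negP => kS; apply: noL.
  have [|B' [p [BS cB lp]]] := @menger V (inset e W) Y Z k.
    by move=> T /minS; apply: leq_trans.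
  exists p; suff -> : Z = B' by [].
  by apply/esym/eqP; rewrite eqEcard BS cB Zk leqnn.
have SW : S \subset W.
  have : separates (inset e W) Y Z (S :&: W).
    move=> y p yY pp lp; have /hasP[w w1 w2] := sepS y p yY pp lp.
    apply/hasP; exists w => //; rewrite /= inE in w2 *; rewrite w2 /=.
    have yW : y \in W by rewrite !inE yY orbT.
    exact: (path_inset yW pp w1).
  by move/minS => SS; apply/setIidPl/eqP; rewrite eqEcard subsetIl.
have XN : X \subset nbh e C by rewrite XE.
(* A connected part of [C :\: S] cannot see both [Y :\: S] and [Z :\: S]. Each component is
   therefore treated with the linkage from a side that it does not see. *)
have via y z (D : {set V}) : D \subset C :\: S -> conn e D -> y \in Y -> z \in Z -> y \notin S -> z \notin S ->
    forall d d', d \in D -> d' \in D -> e y d -> e d' z -> False.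
  move=> DC cD yY zZ yS zS d d' dD d'D eyd edz.
  have /connectP[p pp lp] := cD _ _ dD d'D.
  have dp := path_inset dD pp.
  have := sepS y (rcons (d :: p) z) yY.
  rewrite rcons_path last_rcons /= -lp => H.
  have /hasP[w] : has (mem S) (y :: rcons (d :: p) z).
    apply: H (zZ); apply/andP; split; last first.
      by rewrite /inset edz !inE zZ orbT /=; have := subsetP DC _ d'D; rewrite inE => /andP[_ ->]; rewrite orbT.
    apply/andP; split.
      by rewrite /inset eyd !inE yY orbT /=; have := subsetP DC _ dD; rewrite inE => /andP[_ ->].
    apply: sub_path pp; apply: inset_sub; apply: subset_trans DC _; apply: subset_trans (subsetDl _ _) _.
    exact: subsetUl.
  rewrite inE mem_rcons inE => /or3P[/eqP ->|/eqP ->|wp] /= wS; rewrite ?wS in yS zS => //.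
  by have := subsetP DC _ (dp w wp); rewrite inE wS.
have [y yY yS] : exists2 y, y \in Y & y \notin S.
  by apply/subsetPn; apply: contraTN Sk => /subset_leq_card; rewrite Yk -leqNgt.
have [z zZ zS] : exists2 z, z \in Z & z \notin S.
  by apply/subsetPn; apply: contraTN Sk => /subset_leq_card; rewrite Zk -leqNgt.
have nC u : u \in X -> exists2 c, c \in C & e u c.
  by move=> /(subsetP XN); rewrite inE => /andP[_ /existsP[c /andP[? ?]]]; exists c.
have SC : S :&: C != set0.
  apply/negP => /eqP SC0.
  have [c cC' eyc] := nC y (subsetP YX _ yY); have [d dC ezd] := nC z (subsetP ZX _ zZ).
  apply: (via y z C _ cC yY zZ yS zS c d) => //; last by rewrite e_sym.
  apply/subsetP => w wC; rewrite inE wC andbT; apply/negP => wS.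
  by have : w \in S :&: C by [rewrite inE wS]; rewrite SC0 inE.
have SCX : (S :&: C) :|: X = S :|: X.
  apply/setP => w; rewrite !inE; case wX: (w \in X); rewrite ?orbT //= !orbF.
  case wS: (w \in S) => //=; have := subsetP SW _ wS; rewrite !inE => /or3P[->//||].
    by move/(subsetP YX); rewrite wX.
  by move/(subsetP ZX); rewrite wX.
have SXk : #|S :|: X| <= h + k.
  by apply: leq_trans (leq_card_setU _ _) _; rewrite Xeq addnC leq_add2l ltnW.
apply: (dec_intros (S := S :&: C)); rewrite ?SCX ?subsetIr //.
have -> : C :\: (S :&: C) = C :\: S by apply/setP => w; rewrite !inE; case: (w \in C); rewrite ?andbF ?andbT.
apply: dec_components => // D cD; have [DC D0 cnD clD] := cD.
have DsC : D \subset C by apply: subset_trans DC (subsetDl _ _).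
have ND : nbh e D \subset X :|: S.
  apply/subsetP => w; rewrite inE => /andP[wD /existsP[d /andP[dD ewd]]].
  have := clX d w (subsetP DsC _ dD); rewrite e_sym => /(_ ewd).
  rewrite !inE; case wS: (w \in S); rewrite ?orbT //= orbF => /orP[wC|//].
  by case/negP: wD; apply: (clD d); rewrite // 1?e_sym // inE wS.
have Dn : #|D| < n.
  apply: leq_trans Cn; apply: proper_card; apply/properP; split=> //.
  case/set0Pn: SC => s; rewrite inE => /andP[sS sC]; exists s => //.
  by apply/negP => /(subsetP DC); rewrite inE sS.
have forget : dec e (h + k) D (nbh e D) -> dec e (h + k) D (S :|: X).
  move=> D'; apply: dec_forget D' => //; first by rewrite setUC.
  move=> u w uD euw; rewrite inE; case wD: (w \in D) => //=; rewrite inE wD.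
  by apply/existsP; exists u; rewrite uD e_sym.
(* The unseen side [Y'] is traded for the separator: [k] neighbours are lost and fewer than [k] are
   gained, so the bound [h] on the neighbourhood persists. *)
have side Y' Z' : Y' \subset X -> Z' \subset X -> #|Y'| = k -> W = C :|: (Y' :|: Z') ->
    separates (inset e W) Y' Z' S -> (forall T, separates (inset e W) Y' Z' T -> #|S| <= #|T|) ->
    (forall x y, x \in D -> y \in Y' -> y \notin S -> ~~ e x y) -> dec e (h + k) D (S :|: X).
  move=> YX' ZX' Yk' WE sep' min' DY; apply: forget.
  have lk := linkage_to_separator sep' min'.
  rewrite WE in sep' lk SW.
  have [t1 [g1 d1 o1 l1]] := extend_tree gt Ct Xo YX' ZX' cC XN XC sep' SW lk cD DY ND SC.
  have Nh : #|nbh e D| <= h.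
    apply: (@leq_trans #|(X :\: Y') :|: S|); last first.
      apply: leq_trans (leq_card_setU _ _) _; rewrite cardsD (setIidPr YX') Yk' Xeq.
      have : k <= h by rewrite -Xeq -Yk' subset_leq_card.
      by move: Sk; clear; lia.
    apply: subset_leq_card; apply/subsetP => w wN; have := subsetP ND _ wN; rewrite !inE.
    case wS: (w \in S); rewrite ?orbT // !orbF => wX; rewrite wX andbT; apply/negP => wY.
    move: wN; rewrite inE => /andP[_ /existsP[d /andP[dD ewd]]].
    by have := DY d w dD wY; rewrite wS e_sym ewd => /(_ isT).
  by have [] := IH D (nbh e D) t1 Dn cnD D0 erefl g1 d1 o1 l1 Nh.
have [DY|nDY] := EM (forall x y, x \in D -> y \in Y -> y \notin S -> ~~ e x y).
  exact: (side Y Z).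
apply: (side Z Y) => //; first by rewrite [Z :|: Y]setUC.
move=> x1 z1 x1D z1Z z1S; apply/negP => e1; apply: nDY => x2 y2 x2D y2Y y2S; apply/negP => e2.
by apply: (via y2 z1 D DC cnD y2Y z1Z y2S z1S x2 x1); rewrite // e_sym.
Qed.

Lemma mesh_exists : 0 < h -> ~ dec e (h + k) setT set0 -> mesh.
Proof.
move=> h0 nd; apply: contrapT => nM; apply: nd.
apply: dec_components; rewrite ?cards0 // => C [_ C0 cC clC].
case/set0Pn: (C0) => v vC.
apply: (dec_intro (v := v)) => //; first by rewrite cards0.
rewrite [v |: set0]setU0; apply: dec_components => //; first by rewrite cards1 (leq_trans h0) ?leq_addr.
move=> D [DC D0 cD clD].
have DC' : D \subset C by apply: subset_trans DC (subsetDl _ _).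
have vD : v \notin D by apply/negP => /(subsetP DC); rewrite !inE eqxx.
have ND : nbh e D \subset [set v].
  apply/subsetP => y; rewrite [_ \in nbh _ _]inE => /andP[yD /existsP[d /andP[dD edy]]].
  rewrite e_sym in edy; have yC : y \in C by apply: (clC d); rewrite ?inE // ?(subsetP DC').
  rewrite inE; apply: contraNT yD => yv; apply: (clD d) => //.
  by rewrite !inE yv.
have vN : v \in nbh e D.
  rewrite inE vD /=; apply: contraT => /existsPn nv.
  have E : D = C.
    apply: conn_closed cC DC' D0 _ => y z yD zC eyz.
    apply: (clD y) => //; rewrite !inE zC andbT; apply: contraNneq (nv y) => <-.
    by rewrite yD e_sym.
  by rewrite E vC in vD.
have gv : good_tree e (Node v (Empty V) (Empty V)) by [].
have [|||||D'] // := mesh_or_dec (ltnSn #|D|) cD D0 erefl gv.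
- by move=> w wD; rewrite inE; apply: contraNneq vD => <-.
- by move=> w /(subsetP ND); rewrite inE => /eqP ->; rewrite mem_head.
- by exists v; rewrite // mem_head.
- by apply: leq_trans (subset_leq_card ND) _; rewrite cards1.
apply: dec_forget D' => //; first by rewrite cards1 (leq_trans h0) ?leq_addr.
move=> u w uD euw; rewrite inE; case wD: (w \in D) => //=; rewrite inE wD.
by apply/existsP; exists u; rewrite uD e_sym.
Qed.
End Mesh.

(** * Linkages that cross a family of disjoint connected sets *)

Section Layers.
Variables (V : finType) (e : rel V).
Hypothesis e_sym : symmetric e.
Implicit Types (A B C S W : {set V}).

Definition pairs (s : seq V) : seq (V * V) := zip s (behead s).

Lemma pairs_path (r : rel V) x t u v : path r x t -> (u, v) \in pairs (x :: t) -> r u v.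
Proof.
rewrite /pairs /=; elim: t x => //= y t IH x /andP[rxy pt].
by rewrite inE => /orP[/eqP[-> ->]//|]; apply: IH.
Qed.

Lemma path_pairs (r : rel V) x t : (forall u v, (u, v) \in pairs (x :: t) -> r u v) -> path r x t.
Proof.
rewrite /pairs /=; elim: t x => //= y t IH x h; rewrite h ?mem_head //=.
by apply: IH => u v uv; apply: h; rewrite inE uv orbT.
Qed.

Lemma pairs_mem s u v : (u, v) \in pairs s -> u \in s /\ v \in s.
Proof.
rewrite /pairs; elim: s => //= x [|y s] IH //=.
rewrite inE => /orP[/eqP[-> ->]|/IH [us vs]]; first by rewrite !inE !eqxx orbT.
by split; rewrite inE ?us ?vs orbT.
Qed.

Lemma pairs_index s u v : uniq s -> (u, v) \in pairs s -> index v s = (index u s).+1.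
Proof.
rewrite /pairs; elim: s => // x s IH; rewrite cons_uniq => /andP[xs us].
case: s IH xs us => // y s IH xs us; rewrite [zip _ _]/= inE => /orP[/eqP[-> ->]|uv].
  by rewrite /= eqxx; case: eqP xs => [->|_ _]; rewrite ?mem_head ?eqxx.
have [us' vs'] := pairs_mem (s := y :: s) uv.
have nx w : w \in y :: s -> index w (x :: y :: s) = (index w (y :: s)).+1.
  by move=> ws; rewrite [LHS]/=; case: eqP => // E; rewrite E ws in xs.
by rewrite !nx // IH.
Qed.

Lemma split_index (x : V) t v : uniq (x :: t) -> v \in x :: t ->
  exists t1 t2, [/\ t = t1 ++ t2, last x t1 = v,
    forall w, w \in x :: t1 -> index w (x :: t) <= index v (x :: t) &
    forall w, w \in t2 -> index v (x :: t) < index w (x :: t)].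
Proof.
move=> u vs; case/splitPl: vs u => t1 t2 lt1 u; exists t1, t2.
have u1 : uniq (x :: t1) by move: u; rewrite -cat_cons cat_uniq => /andP[].
have iv : index v (x :: t1 ++ t2) = size t1.
  rewrite -cat_cons index_cat -lt1 mem_last (last_nth x).
  by rewrite index_uniq.
split=> // w; rewrite iv -cat_cons index_cat.
  by move=> ws; rewrite ws -ltnS; move: ws; rewrite -index_mem.
move=> w2; rewrite ifN /=; first by rewrite addSn ltnS leq_addr.
apply/negP => w1; move: u; rewrite -cat_cons cat_uniq => /and3P[_ /hasPn/(_ w w2)].
by rewrite /= w1.
Qed.

Variables (T : finType) (P : T -> {set V}) (W A B : {set V}) (n : nat).
Hypothesis P_conn : forall t, conn e (P t).
Hypothesis P_sub : forall t, P t \subset W.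
Hypothesis P_disj : forall t t' v, v \in P t -> v \in P t' -> t = t'.

Definition inside : rel V := fun u v => [exists t, (u \in P t) && (v \in P t)].
Definition outer B' (p : V -> seq V) : {set V * V} :=
  [set uv | ~~ inside uv.1 uv.2 & [exists b in B', uv \in pairs (p b)]].

(** Minimality makes every edge outside the sets [P t] indispensable, which is the source of the
    separators in [cut_edge]. In the application the sets [P t] are the paths of another linkage. *)
Definition min_linkage B' p : Prop :=
  [/\ B' \subset B, #|B'| = n, linkage (inset e W) A B' p &
   forall B'' p', B'' \subset B -> #|B''| = n -> linkage (inset e W) A B'' p' ->
     #|outer B' p| <= #|outer B'' p'|].

Lemma min_linkage_exists B' p : B' \subset B -> #|B'| = n -> linkage (inset e W) A B' p ->
  exists B'' p', min_linkage B'' p'.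
Proof.
have [m] := ubnP #|outer B' p|; elim: m => // m IH in B' p *; rewrite ltnS => om sB cB lp.
have [M|] := EM (forall B'' p', B'' \subset B -> #|B''| = n -> linkage (inset e W) A B'' p' ->
     #|outer B' p| <= #|outer B'' p'|); first by exists B', p.
move=> /existsNP[B2 /existsNP[p2 /not_implyP[s2 /not_implyP[c2 /not_implyP[l2 /negP]]]]].
by rewrite -ltnNge => lt; apply: IH l2 => //; apply: leq_trans lt om.
Qed.

Variables (B' : {set V}) (p : V -> seq V).
Hypothesis pmin : min_linkage B' p.
Variables (b0 x y : V).
Hypotheses (b0B : b0 \in B') (xy_pair : (x, y) \in pairs (p b0)) (xy_out : ~~ inside x y).

(** In the union of the linkage and the edges inside the sets [P t], minimality leaves no linkage of
    size [n] after deletion of the edge from [x] to [y], so Menger's theorem gives a separator [S].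
    It has exactly one vertex on each path other than [p b0]; hence the part [L] reachable from [A]
    cuts every path into a beginning and an end, and a set [P t] that avoids [S], being connected
    without the deleted edge, lies on one side. *)
Lemma cut_edge : exists S L : {set V}, [/\ #|S| < n,
  forall b v v', b \in B' -> v \in p b -> v' \in p b -> v \notin S -> v' \notin S ->
    v \in L -> v' \notin L -> index v (p b) < index v' (p b),
  forall v, v \in p b0 -> (v \in L) = (index v (p b0) <= index x (p b0)) &
  forall t, [disjoint P t & S] -> P t \subset L \/ [disjoint P t & L]].
Proof.
have [sB cB [lp1 lp2] mino] := pmin.
have uniqp b : b \in B' -> uniq (p b).
  by move/lp1; case: (p b) => // a t /and4P[].
pose H : rel V := fun u v => [exists b in B', (u, v) \in pairs (p b)] || inside u v && inset e W u v.
have HW : subrel H (inset e W).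
  move=> u v /orP[/existsP[b /andP[bB uv]]|/andP[]//].
  by have := lp1 b bB; case Ep: (p b) uv => [|a t] // uv /and4P[_ pt _ _]; apply: pairs_path pt uv.
pose r := del_edge H x y.
have rW : subrel r (inset e W) by move=> u v /del_edge_sub/HW.
have [S sepS Sn] : exists2 S, separates r A B S & #|S| < n.
  apply: contrapT => no.
  have [|B2 [p2 [s2 c2 l2]]] := @menger V r A B n.
    by move=> S sepS; rewrite leqNgt; apply/negP => Sn; apply: no; exists S.
  have := mino B2 p2 s2 c2 (linkage_sub rW l2); rewrite leqNgt => /negP[].
  apply: proper_card; apply/properP; split.
    apply/subsetP => -[u v]; rewrite !inE /= => /andP[out /existsP[b /andP[bB uv]]].
    rewrite out /=; have := l2.1 b bB; case Ep: (p2 b) uv => [|a t] // uv /and4P[_ pt _ _].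
    have := pairs_path pt uv => /andP[/orP[//|]]; by rewrite (negbTE out).
  exists (x, y); rewrite !inE /= xy_out /=; first by apply/existsP; exists b0; rewrite b0B.
  apply/negP => /existsP[b /andP[bB uv]].
  have := l2.1 b bB; case Ep: (p2 b) uv => [|a t] // uv /and4P[_ pt _ _].
  by have := pairs_path pt uv; rewrite /r /del_edge !eqxx andbF.
have [xp yp] := pairs_mem xy_pair.
have pH b a t : b \in B' -> p b = a :: t -> path H a t.
  move=> bB Ep; apply: path_pairs => u v uv; apply/orP; left; apply/existsP; exists b.
  by rewrite bB Ep.
have pr b a t : b \in B' -> b != b0 -> p b = a :: t -> path r a t.
  move=> bB bb0 Ep; apply: path_del_edge_tgt; last exact: (pH b).
  apply: contraNN bb0 => yt; apply/eqP; apply: (lp2 _ _ y) => //.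
  by rewrite Ep inE yt orbT.
have hitS b : exists w, b \in B' -> b != b0 -> w \in p b /\ w \in S.
  case bB: (b \in B'); last by exists x.
  case: (eqVneq b b0) => [_|bb0]; first by exists x.
  have := lp1 b bB; case Ep: (p b) => [|a t] // /and4P[aA _ /eqP lt _].
  have lB : last a t \in B by rewrite lt; apply: (subsetP sB).
  by have /hasP[w w1 w2] := sepS a t aA (pr b a t bB bb0 Ep) lB; exists w.
have {hitS} /choice[s hs] := hitS.
have hs' b : b \in B' :\ b0 -> s b \in p b /\ s b \in S.
  by rewrite !inE => /andP[bb0 bB]; apply: hs.
have s_inj : {in B' :\ b0 &, injective s}.
  move=> b c bB' cB' E; have [h1 _] := hs' b bB'; have [h2 _] := hs' c cB'.
  move: bB' cB'; rewrite !inE => /andP[_ bB] /andP[_ cB'].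
  by apply: (lp2 _ _ (s b)); rewrite // E.
have Sim : S = s @: (B' :\ b0).
  apply/esym/eqP; rewrite eqEcard; apply/andP; split.
    by apply/subsetP => _ /imsetP[b bB ->]; have [] := hs' b bB.
  rewrite card_in_imset //; move: Sn; rewrite -cB (cardsD1 b0 B') b0B; exact.
have S_on b v : b \in B' -> v \in p b -> v \in S -> b != b0 /\ v = s b.
  move=> bB vp; rewrite Sim => /imsetP[c cB0 vs]; have [sc _] := hs' c cB0.
  have cB' : c \in B' by move: cB0; rewrite !inE => /andP[].
  have <- : c = b by apply: (lp2 _ _ v); rewrite // vs.
  by split=> //; move: cB0; rewrite !inE => /andP[].
pose rS : rel V := fun u v => r u v && (v \notin S).
pose L := [set v | [exists a in A :\: S, connect rS a v]].
have L1 a t1 : a \in A -> path r a t1 -> {in a :: t1, forall w, w \notin S} -> last a t1 \in L.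
  move=> aA pt nS; rewrite inE; apply/existsP; exists a; rewrite inE aA nS ?mem_head //=.
  apply/connectP; exists t1 => //.
  elim: t1 a {aA} pt nS => //= z t1 IH a /andP[raz pt] nS; rewrite IH //.
    by rewrite /rS raz nS // !inE eqxx orbT.
  by move=> w wz; apply: nS; rewrite inE wz orbT.
have L2 v t2 : v \in L -> path r v t2 -> last v t2 \in B -> {in t2, forall w, w \notin S} -> False.
  rewrite inE => /existsP[a /andP[]]; rewrite inE => /andP[aS aA] /connectP[q pq ->] pt lB nS.
  have pq' : path r a q by apply: sub_path pq => u w /andP[].
  have := sepS a (q ++ t2) aA; rewrite cat_path pq' pt last_cat => /(_ isT lB) /hasP[w].
  rewrite inE mem_cat => /or3P[/eqP ->|wq|w2]; rewrite /= ?(negbTE aS) //; last by rewrite (negbTE (nS w w2)).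
  suff : all (fun w => w \notin S) q by move/allP/(_ w wq)/negbTE ->.
  by elim: q a pq {aS aA pq' wq pt lB} => //= z q IH a /andP[/andP[_ ->] /IH].
exists S, L; split=> //.
- move=> b v v' bB vp vp' vS vS' vL vL'.
  have up := uniqp b bB.
  have := lp1 b bB; case Ep: (p b) => [|a t] // /and4P[aA _ /eqP lt _].
  rewrite Ep in vp vp' up.
  have lB : last a t \in B by rewrite lt (subsetP sB).
  have [t1 [t2 [Et l1 i1 i2]]] := split_index up vp.
  have [t1' [t2' [Et' l1' i1' i2']]] := split_index up vp'.
  case: (eqVneq b b0) => [bb0|bb0].
    have nS w : w \in a :: t -> w \notin S.
      by move=> wt; apply/negP => wS; have [] := S_on b w bB _ wS; rewrite ?Ep // bb0 eqxx.
    have Eyx : index y (p b0) = (index x (p b0)).+1 by apply: pairs_index; rewrite ?uniqp.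
    rewrite -bb0 Ep in Eyx.
    have pt := pH b a t bB Ep.
    rewrite ltnNge; apply/negP => le.
    case: (leqP (index v (a :: t)) (index x (a :: t))) => vx.
      case/negP: vL'; rewrite -l1'; apply: L1 => //.
        apply: path_del_edge_tgt; last by move: pt; rewrite Et' cat_path => /andP[].
        apply/negP => y1; have := i1' y; rewrite inE y1 orbT Eyx => /(_ isT) h.
        by have := leq_trans h (leq_trans le vx); rewrite ltnn.
      by move=> w ws; apply: nS; rewrite Et' -cat_cons mem_cat ws.
    apply: (L2 v t2) => //; last 2 first.
    + by rewrite -l1 -last_cat -Et.
    + by move=> w w2; apply: nS; rewrite Et inE mem_cat w2 !orbT.
    apply: path_del_edge_src; last by move: pt; rewrite Et cat_path l1 => /andP[].
    apply/negP => /mem_belast; rewrite inE => /orP[/eqP E|x2]; first by rewrite E ltnn in vx.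
    by have := ltn_trans vx (i2 x x2); rewrite ltnn.
  have bB0 : b \in B' :\ b0 by rewrite !inE bb0.
  have [sb _] := hs' b bB0; rewrite Ep in sb.
  have pt := pr b a t bB bb0 Ep.
  have nS w : w \in a :: t -> w != s b -> w \notin S.
    move=> wt ws; apply/negP => wS; have [] := S_on b w bB _ wS; rewrite ?Ep // => _ E.
    by rewrite E eqxx in ws.
  have iv : index v (a :: t) < index (s b) (a :: t).
    rewrite ltnNge; apply/negP => le; apply: (L2 v t2) => //.
    + by move: pt; rewrite Et cat_path l1 => /andP[].
    + by rewrite -l1 -last_cat -Et.
    + move=> w w2; apply: nS; first by rewrite Et inE mem_cat w2 !orbT.
      by apply/eqP => ws; have := leq_ltn_trans le (i2 w w2); rewrite ws ltnn.
  apply: ltn_trans iv _; rewrite ltnNge; apply/negP => le; case/negP: vL'.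
  rewrite -l1'; apply: L1 => //; first by move: pt; rewrite Et' cat_path => /andP[].
  move=> w w1; apply: nS; first by rewrite Et' -cat_cons mem_cat w1.
  apply/eqP => ws; have : index (s b) (a :: t) = index v' (a :: t).
    by apply/eqP; rewrite eqn_leq -{1}ws i1'.
  move=> E; have : s b = v' by rewrite -(nth_index a sb) E nth_index.
  by move=> E'; case/negP: vS'; rewrite -E'; have [] := hs' b bB0.
- move=> v vp; have up := uniqp b0 b0B.
  have Eyx : index y (p b0) = (index x (p b0)).+1 by apply: pairs_index.
  have := lp1 b0 b0B; case Ep: (p b0) => [|a t] // /and4P[aA _ /eqP lt _].
  rewrite Ep in vp up Eyx.
  have nS w : w \in a :: t -> w \notin S.
    by move=> wt; apply/negP => wS; have [] := S_on b0 w b0B _ wS; rewrite ?Ep // eqxx.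
  have pt := pH b0 a t b0B Ep.
  have lB : last a t \in B by rewrite lt (subsetP sB).
  have [t1 [t2 [Et l1 i1 i2]]] := split_index up vp.
  case: leqP => vx.
    rewrite -l1; apply: L1 => //.
      apply: path_del_edge_tgt; last by move: pt; rewrite Et cat_path => /andP[].
      by apply/negP => y1; have := i1 y; rewrite inE y1 orbT Eyx ltnNge vx => /(_ isT).
    by move=> w ws; apply: nS; rewrite Et -cat_cons mem_cat ws.
  apply/negP => vL; apply: (L2 v t2) => //; last 2 first.
  + by rewrite -l1 -last_cat -Et.
  + by move=> w w2; apply: nS; rewrite Et inE mem_cat w2 !orbT.
  apply: path_del_edge_src; last by move: pt; rewrite Et cat_path l1 => /andP[].
  apply/negP => /mem_belast; rewrite inE => /orP[/eqP E|x2]; first by rewrite E ltnn in vx.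
  by have := ltn_trans vx (i2 x x2); rewrite ltnn.
- move=> t dS; case: (boolP [disjoint P t & L]) => [|/pred0Pn[v /andP[/= vP vL]]]; first by right.
  left; apply/subsetP => u uP; move: vL; rewrite !inE => /existsP[a /andP[aA av]].
  apply/existsP; exists a; rewrite aA /=; apply: connect_trans av _.
  have := P_conn vP uP; apply: connect_sub => w z /and3P[wP zP ewz]; apply: connect1.
  have wW := subsetP (P_sub t) _ wP; have zW := subsetP (P_sub t) _ zP.
  have iwz : inside w z by apply/existsP; exists t; rewrite wP.
  rewrite /rS /r /del_edge /H iwz /inset wW zW ewz orbT /=.
  rewrite (disjointFr dS zP) andbT; apply/negP => /andP[/eqP E /eqP E'].
  by rewrite E E' (negbTE xy_out) in iwz.
Qed.
End Layers.

(** [P a] is a row and [C j a] the stretch of column [j] that starts in row [a]. The columns may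
    occur in a different order along each row. *)
Definition grid_like (V : finType) (e : rel V) (r q : nat) : Prop :=
  exists (P : nat -> {set V}) (C : nat -> nat -> {set V}),
  [/\ forall a, a < r -> conn e (P a),
      forall a a', a < r -> a' < r -> a != a' -> [disjoint P a & P a'],
      forall j a, j < q -> a < r -> conn e (C j a),
      forall j a j' a' v, j < q -> a < r -> j' < q -> a' < r -> v \in C j a -> v \in C j' a' ->
        j = j' /\ a = a' &
      [/\ forall j a, j < q -> a.+1 < r -> exists x y, [/\ x \in C j a, y \in C j a.+1 & e x y],
          forall j a, j < q -> a < r -> ~~ [disjoint C j a & P a] &
          forall j a a', j < q -> a < r -> a' < r -> a != a' -> [disjoint C j a & P a']]].

Section Rows.
Variables (V : finType) (e : rel V).
Hypothesis e_sym : symmetric e.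
Implicit Types (A B C S W : {set V}).
Variables (T : finType) (P : T -> {set V}) (W A B : {set V}) (n : nat).
Hypothesis P_conn : forall t, conn e (P t).
Hypothesis P_sub : forall t, P t \subset W.
Hypothesis P_disj : forall t t' v, v \in P t -> v \in P t' -> t = t'.

Lemma pairs_nth (d : V) s j : j.+1 < size s -> (nth d s j, nth d s j.+1) \in pairs s.
Proof.
elim: s j => // x [|y s] IH // [|j] /= js; first by rewrite mem_head.
by rewrite inE; apply/orP; right; apply: IH.
Qed.

Lemma card_meeting (U : {set V}) (T' : {set T}) : #|[set t in T' | ~~ [disjoint P t & U]]| <= #|U|.
Proof.
pose f t := [pick v | (v \in P t) && (v \in U)].
pose D := [set t in T' | ~~ [disjoint P t & U]].
have fP t : t \in D -> exists v, [/\ f t = Some v, v \in P t & v \in U].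
  rewrite inE => /andP[_ /pred0Pn[v /andP[/= vP vU]]]; rewrite /f; case: pickP => [w /andP[]|/(_ v)].
    by exists w.
  by rewrite vP vU.
have finj : {in D &, injective f}.
  move=> t t' /fP[v [-> vP _]] /fP[v' [-> vP' _]] [E]; apply: P_disj vP _; by rewrite E.
have sI : injective (@Some V) by move=> ? ? [].
rewrite -(card_in_imset finj) -(card_imset _ sI); apply: subset_leq_card.
apply/subsetP => _ /imsetP[t /fP[v [-> _ vU]] ->]; exact: imset_f.
Qed.

Variables (B' : {set V}) (p : V -> seq V).
Hypothesis pmin : min_linkage e P W A B n B' p.

(** The sets are listed by their first encounter along [p b0], and cuts are placed so that
    [M = r * n] sets are first met between consecutive ones. The separators of all cuts have
    together at most [r.-1 * n] elements, so every block contains a set that avoids them all, and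
    the cuts order these sets in the same way on every path. *)
Lemma rows_in_order r (T0 : {set T}) b0 : 0 < r -> b0 \in B' -> {in T0, forall t, has (mem (P t)) (p b0)} ->
  r * (r * n) <= #|T0| ->
  exists row : nat -> T, (forall a, a < r -> row a \in T0) /\
    (forall a a' b v v', a < a' -> a' < r -> b \in B' -> v \in p b -> v' \in p b ->
      v \in P (row a) -> v' \in P (row a') -> index v (p b) < index v' (p b)).
Proof.
move=> r0 b0B T0P T0r.
have [sB cB [lp1 lp2] _] := pmin.
have n0 : 0 < n by rewrite -cB; apply/card_gt0P; exists b0.
set M := r * n in T0r; have M0 : 0 < M by rewrite muln_gt0 r0.
pose s := p b0.
have us : uniq s by have := lp1 b0 b0B; rewrite /s; case: (p b0) => // a t /and4P[].
pose D j := [set t in T0 | has (mem (P t)) (take j s)].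
pose N j := #|D j|.
have Dmono j j' : j <= j' -> D j \subset D j'.
  move=> jj; apply/subsetP => t; rewrite !inE => /andP[-> /hasP[v vj vP]] /=.
  apply/hasP; exists v => //; move: vj; rewrite -(cat_take_drop j (take j' s)) mem_cat take_takel // => ->.
  by [].
have N0 : N 0 = 0 by apply/eqP; rewrite cards_eq0; apply/eqP/setP => t; rewrite !inE take0 andbF.
have Nstep j : N j.+1 <= (N j).+1.
  case: (ltnP j (size s)) => js; last first.
    by rewrite /N /D !take_oversize // (leq_trans js) // leqnSn.
  have sub : D j.+1 \subset D j :|: [set t | nth b0 s j \in P t].
    apply/subsetP => t; rewrite !inE (take_nth b0) // has_rcons /= => /andP[-> /orP[->|->]] //.
    by rewrite orbT.
  apply: leq_trans (subset_leq_card sub) _; apply: leq_trans (leq_card_setU _ _) _.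
  rewrite -[in X in _ <= X]addn1 leq_add2l; apply/card_le1P => t t1 t2; rewrite !inE in t1 *.
  by apply/idP/eqP => [t2P|->//]; apply: P_disj t2P t1.
have Nall : N (size s) = #|T0|.
  by apply: eq_card => t; rewrite !inE take_size; apply: andb_idr => /T0P.
have cut_ex a : exists c, a < r -> [/\ c < size s, N c <= a * M & a * M < N c.+1].
  case: (ltnP a r) => ar; last by exists 0.
  have ex : exists j, a * M < N j.
    by exists (size s); rewrite Nall (leq_trans _ T0r) // ltn_pmul2r.
  case: (ex_minnP ex) => -[|j] jN jmin; first by rewrite N0 in jN.
  exists j => _; split=> //; last by rewrite leqNgt; apply/negP => /jmin; rewrite ltnn.
  rewrite ltnNge; apply/negP => js.
  by have := jmin j; rewrite ltnn /N /D !take_oversize // ?(leq_trans js) // in jN * => /(_ jN).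
have /choice[c cP] := cut_ex.
have cge a : a < r -> a * M <= N (c a).
  by move=> /cP[_ _ h]; rewrite -ltnS; apply: leq_trans h (Nstep _).
have cmono a a' : a <= a' -> a' < r -> c a <= c a'.
  move=> aa ar; have [_ _ h'] := cP a' ar; have [_ h _] := cP a (leq_ltn_trans aa ar).
  rewrite leqNgt; apply/negP => lt.
  have := leq_trans (leq_trans h' (subset_leq_card (Dmono _ _ lt))) h.
  by rewrite ltn_pmul2r // ltnNge aa.
have cut a : exists SL : {set V} * {set V}, 0 < a -> a < r -> [/\ #|SL.1| < n,
    forall b v v', b \in B' -> v \in p b -> v' \in p b -> v \notin SL.1 -> v' \notin SL.1 ->
      v \in SL.2 -> v' \notin SL.2 -> index v (p b) < index v' (p b),
    forall v, v \in s -> (v \in SL.2) = (index v s < c a) &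
    forall t, [disjoint P t & SL.1] -> P t \subset SL.2 \/ [disjoint P t & SL.2]].
  case: (posnP a) => [_|a0]; first by exists (set0, set0).
  case: (ltnP a r) => ar; last by exists (set0, set0).
  have [cs Nc Nc'] := cP a ar.
  have c0 : 0 < c a.
    rewrite lt0n; apply/eqP => c0; have := leq_trans Nc' (Nstep _).
    by rewrite c0 N0 ltnS leqn0 muln_eq0 !eqn0Ngt a0 M0.
  case Ec: (c a) c0 => [//|j] _; rewrite Ec in cs Nc Nc'.
  have js : j < size s by apply: ltnW.
  have xy : (nth b0 s j, nth b0 s j.+1) \in pairs s.
    exact: pairs_nth.
  (* A set not met before is met at the far end of this edge; as the sets are disjoint, no set
     contains both ends. *)
  have out : ~~ inside P (nth b0 s j) (nth b0 s j.+1).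
    apply/negP => /existsP[t /andP[xt yt]].
    have /subsetPn[t' t'D t'N] : ~~ (D j.+2 \subset D j.+1).
      by apply: contraTN Nc' => /subset_leq_card h; rewrite -leqNgt; apply: leq_trans h Nc.
    move: t'D t'N; rewrite !inE => /andP[t'0]; rewrite t'0 /= (take_nth b0) // has_rcons => /orP[|-> //] yt'.
    have -> : t' = t by apply: P_disj yt.
    by case/hasP; exists (nth b0 s j) => //; rewrite (take_nth b0) // mem_rcons mem_head.
  have [S [L [H1 H2 H3 H4]]] := cut_edge P_conn P_sub pmin b0B xy out.
  exists (S, L) => _ _; split=> // v vs.
  by rewrite H3 // -/s index_uniq // ltnS.
have {cut} /choice[SL cut] := cut.
pose U := \bigcup_(i < r | 0 < i) (SL i).1.
have U_card : #|U| <= r.-1 * n.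
  rewrite /U; apply: (@leq_trans (\sum_(i < r | 0 < i) n)).
    elim/big_rec2: _ => [|i u w i0 uw]; first by rewrite cards0.
    apply: leq_trans (leq_card_setU _ _) _; apply: leq_add => //.
    by have [h _ _ _] := cut i i0 (ltn_ord i); apply: ltnW.
  rewrite sum_nat_const leq_mul2r; apply/orP; right.
  rewrite -ltnS prednK // -[X in _ < X](card_ord r).
  apply: proper_card; apply/properP; split; first exact/subsetP.
  by exists (Ordinal r0).
have row_ex a : exists t, a < r -> [/\ t \in T0, [disjoint P t & U],
    exists2 v, v \in s & (v \in P t) && (c a <= index v s) &
    forall i, a < i -> i < r -> exists2 v, v \in s & (v \in P t) && (index v s < c i)].
  case: (ltnP a r) => ar; last first.
    have [t _|T00] := pickP (pred_of_set T0); first by exists t.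
    have := leq_trans (_ : 0 < _) T0r; rewrite muln_gt0 r0 M0 => /(_ isT) /card_gt0P[t tT].
    by have /negP[] := negbT (T00 t).
  pose c' := if a.+1 < r then c a.+1 else size s.
  have Nc' : a.+1 * M <= N c'.
    rewrite /c'; case: ltnP => ar'; first exact: cge.
    by rewrite Nall (leq_trans _ T0r) // leq_mul2r ar orbT.
  have [ca Na _] := cP a ar.
  pose Ta := D c' :\: D (c a).
  have TaM : M <= #|Ta|.
    rewrite cardsD; apply: leq_trans (leq_sub2l _ (subset_leq_card (subsetIr _ _))).
    by rewrite -/(N _) leq_subRL ?(leq_trans Na) ?leq_pmul2r // ; [|]; move: Nc' Na; rewrite mulSn /N; clear; lia.
  have [t tTa tU] : exists2 t, t \in Ta & [disjoint P t & U].
    apply: contrapT => no.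
    have : #|Ta| <= #|U|.
      apply: leq_trans (card_meeting U Ta); apply: subset_leq_card; apply/subsetP => t tTa.
      by rewrite inE tTa /=; apply/negP => tU; apply: no; exists t.
    rewrite leqNgt => /negP; apply; apply: leq_ltn_trans U_card (leq_trans _ TaM).
    by rewrite ltn_pmul2r // prednK.
  exists t => _; move: tTa; rewrite !inE => /andP[nt /andP[t0 /hasP[v vc' vP]]].
  rewrite t0 /= in nt.
  have vs : v \in s by apply: mem_take vc'.
  have {}vP : v \in P t := vP.
  split=> //.
    exists v => //; rewrite vP /= leqNgt; apply/negP => lt; case/hasP: nt; exists v => //.
    by rewrite in_take_leq // ltnW.
  move=> i ai ir; exists v => //; rewrite vP /=.
  have ar' : a.+1 < r by apply: leq_ltn_trans ir.
  apply: leq_trans (cmono a.+1 i ai ir); move: vc'; rewrite /c' ar' in_take_leq //.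
  by apply/ltnW; have [] := cP _ ar'.
have {row_ex} /choice[row rowP] := row_ex.
exists row; split=> [a /rowP[]//|a a' b v v' aa ar bB vp vp' vP vP'].
have [_ dU [v1 v1s /andP[v1P v1c]] _] := rowP a' ar.
have a'0 : 0 < a' by apply: leq_ltn_trans aa.
have [_ dU' _ /(_ a' aa ar)[v2 v2s /andP[v2P v2c]]] := rowP a (ltn_trans aa ar).
have [H1 H2 H3 H4] := cut a' a'0 ar.
have SU : (SL a').1 \subset U by apply: (bigcup_sup (Ordinal ar)).
have dS t : [disjoint P t & U] -> [disjoint P t & (SL a').1].
  by move=> h; apply: disjointWr h.
have offS t w : [disjoint P t & U] -> w \in P t -> w \notin (SL a').1.
  by move=> /dS h wP; rewrite (disjointFr h).
apply: H2 => //; rewrite ?(offS _ _ dU' vP) ?(offS _ _ dU vP') //.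
- case: (H4 _ (dS _ dU')) => [/subsetP h|h]; first exact: h.
  by have := disjointFr h v2P; rewrite (H3 _ v2s) v2c.
- case: (H4 _ (dS _ dU)) => [/subsetP/(_ _ v1P)|h]; last by rewrite (disjointFr h vP').
  by rewrite (H3 _ v1s) ltnNge v1c.
Qed.

(** Each path is cut at its first vertex in each row. Since all vertices of one row precede those of
    the next on every path, the stretch that starts in a row meets no other row. *)
Lemma grid_of_rows r q (row : nat -> T) (J : seq V) : uniq J -> {subset J <= B'} -> q <= size J ->
  (forall a a', a < r -> a' < r -> a != a' -> row a != row a') ->
  (forall a b, a < r -> b \in J -> has (mem (P (row a))) (p b)) ->
  (forall a a' b v v', a < a' -> a' < r -> b \in B' -> v \in p b -> v' \in p b ->
      v \in P (row a) -> v' \in P (row a') -> index v (p b) < index v' (p b)) ->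
  grid_like e r q.
Proof.
move=> uJ JB qJ rowinj meets ord.
have [sB cB [lp1 lp2] _] := pmin.
have up b : b \in B' -> uniq (p b) by move/lp1; case: (p b) => // x t /and4P[].
have rowdis a a' : a < r -> a' < r -> a != a' -> [disjoint P (row a) & P (row a')].
  move=> ar ar' aa; apply/pred0P => v /=; apply/negP => /andP[v1 v2].
  by case/negP: (rowinj a a' ar ar' aa); apply/eqP; apply: P_disj v1 v2.
case: J uJ JB qJ meets => [|d J'].
  by rewrite leqn0 => _ _ /eqP -> _; exists (fun a => P (row a)), (fun _ _ => set0); split.
set J := d :: J' => uJ JB qJ meets.
pose f b a := find (mem (P (row a))) (p b).
pose g b a := if a.+1 < r then f b a.+1 else size (p b).
pose h b a := nth b (p b) (f b a).
have fs b a : a < r -> b \in J -> f b a < size (p b) by move=> ar bJ; rewrite /f -has_find meets.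
have hp b a : a < r -> b \in J -> h b a \in p b by move=> ar bJ; rewrite mem_nth ?fs.
have hP b a : a < r -> b \in J -> h b a \in P (row a).
  by move=> ar bJ; have := nth_find b (meets a b ar bJ).
have ih b a : a < r -> b \in J -> index (h b a) (p b) = f b a.
  by move=> ar bJ; rewrite index_uniq ?fs ?up ?JB.
have fmono b a a' : a < a' -> a' < r -> b \in J -> f b a < f b a'.
  move=> aa ar bJ; have ar0 := ltn_trans aa ar.
  by rewrite -(ih b a) // -(ih b a') //; apply: (ord a a'); rewrite ?hp ?hP ?JB.
have gle b a a' : a < a' -> a' < r -> b \in J -> g b a <= f b a'.
  move=> aa ar bJ; rewrite /g (leq_ltn_trans aa ar); move: aa; rewrite leq_eqVlt => /orP[/eqP -> //|aa].
  by apply/ltnW/fmono.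
have fg b a : a < r -> b \in J -> f b a < g b a.
  move=> ar bJ; rewrite /g; case: ifP => ar'; last exact: fs.
  by apply: fmono.
have gs b a : a < r -> b \in J -> g b a <= size (p b).
  by move=> ar bJ; rewrite /g; case: ifP => ar' //; apply/ltnW/fs.
have fP b a v : v \in p b -> v \in P (row a) -> f b a <= index v (p b).
  move=> vp vP; rewrite leqNgt; apply/negP => /(before_find b).
  by rewrite nth_index // => /negbT/negP; apply.
pose C b a := [set v | (v \in p b) && (f b a <= index v (p b) < g b a)].
have nJ j : j < q -> nth d J j \in J by move=> jq; rewrite mem_nth // (leq_trans jq).
exists (fun a => P (row a)), (fun j a => C (nth d J j) a); split.
- by move=> a ar; apply: P_conn.
- exact: rowdis.
- move=> j a /nJ; move: (nth d J j) => b bJ ar.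
  have pe : exists x t, p b = x :: t /\ path e x t.
    have := lp1 b (JB _ bJ); case: (p b) => // x t /and4P[_ pt _ _]; exists x, t; split=> //.
    exact: path_inset_e pt.
  have step i : i.+1 < size (p b) -> e (nth b (p b) i) (nth b (p b) i.+1).
    by move: pe => [x [t [-> /(pathP b) h1]]] it; rewrite /= -[t in X in e X]/t; apply: h1.
  have inC i : f b a <= i -> i < g b a -> nth b (p b) i \in C b a.
    move=> fi ig; have is' : i < size (p b) by apply: leq_trans ig (gs _ _ _ _).
    by rewrite inE mem_nth //= index_uniq ?up ?JB // fi.
  have from i : f b a <= i -> i < g b a -> connect (inset e (C b a)) (nth b (p b) (f b a)) (nth b (p b) i).
    elim: i => [|i IH] fi ig; first by move: fi; rewrite leqn0 => /eqP ->; apply: connect0.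
    move: fi; rewrite leq_eqVlt => /orP[/eqP <-|fi]; first exact: connect0.
    apply: connect_trans (IH fi (ltnW ig)) (connect1 _).
    by rewrite /inset (inC i fi (ltnW ig)) (inC i.+1 (leqW fi) ig) step // (leq_trans ig) ?gs.
  have to v : v \in C b a -> connect (inset e (C b a)) (nth b (p b) (f b a)) v.
    rewrite inE => /andP[vp /andP[v1 v2]].
    by rewrite -[v in connect _ _ v](nth_index b vp); apply: from.
  by move=> u v /to; rewrite (connect_inset_sym e_sym) => cu /to; apply: connect_trans.
- move=> j a j' a' v jq ar jq' ar'; rewrite !inE => /andP[vp /andP[v1 v2]] /andP[vp' /andP[v1' v2']].
  have E : nth d J j = nth d J j' by apply: (lp2 _ _ v); rewrite ?JB ?nJ.
  have jj : j = j'.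
    by apply/eqP; rewrite -(nth_uniq d _ _ uJ) ?(leq_trans jq) ?(leq_trans jq') // E.
  split; first exact: jj.
  rewrite -E in v1' v2'; case: (ltngtP a a') => // aa.
    by have := leq_trans v2 (leq_trans (gle _ _ _ aa ar' (nJ j jq)) v1'); rewrite ltnn.
  by have := leq_trans v2' (leq_trans (gle _ _ _ aa ar (nJ j jq)) v1); rewrite ltnn.
split.
- move=> j a /nJ; move: (nth d J j) => b bJ ar; have ar0 := ltnW ar.
  have fm := fmono b a a.+1 (ltnSn a) ar bJ.
  have fs1 := fs b a.+1 ar bJ.
  case Ef: (f b a.+1) fm fs1 => [//|i] fm fs1.
  exists (nth b (p b) i), (nth b (p b) i.+1); split.
  + rewrite inE mem_nth ?(ltnW fs1) //= index_uniq ?up ?JB ?(ltnW fs1) // -ltnS fm.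
    by rewrite /g ar Ef ltnSn.
  + rewrite inE mem_nth //= index_uniq ?up ?JB // Ef leqnn -Ef; exact: fg.
  + have := lp1 b (JB _ bJ); case: (p b) fs1 => // x t fs1 /and4P[_ pt _ _].
    by have /(pathP b) := path_inset_e pt; apply.
- move=> j a /nJ; move: (nth d J j) => b bJ ar.
  apply/pred0Pn; exists (h b a); rewrite /= hP // andbT inE hp //= ih // leqnn /=; exact: fg.
- move=> j a a' /nJ; move: (nth d J j) => b bJ ar ar' aa; apply/pred0P => v /=; apply/negP => /andP[].
  rewrite inE => /andP[vp /andP[v1 v2]] vP.
  case: (ltngtP a a') aa => // aa _.
    by have := leq_trans v2 (leq_trans (gle b a a' aa ar' bJ) (fP b a' v vp vP)); rewrite ltnn.
  by have := ord a' a b v (h b a) aa ar (JB _ bJ) vp (hp b a ar bJ) vP (hP b a ar bJ); rewrite ih // ltnNge v1.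
Qed.
End Rows.

Lemma pigeonhole (T U : finType) (D : {set T}) (f : T -> U) (E : {set U}) m :
  {in D, forall x, f x \in E} -> m * #|E| < #|D| -> exists2 y, y \in E & m < #|[set x in D | f x == y]|.
Proof.
move=> fE lt; apply: contrapT => no; move: lt; rewrite ltnNge => /negP; apply.
have -> : #|D| = \sum_(y in E) #|[set x in D | f x == y]|.
  rewrite -sum1_card (partition_big f (mem E)) //=; apply: eq_bigr => y _.
  by rewrite -sum1_card; apply: eq_bigl => x; rewrite inE.
rewrite mulnC -sum_nat_const; apply: leq_sum => y yE; rewrite leqNgt; apply/negP => h.
by apply: no; exists y.
Qed.

Lemma linkage_subset (V : finType) (e : rel V) (A B B' : {set V}) p :
  B' \subset B -> linkage e A B p -> linkage e A B' p.
Proof.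
move=> /subsetP s [l1 l2]; split=> [b /s|b c v /s bB /s cB]; [exact: l1|exact: l2].
Qed.

Lemma linkage_avoid (V : finType) (e : rel V) (W U A B : {set V}) p : linkage (inset e W) A B p ->
  A \subset W -> {in B, forall b, ~~ has (mem U) (p b)} -> linkage (inset e (W :\: U)) (A :\: U) B p.
Proof.
move=> [l1 l2] AW nU; split=> // b bB; have := l1 b bB; have := nU b bB.
case: (p b) => // x t; rewrite /= negb_or => /andP[xU /hasPn tU] /and4P[xA pt -> ->].
rewrite inE xA xU !andbT /=; apply: path_insetI (path_inset_e pt) => v; rewrite inE => /orP[/eqP ->|vt].
  by rewrite inE (subsetP AW) // xU.
by rewrite inE tU //= (path_inset (subsetP AW _ xA) pt) // inE vt orbT.
Qed.

(** Induction on the number of linkages; [D] selects the indices that count. A path of the last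
    linkage can be kept if in every other linkage at least [K'] paths miss it. If no path qualifies,
    two applications of the pigeonhole principle give one path of another linkage that crosses more
    than [r * (r * n)] of them; the crossed paths supply the rows and that linkage the columns. *)
Lemma dichotomy (r q N : nat) : 0 < r -> exists K, forall (V : finType) (e : rel V) (W : {set V})
   (A B : nat -> {set V}) (D : pred nat), symmetric e -> (forall t, A t \subset W) ->
   (forall t, t < N -> D t -> exists (B' : {set V}) p,
      [/\ B' \subset B t, K <= #|B'| & linkage (inset e W) (A t) B' p]) ->
   grid_like e r q \/ exists R : nat -> {set V},
     (forall t, t < N -> D t -> [/\ conn e (R t), R t \subset W, ~~ [disjoint R t & A t] &
        ~~ [disjoint R t & B t]]) /\
     (forall t t', t < N -> t' < N -> D t -> D t' -> t != t' -> [disjoint R t & R t']).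
Proof.
move=> r0; elim: N => [|N [K' IH]].
  by exists 0 => V e W A B D _ _ _; right; exists (fun=> set0); split.
(* Fewer than [K'] of the [n] columns miss a given row, so more than [q] columns meet all [r] rows.
   In [m], the factor [n] pays for the choice of one column crossing many rows and [r * (r * n)] is
   what [rows_in_order] asks for. *)
pose n := r * K' + q.+1; pose m := n * (r * (r * n)).
exists (K' + n + (m * N.+1).+1) => V e W A B D e_sym AW lk.
have n0 : 0 < n by rewrite /n addnS.
case DN: (D N); last first.
  have [|//|[R [R1 R2]]] := IH V e W A B D e_sym AW.
  - move=> t tN Dt; have [B' [p [s c l]]] := lk t (leqW tN) Dt.
    by exists B', p; split=> //; apply: leq_trans c; rewrite -addnA leq_addr.
  - by left.
  right; exists R; split=> [t|t t']; rewrite ltnS leq_eqVlt => /orP[/eqP ->|tN]; rewrite ?DN //.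
    exact: R1.
  by rewrite ltnS leq_eqVlt => /orP[/eqP -> _|tN']; rewrite ?DN //; apply: R2.
have [B0 [p0 [B0B B0K [l1 l2]]]] := lk N (ltnSn N) DN.
pose P b := if b \in B0 then [set v in p0 b] else set0.
have PB0 b v : v \in P b -> b \in B0 by rewrite /P; case: ifP => // _; rewrite inE.
have Pp b : b \in B0 -> P b = [set v in p0 b] by rewrite /P => ->.
have p0P b : b \in B0 -> exists x t, [/\ p0 b = x :: t, x \in A N, path (inset e W) x t & last x t = b].
  by move=> /l1; case: (p0 b) => // x t /and4P[xA pt /eqP lt _]; exists x, t.
have P_conn b : conn e (P b).
  case bB: (b \in B0); last by rewrite /P bB => x y; rewrite inE.
  have [x [t [E _ pt _]]] := p0P b bB; rewrite Pp // E; apply: conn_path => //.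
  exact: path_inset_e pt.
have P_sub b : P b \subset W.
  apply/subsetP => v vP; have bB := PB0 b v vP; have [x [t [E xA pt _]]] := p0P b bB.
  by move: vP; rewrite Pp // inE E; apply: (path_inset (subsetP (AW N) _ xA) pt).
have P_disj b c v : v \in P b -> v \in P c -> b = c.
  move=> vb vc; have bB := PB0 b v vb; have cB := PB0 c v vc.
  by move: vb vc; rewrite !Pp // !inE; apply: l2.
have mins t : exists BP : {set V} * (V -> seq V), t < N -> D t -> min_linkage e P W (A t) (B t) n BP.1 BP.2.
  case: (boolP ((t < N) && D t)) => [/andP[tN Dt]|h]; last first.
    by exists (set0, fun=> [::]) => tN Dt; rewrite tN Dt in h.
  have [B1 [p1 [s1 c1 lp1]]] := lk t (leqW tN) Dt.
  have [|B2 s2 c2] := @subset_of_card V B1 n.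
    by apply: leq_trans c1; rewrite addnAC leq_addl.
  have [B3 [p3 M]] := min_linkage_exists P (subset_trans s2 s1) c2 (linkage_subset s2 lp1).
  by exists (B3, p3).
have {mins} /choice[BP min] := mins.
pose miss t b := [set c in (BP t).1 | ~~ has (mem (P b)) ((BP t).2 c)].
have [[b bB good]|nogood] := EM (exists2 b, b \in B0 & forall t, t < N -> D t -> K' <= #|miss t b|).
  have [|t tN Dt||[R [R1 R2]]] := IH V e (W :\: P b) (fun t => A t :\: P b) B D e_sym.
  - by move=> t; apply: setSD.
  - have [sB cB lp _] := min t tN Dt; exists (miss t b), (BP t).2; split.
    + by apply: subset_trans sB; apply/subsetP => c; rewrite inE => /andP[].
    + exact: good.
    + apply: linkage_avoid => //; last by move=> c; rewrite inE => /andP[].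
      by apply: linkage_subset lp; apply/subsetP => c; rewrite inE => /andP[].
  - by left.
  right; exists (fun t => if t == N then P b else R t).
  have RP t : t < N -> D t -> [disjoint P b & R t].
    move=> tN Dt; have [_ s _ _] := R1 t tN Dt; rewrite disjoint_sym.
    by apply/pred0P => v /=; apply/negP => /andP[/(subsetP s)]; rewrite inE => /andP[/negP].
  split=> [t|t t'].
    rewrite ltnS leq_eqVlt; case: (eqVneq t N) => [-> _ _|tN /= tN' Dt].
      have [x [s [E xA pt lt]]] := p0P b bB; split=> //.
        by apply/pred0Pn; exists x; rewrite /= xA Pp // inE E mem_head.
      apply/pred0Pn; exists b; rewrite /= (subsetP B0B) // Pp // inE E -{1}lt mem_last //.
    have [c s a1 a2] := R1 t tN' Dt; split=> //; first exact: subset_trans s (subsetDl _ _).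
    apply: contraNN a1 => h; apply: disjointWr h; exact: subsetDl.
  rewrite !ltnS => tN tN' Dt Dt'; case: (eqVneq t N) => [E|nt]; case: (eqVneq t' N) => [E'|nt'] tt.
  - by rewrite E E' eqxx in tt.
  - by apply: RP; rewrite // ltn_neqAle nt'.
  - by rewrite disjoint_sym; apply: RP; rewrite // ltn_neqAle nt.
  - by apply: R2; rewrite // ltn_neqAle ?nt ?nt'.
left.
have bad b : exists t, b \in B0 -> [/\ t < N, D t & #|miss t b| < K'].
  case bB: (b \in B0); last by exists 0.
  apply: contrapT => no; apply: nogood; exists b => // t tN Dt; rewrite leqNgt; apply/negP => lt.
  by apply: no; exists t.
have {bad} /choice[f fP] := bad.
have [|t0 _ tcard] := @pigeonhole V 'I_N.+1 B0 (fun b => inord (f b)) setT m (fun _ _ => in_setT _).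
  by rewrite cardsT card_ord; apply: leq_trans B0K; rewrite leq_addl.
set T1 := [set x in B0 | _] in tcard.
have T1P b : b \in T1 -> b \in B0 /\ f b = t0.
  rewrite inE => /andP[bB /eqP <-]; split=> //; rewrite inordK // ltnW // ltnS.
  by have [] := fP b bB.
have [b1 b1T] : exists b, b \in T1 by apply/card_gt0P; apply: leq_ltn_trans tcard.
have [tN Dt] : t0 < N /\ D t0.
  by have [bB <-] := T1P b1 b1T; have [] := fP b1 bB.
have miss1 b : b \in T1 -> #|miss t0 b| < K' by move=> /T1P[/fP[_ _]] + <-.
have minT := min t0 tN Dt; have [sB cB [lp1 lp2] _] := minT.
set Bt := (BP t0).1 in minT sB cB lp1 lp2; set pt := (BP t0).2 in minT lp1 lp2.
have hit b : exists c, b \in T1 -> c \in Bt /\ has (mem (P b)) (pt c).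
  case bT: (b \in T1); last by exists b.
  have [c cB' cm] : exists2 c, c \in Bt & c \notin miss t0 b.
    apply/subsetPn; apply: contraTN (miss1 b bT) => /subset_leq_card h; rewrite -leqNgt.
    by apply: leq_trans h; rewrite cB /n; apply: leq_trans (leq_addr _ _); rewrite leq_pmull.
  exists c => _; split=> //; apply: contraNT cm => h; by rewrite inE cB'.
have /choice[g gP] := hit.
have [||c0 c0B c0card] := @pigeonhole V V T1 g Bt (r * (r * n)).
- by move=> b /gP[].
- by rewrite cB mulnC.
set T0 := [set x in T1 | _] in c0card.
have T0P b : b \in T0 -> b \in T1 /\ has (mem (P b)) (pt c0).
  by rewrite inE => /andP[bT /eqP <-]; split=> //; have [] := gP b bT.
have [|row [rowT rowo]] := rows_in_order P_conn P_sub P_disj minT r0 c0B _ (ltnW c0card).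
  by move=> b /T0P[].
pose J := [set c in Bt | [forall a : 'I_r, has (mem (P (row a))) (pt c)]].
have rowinj a a' : a < a' -> a' < r -> row a != row a'.
  move=> aa ar; apply/eqP => E; have [_ /hasP[v vp vP]] := T0P _ (rowT a (ltn_trans aa ar)).
  by have := rowo a a' c0 v v aa ar c0B vp vp vP; rewrite -E ltnn => /(_ vP).
apply: (grid_of_rows e_sym P_conn P_disj minT (row := row) (J := enum J)).
- exact: enum_uniq.
- by move=> c; rewrite mem_enum inE => /andP[].
- rewrite -cardE.
  have sub : Bt :\: J \subset \bigcup_(a < r) miss t0 (row a).
    apply/subsetP => c; rewrite !inE => /andP[]; case cBt: (c \in Bt) => //= /forallPn[a na] _.
    by apply/bigcupP; exists a => //; rewrite inE cBt.
  have le : #|\bigcup_(a < r) miss t0 (row a)| <= r * K'.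
    apply: (@leq_trans (\sum_(a < r) K')); last by rewrite sum_nat_const card_ord.
    elim/big_rec2: _ => [|a u w _ uw]; first by rewrite cards0.
    apply: leq_trans (leq_card_setU _ _) _; apply: leq_add => //.
    by apply/ltnW/miss1; have [] := T0P _ (rowT a (ltn_ord a)).
  have JB : J \subset Bt by apply/subsetP => c; rewrite inE => /andP[].
  have := leq_trans (subset_leq_card sub) le; rewrite cardsD (setIidPr JB) cB /n.
  by clear; lia.
- move=> a a' ar ar'; rewrite neq_ltn => /orP[aa|aa]; first exact: rowinj.
  by rewrite eq_sym; apply: rowinj.
- by move=> a c ar; rewrite mem_enum inE => /andP[_ /forallP/(_ (Ordinal ar))].
- exact: rowo.
Qed.

Definition adjacent (V : finType) (e : rel V) (A B : {set V}) : Prop :=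
  exists x y, [/\ x \in A, y \in B & e x y].

(** A minor model with [s] columns and [l] layers. Each layer has one rung, at a place prescribed in
    advance, which is all that a step-by-step evaluation uses. *)
Definition ladder_model (V : finType) (e : rel V) (s l : nat) (rung : nat -> nat) : Prop :=
  exists Br : nat -> nat -> {set V},
  [/\ forall i t, i < s -> t < l -> conn e (Br i t) /\ Br i t != set0,
      forall i t i' t' v, i < s -> t < l -> i' < s -> t' < l -> v \in Br i t -> v \in Br i' t' ->
        i = i' /\ t = t',
      forall i t, i < s -> t.+1 < l -> adjacent e (Br i t) (Br i t.+1) &
      forall t, t < l -> (rung t).+1 < s -> adjacent e (Br (rung t) t) (Br (rung t).+1 t)].

Section PathOrStar.
Variables (T : finType) (g : rel T) (s : nat).

Let ball x n := iter n (fun B : {set T} => B :|: [set z | [exists y in B, g y z]]) [set x].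

(** If all degrees are at most [s], at most [s.+2 ^ s] vertices lie within distance [s] of [x0]; a
    vertex farther away is reached by a path that is long enough. *)
Lemma path_or_star (x0 : T) : (forall x y, connect g x y) -> s.+2 ^ s < #|T| ->
  (exists x p, [/\ path g x p, uniq (x :: p) & s <= size (x :: p)]) \/
  (exists x, s <= #|[set y | g x y]|).
Proof.
move=> conn_g big.
have [star|nostar] := EM (exists x, s <= #|[set y | g x y]|); first by right.
left; have deg x : #|[set y | g x y]| <= s.
  by rewrite leqNgt; apply/negP => h; apply: nostar; exists x; apply: ltnW.
have ballS n : #|ball x0 n| <= s.+2 ^ n.
  elim: n => [|n IH]; first by rewrite cards1.
  rewrite /ball iterS -/(ball x0 n); apply: leq_trans (leq_card_setU _ _) _.
  have sub : [set z | [exists y in ball x0 n, g y z]] \subset \bigcup_(y in ball x0 n) [set z | g y z].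
    by apply/subsetP => z; rewrite inE => /existsP[y /andP[yB gyz]]; apply/bigcupP; exists y; rewrite // inE.
  have le : #|\bigcup_(y in ball x0 n) [set z | g y z]| <= #|ball x0 n| * s.
    rewrite -sum_nat_const; elim/big_rec2: _ => [|y u w _ uw]; first by rewrite cards0.
    by apply: leq_trans (leq_card_setU _ _) _; apply: leq_add.
  have := leq_trans (subset_leq_card sub) le; rewrite expnS; move: IH; clear.
  move: #|ball x0 n| #|[set z | _]| (s.+2 ^ n) => a b c; nia.
have [y yB] : exists y, y \notin ball x0 s.
  apply/existsP; rewrite -negb_forall; apply/negP => /forallP all_in.
  have := leq_ltn_trans (ballS s) big; rewrite -cardsT ltnNge subset_leq_card //.
  by apply/subsetP => z _.
have /connectP[p pp ly] := conn_g x0 y.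
case/shortenP: pp ly => p' pp' up' _ ly.
exists x0, p'; split=> //; rewrite leqNgt; apply/negP => lt; case/negP: yB.
have inball q n : path g x0 q -> size q <= n -> last x0 q \in ball x0 n.
  elim: n q => [|n IH] q; first by case: q => // _ _; rewrite /ball inE.
  case/lastP: q => [|q z].
    by move=> _ _; rewrite /ball iterS inE; apply/orP; left; apply: (IH [::]).
  rewrite rcons_path last_rcons size_rcons => /andP[pq gz] sn.
  rewrite /ball iterS !inE; apply/orP; right; apply/existsP; exists (last x0 q).
  by rewrite gz IH.
by rewrite ly; apply: inball => //; move: lt; rewrite /= => /ltnW/ltnW.
Qed.
End PathOrStar.

(** * From grid-like structures to ladders *)

Section GridToLadder.
Variables (V : finType) (e : rel V) (s l q : nat) (rung : nat -> nat).
Hypothesis e_sym : symmetric e.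
Variable r : nat.
Variables (P : nat -> {set V}) (C : nat -> nat -> {set V}).
Hypotheses (P_conn : forall a, a < r -> conn e (P a))
  (P_disj : forall a a', a < r -> a' < r -> a != a' -> [disjoint P a & P a'])
  (C_conn : forall j a, j < q -> a < r -> conn e (C j a))
  (C_disj : forall j a j' a' v, j < q -> a < r -> j' < q -> a' < r -> v \in C j a -> v \in C j' a' ->
        j = j' /\ a = a')
  (C_vert : forall j a, j < q -> a.+1 < r -> adjacent e (C j a) (C j a.+1))
  (C_P : forall j a, j < q -> a < r -> ~~ [disjoint C j a & P a])
  (C_P' : forall j a a', j < q -> a < r -> a' < r -> a != a' -> [disjoint C j a & P a']).

Let row a : {set V} := P a :|: \bigcup_(j < q) C j a.

Let row_disj a a' v : a < r -> a' < r -> v \in row a -> v \in row a' -> a = a'.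
Proof.
move=> ar ar'; rewrite !inE; case: (eqVneq a a') => // aa /orP[vP|/bigcupP[j _ vC]] /orP[vP'|/bigcupP[j' _ vC']].
- by have := disjointFr (P_disj ar ar' aa) vP; rewrite vP'.
- by rewrite eq_sym in aa; have := disjointFr (C_P' (ltn_ord j') ar' ar aa) vC'; rewrite vP.
- by have := disjointFr (C_P' (ltn_ord j) ar ar' aa) vC; rewrite vP'.
- by have [_ E] := C_disj (ltn_ord j) ar (ltn_ord j') ar' vC vC'.
Qed.

(** [M] is a bridge inside row [a] that avoids the columns in [J]. It may absorb other columns,
    which is needed when it passes through the centre of a star. *)
Let link (J : pred nat) a j j' (M : {set V}) : Prop :=
  [/\ M \subset row a, forall i, i < q -> J i -> [disjoint M & C i a],
      conn e (C j a :|: M) & adjacent e (C j a :|: M) (C j' a)].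

Let row_link a : rel 'I_q := fun j j' => (j != j') && `[< exists M, link predT a j j' M /\ link predT a j' j M >].

(** Along [P a], between the last vertex in a reached column and the next vertex in any column,
    there is a stretch free of columns; it is a bridge to a column not reached, a contradiction. *)
Let row_connected a : a < r -> forall j j', connect (row_link a) j j'.
Proof.
move=> ar j j'; apply: contraT => nc.
pose D := [set i | connect (row_link a) j i].
pose UD := \bigcup_(i in D) C i a; pose UA := \bigcup_(i < q) C i a.
have /pred0Pn[x /andP[/= xC xP]] := C_P (ltn_ord j) ar.
have /pred0Pn[y /andP[/= yC yP]] := C_P (ltn_ord j') ar.
have /connectP[p pp ly] := P_conn ar xP yP.
have xUD : x \in UD by apply/bigcupP; exists j; rewrite // inE connect0.
have [p1 [p2 [Ep l1 n2]]] : exists p1 p2, [/\ p = p1 ++ p2, last x p1 \in UD & ~~ has (mem UD) p2].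
  by apply: last_hit; apply/hasP; exists x; rewrite ?mem_head.
set z := last x p1 in l1; case/bigcupP: l1 => j1 j1D zC.
have ly2 : last z p2 = y by rewrite ly Ep last_cat.
have p2P : path (inset e (P a)) z p2 by move: pp; rewrite Ep cat_path => /andP[].
have j'D : j' \notin D by rewrite inE.
case: p2 n2 ly2 p2P {Ep} => [|w p2] n2 ly2 p2P.
  rewrite /= in ly2; rewrite ly2 in zC.
  have [E _] := C_disj (ltn_ord j1) ar (ltn_ord j') ar zC yC.
  by rewrite -(ord_inj E) j1D in j'D.
have [q1 [q2 [Eq lq nq]]] : exists q1 q2, [/\ p2 = q1 ++ q2, last w q1 \in UA & ~~ has (mem UA) (belast w q1)].
  apply: first_hit; apply/hasP; exists y; last by apply/bigcupP; exists j'.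
  by rewrite -ly2 /= mem_last.
case/bigcupP: lq => j2 _ uC.
have j2D : j2 \notin D.
  apply/negP => j2D; case/hasP: n2; exists (last w q1); last by apply/bigcupP; exists j2.
  by rewrite Eq -cat_cons mem_cat mem_last.
have j12 : j1 != j2 by apply: contraNneq j2D => <-.
case/negP: j2D; rewrite inE; move: j1D; rewrite inE => /connect_trans; apply; apply: connect1.
apply/andP; split=> //; apply/asboolP.
move: p2P; rewrite /= Eq cat_path => /andP[zw /andP[pq _]].
have wP : w \in P a by case/and3P: zw.
have q1P : {subset w :: q1 <= P a} by apply: path_inset pq.
case/and3P: zw => _ _ ezw; have {}pq := path_inset_e pq.
case/lastP: q1 => [|q3 u] in uC nq pq q1P {Eq} *.
  exists set0; split; (split; first exact: sub0set).
  - by move=> i _ _; rewrite -setI_eq0 set0I.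
  - by rewrite setU0; apply: C_conn.
  - by exists z, w; rewrite setU0.
  - by move=> i _ _; rewrite -setI_eq0 set0I.
  - by rewrite setU0; apply: C_conn.
  - by exists w, z; rewrite setU0 e_sym.
rewrite belast_rcons in nq; rewrite last_rcons in uC.
move: pq; rewrite rcons_path => /andP[pq eu].
have sub : {subset w :: q3 <= P a}.
  by move=> v vq; apply: q1P; rewrite -rcons_cons mem_rcons inE vq orbT.
have Msub : [set v in w :: q3] \subset row a.
  by apply/subsetP => v; rewrite inE => /sub vP; rewrite inE vP.
have Mdis i : i < q -> [disjoint [set v in w :: q3] & C i a].
  move=> iq; apply/pred0P => v /=; apply/negP => /andP[]; rewrite inE => vq vC.
  by case/hasP: nq; exists v => //; apply/bigcupP; exists (Ordinal iq).
exists [set v in w :: q3]; split; split=> //; try by move=> i iq _; apply: Mdis.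
- by apply: (conn_union e_sym (x := z) (y := w)); rewrite ?inE ?eqxx ?ezw ?orbT //; [apply: C_conn|apply: conn_path].
- by exists (last w q3), u; split=> //; rewrite inE inE mem_last orbT.
- apply: (conn_union e_sym (x := u) (y := last w q3)) => //.
  + exact: C_conn.
  + exact: conn_path.
  + by rewrite inE mem_last.
  + by rewrite e_sym eu orbT.
- by exists w, z; split=> //; rewrite ?inE ?eqxx ?orbT // e_sym.
Qed.

Let good_seq (J : seq 'I_q) a := forall i, i.+1 < s -> forall d : 'I_q,
  exists M, link (fun j => j \in [seq val x | x <- J]) a (nth d J i) (nth d J i.+1) M.

Let link_weak J a j j' M : link predT a j j' M -> link J a j j' M.
Proof. by case=> H1 H2 H3 H4; split=> // i iq _; apply: H2. Qed.

(** On a path of columns neighbours are linked directly. In a star, two leaves are linked through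
    the centre [h] and two of its bridges; [h] is not among the chosen columns. *)
Let good_seq_ex a : s.+2 ^ s < q -> a < r -> exists2 J : s.-tuple 'I_q, uniq J & good_seq J a.
Proof.
move=> sq ar; have q0 : 0 < q by apply: leq_ltn_trans sq.
have [||[x [p [pp up sp]]]|[h hs]] := @path_or_star 'I_q (row_link a) s (Ordinal q0).
- exact: row_connected.
- by rewrite card_ord.
- have st : size (take s (x :: p)) == s by rewrite size_takel.
  exists (Tuple st); first exact: take_uniq.
  move=> i is' d; have i1 : i.+1 < size (x :: p) by apply: leq_trans sp.
  have -> : nth d (Tuple st) i = nth d (x :: p) i by rewrite [LHS]nth_take // ltnW.
  have -> : nth d (Tuple st) i.+1 = nth d (x :: p) i.+1 by rewrite [LHS]nth_take.
  have /(pathP d)/(_ i i1)/andP[_ /asboolP[M [L _]]] := pp.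
  by exists M; apply: link_weak.
have [Js us [Jsz Jsub]] : exists2 Js, uniq Js & size Js = s /\ {subset Js <= [set y | row_link a h y]}.
  by case/card_geqP: hs => Js [? ? ?]; exists Js.
have st : size Js == s by rewrite Jsz.
exists (Tuple st) => // i is' d /=.
have inJ i' : i' < s -> row_link a h (nth d Js i').
  by move=> i's; have := Jsub (nth d Js i'); rewrite inE mem_nth ?Jsz // => /(_ isT).
have /andP[hj /asboolP[M1 [[a1 a2 a3 a4] _]]] := inJ i.+1 is'.
have /andP[jh /asboolP[M2 [_ [b1 b2 b3 b4]]]] := inJ i (ltnW is').
exists (M2 :|: (C h a :|: M1)); split.
- by rewrite !subUset b1 a1 andbT /=; apply/subsetP => v vC; rewrite inE; apply/orP; right; apply/bigcupP; exists h.
- move=> k kq /mapP[k' k'J Ek]; rewrite -setI_eq0 !setIUl !setU_eq0 !setI_eq0 a2 // b2 //= andbT.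
  apply/pred0P => v /=; apply/negP => /andP[v1 v2].
  have [E _] := C_disj (ltn_ord h) ar kq ar v1 v2.
  have := Jsub _ k'J; rewrite inE => /andP[/negP[]].
  by apply/eqP/ord_inj; rewrite E Ek.
- have [u [v [uM vC euv]]] := b4.
  rewrite setUA; apply: (conn_union e_sym (x := u) (y := v)); rewrite ?euv ?orbT //.
  by rewrite inE vC.
- have [u [v [uM vC euv]]] := a4; exists u, v; split=> //.
  by rewrite inE [u \in M2 :|: _]inE uM !orbT.
Qed.

(** More than [l] rows share one sequence [J] of columns. They mark the layers: a branch set is the
    stretch of a column from one marked row to the next, and the bridge of row [rho t] is added to
    the column at [rung t]. *)
Lemma grid_to_ladder : s.+2 ^ s < q -> l * #|{: s.-tuple 'I_q}| < r -> ladder_model e s l rung.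
Proof.
move=> sq lr.
have q0 : 0 < q by apply: leq_ltn_trans sq.
have ex (a : 'I_r) : exists J : s.-tuple 'I_q, uniq J /\ good_seq J a.
  by have [J uJ gJ] := good_seq_ex sq (ltn_ord a); exists J.
have /choice[f fP] := ex.
have [|J _ Jcard] := @pigeonhole _ _ setT f setT l (fun _ _ => in_setT _).
  by rewrite !cardsT card_ord.
set A := [set _ in _ | _] in Jcard.
pose L := sort leq [seq val a | a <- enum A].
have sL : sorted ltn L.
  rewrite ltn_sorted_uniq_leq sort_uniq (map_inj_uniq val_inj) enum_uniq /=.
  exact: (sort_sorted leq_total).
(* One marked row beyond the [l] layers serves as the upper limit of the last layer. *)
have zL : l < size L by rewrite size_sort size_map -cardE.
pose rho := nth 0 L.
have rho_mono t t' : t < t' -> t' <= l -> rho t < rho t'.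
  move=> tt tl; apply: (sorted_ltn_nth ltn_trans 0 sL) => //; rewrite inE ?(leq_ltn_trans tl) //.
  by apply: ltn_trans tt _; apply: leq_ltn_trans zL.
have rhoP t : t <= l -> rho t < r /\ good_seq J (rho t).
  move=> tl; have : rho t \in L by rewrite mem_nth // (leq_ltn_trans tl).
  rewrite mem_sort => /mapP[a]; rewrite mem_enum !inE => /andP[_ /eqP <-] ->.
  by split; [exact: ltn_ord|have [] := fP a].
have uJ : uniq J.
  have [a aA] : exists a, a \in A by apply/card_gt0P; apply: leq_ltn_trans Jcard.
  by move: aA; rewrite !inE => /andP[_ /eqP <-]; have [] := fP a.
pose col i := val (nth (Ordinal q0) J i).
have colq i : col i < q by apply: ltn_ord.
have col_inj i i' : i < s -> i' < s -> col i = col i' -> i = i'.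
  by move=> is_ is' /ord_inj/eqP; rewrite nth_uniq ?size_tuple // => /eqP.
have Mex t : exists M, t < l -> (rung t).+1 < s ->
    link (fun j => j \in [seq val x | x <- J]) (rho t) (col (rung t)) (col (rung t).+1) M.
  case: (ltnP t l) => tl; last by exists set0.
  case: (ltnP (rung t).+1 s) => rs; last by exists set0.
  by have [_ /(_ _ rs (Ordinal q0))[M LM]] := rhoP t (ltnW tl); exists M.
have /choice[M MP] := Mex.
pose U j lo hi := \bigcup_(a < r | lo <= a < hi) C j a.
have UP j lo hi v : v \in U j lo hi -> exists a, [/\ a < r, lo <= a < hi & v \in C j a].
  by case/bigcupP => a h vC; exists a.
have inU j lo hi a v : a < r -> lo <= a < hi -> v \in C j a -> v \in U j lo hi.
  by move=> ar h vC; apply/bigcupP; exists (Ordinal ar).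
have U1 j a : a < r -> U j a a.+1 = C j a.
  move=> ar; apply/setP => v; apply/idP/idP => [/UP[b [_ ab]]|]; last by apply: inU; rewrite ?leqnn ?ltnSn.
  by rewrite ltnS -eqn_leq in ab; rewrite (eqP ab).
have Uconn j lo hi : j < q -> lo < hi -> hi <= r -> conn e (U j lo hi).
  move=> jq; elim: hi => // hi IH; rewrite ltnS leq_eqVlt => /orP[/eqP -> hr|lh hr].
    by rewrite U1 //; apply: C_conn.
  have -> : U j lo hi.+1 = U j lo hi :|: C j hi.
    apply/setP => v; rewrite inE; apply/idP/orP => [/UP[a [ar /andP[la]]]|[/UP[a [ar /andP[la ah]]]|]].
    - by rewrite ltnS leq_eqVlt => /orP[/eqP ->|ah] vC; [right|left; apply: inU vC; rewrite ?la].
    - by apply: inU => //; rewrite la ltnW.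
    - by apply: inU => //; rewrite ltnSn ltnW.
  case: hi IH lh hr => // hi IH lh hr.
  have [x [y [xC yC exy]]] := C_vert jq hr.
  apply: (conn_union e_sym (x := x) (y := y)); rewrite ?exy ?orbT //.
  - by apply: IH => //; apply: ltnW.
  - exact: C_conn.
  - by apply: inU xC; rewrite ?ltnSn ?andbT // ltnW.
have rho_r t : t <= l -> rho t < r by move=> /rhoP[].
pose mid i t := if (i == rung t) && ((rung t).+1 < s) then M t else set0.
have midP i t : i < s -> t < l -> mid i t = set0 \/
    [/\ i = rung t, (rung t).+1 < s & mid i t = M t].
  move=> is_ tl; rewrite /mid; case: ifP => [/andP[/eqP -> ->]|]; by [right|left].
have Mrow i t v : i < s -> t < l -> v \in mid i t -> v \in row (rho t) /\ 
    forall k, k < s -> v \notin C (col k) (rho t).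
  move=> is_ tl; case: (midP i t is_ tl) => [->|[Ei rs ->] vM]; first by rewrite inE.
  have [/subsetP M1 M2 _ _] := MP t tl rs; split; first exact: M1.
  move=> k ks; rewrite (disjointFr (M2 _ (colq k) _) vM) //.
  by apply/map_f/mem_nth; rewrite size_tuple.
have Urow j t v : j < q -> t < l -> v \in U j (rho t) (rho t.+1) -> exists a, [/\ a < r, rho t <= a < rho t.+1, v \in C j a & v \in row a].
  move=> jq tl /UP[a [ar h vC]]; exists a; split=> //; rewrite inE; apply/orP; right.
  by apply/bigcupP; exists (Ordinal jq).
exists (fun i t => U (col i) (rho t) (rho t.+1) :|: mid i t); split.
- move=> i t is_ tl; have tl' : t < l := tl.
  have rr := rho_mono t t.+1 (ltnSn t) tl.
  have /pred0Pn[x /andP[/= xC _]] := C_P (colq i) (rho_r t (ltnW tl)).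
  have xU : x \in U (col i) (rho t) (rho t.+1).
    by apply: inU xC; rewrite ?rho_r ?leqnn // ltnW.
  split; last by apply/set0Pn; exists x; rewrite inE xU.
  have cU : conn e (U (col i) (rho t) (rho t.+1)).
    by apply: Uconn => //; apply/ltnW/rho_r.
  case: (midP i t is_ tl) => [->|[Ei rs ->]]; first by rewrite setU0.
  have [_ _ cM _] := MP t tl rs; rewrite -Ei in cM.
  have -> : U (col i) (rho t) (rho t.+1) :|: M t = U (col i) (rho t) (rho t.+1) :|: (C (col i) (rho t) :|: M t).
    rewrite setUA; congr (_ :|: _); apply/esym/setUidPl/subsetP => v vC.
    by apply: inU vC; rewrite ?rho_r ?leqnn // ltnW.
  by apply: (conn_union e_sym (x := x) (y := x)); rewrite ?eqxx // inE xC.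
- move=> i t i' t' v is_ tl is' tl'.
  have same_t a a' t1 t2 : t1 < l -> t2 < l -> rho t1 <= a < rho t1.+1 -> rho t2 <= a' < rho t2.+1 -> a = a' -> t1 = t2.
    move=> t1l t2l /andP[h1 h2] /andP[h3 h4] E; subst a'; case: (ltngtP t1 t2) => // tt.
      have : rho t1.+1 <= rho t2.
        by move: tt; rewrite leq_eqVlt => /orP[/eqP ->//|tt]; apply/ltnW/rho_mono => //; apply: ltnW.
      by move=> h; have := leq_trans h2 (leq_trans h h3); rewrite ltnn.
    have : rho t2.+1 <= rho t1.
      by move: tt; rewrite leq_eqVlt => /orP[/eqP ->//|tt]; apply/ltnW/rho_mono => //; apply: ltnW.
    by move=> h; have := leq_trans h4 (leq_trans h h1); rewrite ltnn.
  have rin t1 : t1 < l -> rho t1 <= rho t1 < rho t1.+1 by move=> t1l; rewrite leqnn rho_mono.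
  have UM i1 t1 i2 t2 : i1 < s -> t1 < l -> i2 < s -> t2 < l ->
     v \in U (col i1) (rho t1) (rho t1.+1) -> v \in mid i2 t2 -> False.
    move=> i1s t1l i2s t2l /(Urow _ _ _ (colq i1) t1l)[a [ar h vC va]] /(Mrow _ _ _ i2s t2l)[vr /(_ i1 i1s)].
    by have <- := row_disj ar (rho_r t2 (ltnW t2l)) va vr; rewrite vC.
  rewrite !inE => /orP[v1|v1] /orP[v2|v2].
  + have [a [ar h vC va]] := Urow _ _ _ (colq i) tl v1.
    have [a' [ar' h' vC' va']] := Urow _ _ _ (colq i') tl' v2.
    have [E E'] := C_disj (colq i) ar (colq i') ar' vC vC'.
    by split; [apply: col_inj|apply: (same_t a a')].
  + by case: (UM i t i' t').
  + by case: (UM i' t' i t).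
  + have [va _] := Mrow _ _ _ is_ tl v1; have [va' _] := Mrow _ _ _ is' tl' v2.
    have E := row_disj (rho_r t (ltnW tl)) (rho_r t' (ltnW tl')) va va'.
    have tt : t = t' by apply: (same_t _ _ _ _ tl tl' (rin t tl) (rin t' tl') E).
    split=> //; subst t'; case: (midP i t is_ tl) v1 => [->|[-> _ _]]; first by rewrite inE.
    by case: (midP i' t is' tl) v2 => [->|[-> _ _]]; first by rewrite inE.
- move=> i t is_ tl; have tl0 : t < l by apply: ltnW.
  have rr := rho_mono t t.+1 (ltnSn t) tl0; have rr' := rho_mono t.+1 t.+2 (ltnSn _) tl.
  have Er : (rho t.+1).-1.+1 = rho t.+1 by rewrite prednK // (leq_ltn_trans _ rr).
  have [|x [y [xC yC exy]]] := @C_vert (col i) (rho t.+1).-1 (colq i); first by rewrite Er rho_r.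
  exists x, y; split=> //; rewrite inE; apply/orP; left.
    by apply: inU xC; [apply: ltn_trans (rho_r _ tl0); rewrite Er|rewrite -ltnS Er rr leqnn].
  by rewrite Er in yC; apply: inU yC; rewrite ?rho_r ?leqnn // ltnW.
- move=> t tl rs; have rr := rho_mono t t.+1 (ltnSn t) tl.
  have [_ _ _ [x [y [xC yC exy]]]] := MP t tl rs.
  exists x, y; split=> //; last by rewrite inE (inU _ _ _ (rho t)) ?rho_r ?leqnn ?rr // ltnW.
  move: xC; rewrite !inE /mid eqxx rs => /orP[xC|->]; last by rewrite orbT.
  by rewrite (inU _ _ _ (rho t)) ?rho_r ?leqnn ?rr // ltnW.
Qed.
End GridToLadder.

(** * Ladders in graphs of large tree-width *)

Section LadderExists.
Variables (V : finType) (e : rel V).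
Hypothesis e_sym : symmetric e.

Lemma adjacent_conn (A B : {set V}) : conn e A -> conn e B -> adjacent e A B -> conn e (A :|: B).
Proof.
by move=> cA cB [x [y [xA yB exy]]]; apply: (conn_union e_sym (x := x) (y := y)); rewrite ?exy ?orbT.
Qed.

Lemma conn_bigcup (I : finType) (A : {set V}) (D : pred I) (R : I -> {set V}) : conn e A ->
  (forall i, D i -> conn e (R i) /\ adjacent e A (R i)) -> conn e (A :|: \bigcup_(i | D i) R i).
Proof.
move=> cA H; rewrite (_ : A :|: _ = \bigcup_(i | D i) (A :|: R i) :|: A); last first.
  apply/setP => v; rewrite !inE orbC; apply/orP/orP => -[].
  - by case/bigcupP => i Di vR; left; apply/bigcupP; exists i; rewrite // inE vR orbT.
  - by right.
  - case/bigcupP => i Di; rewrite inE => /orP[->|vR]; [by right|].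
    by left; apply/bigcupP; exists i.
  - by right.
elim/big_rec: _ => [|i B Di cB]; first by rewrite set0U.
have [cR aR] := H i Di.
case: (set_0Vmem A) => [A0|[x xA]]; first by case: aR => x [y []]; rewrite A0 inE.
rewrite -setUA; apply: (conn_union e_sym (x := x) (y := x)); rewrite ?eqxx ?inE ?xA ?orbT //.
exact: adjacent_conn.
Qed.

Definition touching (C Y : {set V}) : {set V} := C :&: [set x | [exists y in Y, e x y]].

(** The ends of the [k] paths exhaust [Y] and [Z], so all inner vertices lie in [C]; as no vertex of
    [Y] is adjacent to one of [Z], every path has an inner vertex. *)
Lemma linkage_interior (C Y Z : {set V}) k p : [disjoint Y & Z] -> #|Y| = k -> #|Z| = k ->
  linkage (inset e (C :|: (Y :|: Z))) Y Z p -> ~ adjacent e Y Z ->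
  exists (B' : {set V}) p', [/\ B' \subset touching C Z, #|B'| = k &
    linkage (inset e C) (touching C Y) B' p'].
Proof.
move=> YZ Yk Zk [l1 l2] nadj; set W := C :|: (Y :|: Z) in l1.
have st_ex z : exists y, z \in Z -> y \in Y /\ y = head y (p z) /\ y \in p z.
  case zZ: (z \in Z); last by exists z.
  by have := l1 z zZ; case Ep: (p z) => [|y t] // /and4P[yY _ _ _]; exists y; rewrite /= mem_head.
have /choice[st stP] := st_ex.
have st_inj : {in Z &, injective st}.
  move=> z z' zZ zZ' E; have [_ [_ h1]] := stP z zZ; have [_ [_ h2]] := stP z' zZ'.
  by apply: (l2 _ _ (st z)); rewrite // E.
have st_im : st @: Z = Y.
  apply/eqP; rewrite eqEcard card_in_imset // Yk Zk leqnn andbT.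
  by apply/subsetP => _ /imsetP[z /stP[yY _] ->].
have onlyY z y : z \in Z -> y \in Y -> y \in p z -> y = head y (p z).
  move=> zZ; rewrite -st_im => /imsetP[z' zZ' ->] yp; have [_ [E yp']] := stP z' zZ'.
  by rewrite (l2 z z' (st z') zZ zZ' yp yp').
have pend z : z \in Z -> z \in p z by move=> zZ; apply: path_from_end (l1 z zZ).
have onlyZ z z' : z \in Z -> z' \in Z -> z' \in p z -> z' = z.
  by move=> zZ zZ' zp; apply: (l2 z' z z'); rewrite ?pend.
have mid z : exists t, z \in Z -> exists y, [/\ p z = y :: rcons t z, t != [::], {subset t <= C},
    y \in Y & path e y (rcons t z)] /\ uniq t.
  case zZ: (z \in Z); last by exists [::].
  have := l1 z zZ; case Ep: (p z) => [|y t] // /and4P[yY pt /eqP lt ut].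
  case/lastP: t lt pt ut Ep => [|t z'].
    by move=> /= E; move: (disjointFr YZ yY); rewrite E zZ.
  rewrite last_rcons => -> pt ut Ep; exists t => _; exists y.
  have pte := path_inset_e pt; split; last first.
    by move: ut; rewrite /= rcons_uniq => /and3P[].
  split=> //.
    apply/eqP => t0; apply: nadj; exists y, z; split=> //.
    by move: pte; rewrite t0 /= andbT.
  move=> v vt; have yW : y \in W by rewrite !inE yY orbT.
  have vp : v \in p z by rewrite Ep inE mem_rcons inE vt !orbT.
  have : v \in W by apply: (path_inset yW pt); rewrite -Ep.
  rewrite !inE => /or3P[//|vY|vZ].
    have := onlyY z v zZ vY vp; rewrite Ep /= => E.
    by move: ut; rewrite /= -E mem_rcons inE vt orbT.
  have E := onlyZ z v zZ vZ vp.
  by move: ut; rewrite /= rcons_uniq -E vt andbF.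
have /choice[m mP] := mid.
pose w z := last z (m z).
have wm z : z \in Z -> w z \in m z.
  move=> /mP[y [[_ m0 _ _ _] _]]; rewrite /w; case: (m z) m0 => // a t _; by rewrite [last _ _]/(last a t) mem_last.
have mp z v : z \in Z -> v \in m z -> v \in p z.
  by move=> /mP[y [[-> _ _ _ _] _]] vm; rewrite inE mem_rcons inE vm !orbT.
have w_inj : {in Z &, injective w}.
  move=> z z' zZ zZ' E; apply: (l2 _ _ (w z)) => //; first exact/mp/wm.
  by rewrite E; apply/mp/wm.
have inv b : exists z, b \in w @: Z -> z \in Z /\ w z = b.
  case bW: (b \in w @: Z); last by exists b.
  by case/imsetP: bW => z zZ ->; exists z.
have /choice[iv ivP] := inv.
exists (w @: Z), (fun b => m (iv b)); split.
- apply/subsetP => _ /imsetP[z zZ ->]; have [y [[_ _ mC _ pt] _]] := mP z zZ.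
  rewrite !inE mC ?wm //=; apply/existsP; exists z; rewrite zZ /=.
  move: pt; rewrite rcons_path => /andP[_].
  suff -> : last y (m z) = w z by [].
  by have := wm z zZ; rewrite /w; case: (m z).
- by rewrite card_in_imset.
split.
  move=> b bW; have [zZ wb] := ivP b bW; have [y [[_ m0 mC yY pt] um]] := mP _ zZ.
  case Em: (m (iv b)) m0 => [|x t] // _; rewrite Em in mC pt um.
  move: pt; rewrite rcons_cons /= rcons_path => /and3P[eyx pt _].
  apply/and4P; split=> //.
  - by rewrite !inE mC ?mem_head //=; apply/existsP; exists y; rewrite yY e_sym.
  - exact: path_insetI.
  - by rewrite -wb /w Em.
move=> b c v bW cW vb vc; have [zZ <-] := ivP b bW; have [zZ' <-] := ivP c cW.
by congr w; apply: (l2 _ _ v); rewrite // mp.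
Qed.

Definition complete_model m : Prop := exists Br : nat -> {set V},
  [/\ forall u, u < m -> conn e (Br u) /\ Br u != set0,
      forall u v x, u < m -> v < m -> x \in Br u -> x \in Br v -> u = v &
      forall u v, u < m -> v < m -> u != v -> adjacent e (Br u) (Br v)].

Lemma complete_to_ladder s l rung : complete_model (s * l) -> ladder_model e s l rung.
Proof.
case=> Br [B1 B2 B3].
have idx i t : i < s -> t < l -> i * l + t < s * l.
  by move=> is_ tl; apply: (@leq_trans (i.+1 * l)); [rewrite mulSn addnC ltn_add2r|rewrite leq_mul2r is_ orbT].
have idx_inj i t i' t' : t < l -> t' < l -> i * l + t = i' * l + t' -> i = i' /\ t = t'.
  move=> tl tl' E; have l0 : 0 < l by apply: leq_ltn_trans tl.
  have := congr1 (divn^~ l) E; rewrite !divnMDl // !divn_small // !addn0 => Ei.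
  by split=> //; move: E; rewrite Ei => /addnI.
exists (fun i t => Br (i * l + t)); split.
- by move=> i t is_ tl; apply: B1; apply: idx.
- by move=> i t i' t' v is_ tl is' tl' v1 v2; apply: idx_inj => //; apply: (B2 _ _ v); rewrite ?idx.
- move=> i t is_ tl; apply: B3; rewrite ?idx ?(ltnW tl) //.
  by rewrite eqn_add2l neq_ltn ltnSn.
- move=> t tl rs; apply: B3; rewrite ?idx ?(ltnW rs) //.
  rewrite eqn_add2r eqn_mul2r negb_or -lt0n (leq_ltn_trans _ tl) //.
  by rewrite neq_ltn ltnSn.
Qed.
End LadderExists.

(** The tree of a mesh is divided into [m] connected pieces, each with [K] elements of [X]. Two
    pieces are adjacent or joined by [K] paths through [C]. The dichotomy gives a grid, or one path
    for every non-adjacent pair, all of them disjoint; in the second case the pieces with their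
    paths model a complete graph on [m] vertices, which contains every ladder of this size. *)
Theorem ladder_exists s l rung : exists k, forall (V : finType) (e : rel V), symmetric e ->
  ~ dec e k setT set0 -> ladder_model e s l rung.
Proof.
(* [q] exceeds the bound of [path_or_star], and [r] exceeds [l] times the number of [s]-tuples of
   columns. *)
pose m := s * l; pose q := (s.+2 ^ s).+1; pose r := (l * q ^ s).+1.
have [K0 HK] := @dichotomy r q (m * m) (ltn0Sn _).
pose K := K0.+1; pose h := m * (2 * K) + K.
exists (h + K) => V e e_sym ndec.
have [C [X [t [gt Xt Ct Xh link]]]] : mesh e h K by apply: mesh_exists; rewrite // addn_gt0 orbT.
have [|A [A1 A2 A3 A4]] := @split_tree_sets V e e_sym K m X t (ltn0Sn _) gt Xt.
  by rewrite Xh.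
have XX u : exists Y : {set V}, u < m -> [/\ Y \subset A u, Y \subset X & #|Y| = K].
  case: (ltnP u m) => um; last by exists set0.
  have [Y YA Yk] := subset_of_card (A3 u um); exists Y => _; split=> //.
    exact: subset_trans YA (subsetIl _ _).
  exact: subset_trans YA (subsetIr _ _).
have /choice[Y YP] := XX.
have AC u v : u < m -> v \in A u -> v \notin C.
  by move=> um vA; apply/negP => /Ct; rewrite (A2 u um).
(* The pair [u < v] is coded by [u * m + v]; adjacent pieces ask for no path. *)
pose D (n : nat) := let u := n %/ m in let v := n %% m in (u < v) && ~~ `[< adjacent e (A u) (A v) >].
have lk n : n < m * m -> D n -> exists (B' : {set V}) p,
    [/\ B' \subset touching e C (Y (n %% m)), K0 <= #|B'| & linkage (inset e C) (touching e C (Y (n %/ m))) B' p].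
  move=> nm /andP[uv /asboolP nadj].
  have m0 : 0 < m by case: (m) nm.
  have um : n %/ m < m by rewrite ltn_divLR.
  have vm : n %% m < m by rewrite ltn_mod.
  have [yA yX yK] := YP _ um; have [zA zX zK] := YP _ vm.
  have yz : [disjoint Y (n %/ m) & Y (n %% m)].
    by apply: disjointWl yA _; apply: disjointWr zA _; apply: A4; rewrite ?neq_ltn ?uv.
  have [p lp] := link _ _ yX zX yz yK zK.
  have [|B' [p' [s1 c1 l1]]] := linkage_interior e_sym yz yK zK lp.
    by case=> x [y [xY yY exy]]; apply: nadj; exists x, y; rewrite (subsetP yA) ?(subsetP zA).
  by exists B', p'; split=> //; rewrite c1.
have [|[P [G [g1 g2 g3 g4 [g5 g6 g7]]]]|[R [R1 R2]]] :=
  HK V e C (fun n => touching e C (Y (n %/ m))) (fun n => touching e C (Y (n %% m))) D e_sym _ lk.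
- by move=> n; apply: subsetIl.
- by apply: (grid_to_ladder rung e_sym g1 g2 g3 g4 g5 g6 g7) => //; rewrite card_tuple card_ord.
apply: complete_to_ladder; rewrite -/m.
pose idx u v := u * m + v.
have idxP u v : u < m -> v < m -> [/\ idx u v < m * m, idx u v %/ m = u & idx u v %% m = v].
  move=> um vm; have m0 : 0 < m by apply: leq_ltn_trans um.
  rewrite /idx modnMDl modn_small // divnMDl // divn_small // addn0; split=> //.
  by apply: (@leq_trans (u.+1 * m)); [rewrite mulSn addnC ltn_add2r|rewrite leq_mul2r um orbT].
have RP u v : u < m -> v < m -> D (idx u v) -> [/\ conn e (R (idx u v)), R (idx u v) \subset C,
    adjacent e (A u) (R (idx u v)) & adjacent e (R (idx u v)) (A v)].
  move=> um vm Duv; have [i1 i2 i3] := idxP u v um vm.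
  have [c s1 a1 a2] := R1 _ i1 Duv; rewrite i2 in a1; rewrite i3 in a2.
  have [yA _ _] := YP u um; have [zA _ _] := YP v vm.
  split=> //.
    case/pred0Pn: a1 => x /andP[/= xR]; rewrite !inE => /andP[_ /existsP[y /andP[yY exy]]].
    by exists y, x; rewrite (subsetP yA) // e_sym.
  case/pred0Pn: a2 => x /andP[/= xR]; rewrite !inE => /andP[_ /existsP[y /andP[yY exy]]].
  by exists x, y; rewrite (subsetP zA).
pose E u (v : 'I_m) := D (idx u v).
pose Br u := A u :|: \bigcup_(v : 'I_m | E u v) R (idx u v).
have BrP u x : u < m -> x \in Br u -> x \in A u \/ exists v, [/\ v < m, D (idx u v) & x \in R (idx u v)].
  by move=> um; rewrite inE => /orP[|/bigcupP[v Ev xR]]; [left|right; exists v].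
exists Br; split.
- move=> u um; split.
    apply: conn_bigcup => //; first exact: A1.
    by move=> v Ev; have [c _ a _] := RP u v um (ltn_ord v) Ev.
  have : 0 < #|A u :&: X| by apply: leq_trans (A3 u um).
  by case/card_gt0P => x; rewrite inE => /andP[xA _]; apply/set0Pn; exists x; rewrite inE xA.
- move=> u v x um vm /(BrP u x um)[xu|[w [wm Dw xw]]] /(BrP v x vm)[xv|[w' [wm' Dw' xw']]].
  + apply/eqP; apply: contraT => uv; have := disjointFr (A4 u v um vm uv) xu.
    by rewrite xv.
  + have [_ s1 _ _] := RP v w' vm wm' Dw'.
    by have := AC u x um xu; rewrite (subsetP s1).
  + have [_ s1 _ _] := RP u w um wm Dw.
    by have := AC v x vm xv; rewrite (subsetP s1).
  + have [i1 i2 i3] := idxP u w um wm; have [j1 j2 j3] := idxP v w' vm wm'.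
    have E' : idx u w = idx v w'.
      apply/eqP; apply: contraT => ne; have := disjointFr (R2 _ _ i1 j1 Dw Dw' ne) xw.
      by rewrite xw'.
    by rewrite -i2 -j2 E'.
- have main u v : u < v -> v < m -> adjacent e (Br u) (Br v).
    move=> uv vm; have um := ltn_trans uv vm; have [i1 i2 i3] := idxP u v um vm.
    case Duv: (D (idx u v)).
      have [_ _ _ [x [y [xR yA exy]]]] := RP u v um vm Duv.
      exists x, y; split=> //; rewrite inE ?yA //; apply/orP; right; apply/bigcupP.
      by exists (Ordinal vm).
    move: Duv; rewrite /D i2 i3 uv /= => /negbFE/asboolP[x [y [xA yA exy]]].
    by exists x, y; rewrite !inE xA yA.
  move=> u v um vm; rewrite neq_ltn => /orP[uv|vu]; first exact: main.
  have [x [y [xB yB exy]]] := main v u vu um.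
  by exists y, x; rewrite e_sym.
Qed.

(** * Counting logic and treewidth *)

Local Notation hom := Defs.hom.

Section CountingLogic.
Variables (G H : graph) (k : nat).
Implicit Types (a : nat -> option (vertex G)) (b : nat -> option (vertex H)) (D : pred nat).

Definition upd (T : Type) (a : nat -> option T) (i : nat) (v : T) : nat -> option T :=
  fun j => if j == i then Some v else a j.

Definition admissible D phi : Prop := all (fun i => i < k) (cvars phi) /\ {subset cfv phi <= D}.

Definition same_type D a b : Prop := forall phi, admissible D phi -> csat a phi = csat b phi.

Let V := (vertex G + vertex H)%type.
Let sat a b i (x : V) phi :=
  match x with inl v => csat (upd a i v) phi | inr w => csat (upd b i w) phi end.

Section Step.
Variables (D : pred nat) (a : nat -> option (vertex G)) (b : nat -> option (vertex H)) (i : nat).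
Hypotheses (ik : i < k) (ab : same_type D a b).
Let D' : pred nat := fun j => (j == i) || D j.
Let eqv (x y : V) : Prop := forall phi, admissible D' phi -> sat a b i x phi = sat a b i y phi.

(** Both graphs are finite, so finitely many formulas tell [x] from the inequivalent vertices of the
    two graphs, and their conjunction defines the class of [x] in both at once. *)
Let char_formula x : exists chi, admissible D' chi /\ forall y, sat a b i y chi <-> eqv x y.
Proof.
have sep y : exists phi, admissible D' phi /\ (sat a b i x phi /\ (~ eqv x y -> ~~ sat a b i y phi)).
  (* A true sentence: the threshold zero is always reached, and it adds no free variable. *)
  pose top := CExGe 0 i (CEq i i).
  have topA : admissible D' top by split=> [|j]; rewrite /= ?ik // eqxx.
  have [e|] := EM (eqv x y); first by exists top; split=> //; split=> //; case: (x).
  move=> /[dup] ne /existsNP[phi /not_implyP[aphi /eqP]].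
  case sx: (sat a b i x phi); case sy: (sat a b i y phi) => //= _.
    by exists phi; split=> //; split=> // _; rewrite sy.
  exists (CNot phi); split=> //; split.
    by move: sx; rewrite /sat; case: (x) => /= v ->.
  by move=> _; move: sy; rewrite /sat; case: (y) => /= v ->.
have /choice[f fP] := sep.
pose chi := foldr (fun y c => CAnd (f y) c) (CExGe 0 i (CEq i i)) (enum {: V}).
have satchi y (s : seq V) : sat a b i y (foldr (fun y c => CAnd (f y) c) (CExGe 0 i (CEq i i)) s) =
    all (fun z => sat a b i y (f z)) s.
  elim: s => [|z s IH]; first by case: (y).
  by rewrite /= -IH; case: (y).
have adm : admissible D' chi.
  rewrite /chi; elim: (enum _) => [|z s [IH1 IH2]]; first by split=> [|j]; rewrite /= ?ik // eqxx.
  have [[h1 h2] _] := fP z; split; first by rewrite /= all_cat h1 IH1.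
  by move=> j; rewrite /= mem_cat => /orP[/h2|/IH2].
have xchi : sat a b i x chi by rewrite satchi; apply/allP => z _; have [_ []] := fP z.
exists chi; split=> // y; split=> [ychi|e]; last by rewrite -e.
apply: contrapT => ne; have [_ [_ /(_ ne)]] := fP y.
by move: ychi; rewrite satchi => /allP/(_ y); rewrite mem_enum => /(_ isT) ->.
Qed.

(** Counting quantifiers in front of the defining formula compare the two class sizes with every
    threshold. *)
Let class_card x : #|[pred v | `[< eqv x (inl v) >]]| = #|[pred w | `[< eqv x (inr w) >]]|.
Proof.
have [chi [[c1 c2] cx]] := char_formula x.
have cG : #|[pred v | `[< eqv x (inl v) >]]| = #|[pred v | csat (upd a i v) chi]|.
  by apply: eq_card => v; rewrite !inE; apply/asboolP/idP => /(cx (inl v)).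
have cH : #|[pred w | `[< eqv x (inr w) >]]| = #|[pred w | csat (upd b i w) chi]|.
  by apply: eq_card => v; rewrite !inE; apply/asboolP/idP => /(cx (inr v)).
have adm n : admissible D (CExGe n i chi).
  split; first by rewrite /= ik.
  move=> j; rewrite /= mem_filter => /andP[ji jc]; have : (j == i) || D j by exact: c2 jc.
  by rewrite (negbTE ji).
have n_le n : (n <= #|[pred v | csat (upd a i v) chi]|) = (n <= #|[pred w | csat (upd b i w) chi]|).
  by have := ab (adm n).
by rewrite cG cH; apply/eqP; rewrite eqn_leq -n_le leqnn n_le leqnn.
Qed.

(** Each class has equally many members in the two graphs, and a summand determined by the class
    contributes equally. This plays the part of a round of the bijective pebble game. *)
Lemma sum_by_type (f : vertex G -> nat) (g : vertex H -> nat) :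
  (forall v w, same_type D' (upd a i v) (upd b i w) -> f v = g w) ->
  \sum_v f v = \sum_w g w.
Proof.
move=> fg.
have eq_sym' x y : eqv x y -> eqv y x by move=> h phi /h.
have eq_tr x y z : eqv x y -> eqv y z -> eqv x z by move=> h1 h2 phi ap; rewrite h1 // h2.
pose rep x := odflt x [pick y | `[< eqv x y >]].
have repP x : eqv x (rep x) by rewrite /rep; case: pickP => [y /asboolP|_] //.
have rep_eq x y : (rep x == rep y) = `[< eqv x y >].
  apply/eqP/asboolP => [E|h]; first by apply: eq_tr (repP x) _; rewrite E; apply/eq_sym'/repP.
  rewrite /rep; rewrite (@eq_pick _ _ (fun z => `[< eqv y z >])); last first.
    by move=> z; apply/asboolP/asboolP; apply: eq_tr => //; apply: eq_sym'.
  by case: pickP => // /(_ y) /asboolP[].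
pose val (x : V) := match x with inl v => f v | inr w => g w end.
have val_eq x y : eqv x y -> val x = val y.
  have vw v w : eqv (inl v) (inr w) -> f v = g w by apply: fg.
  have exw v : exists w, eqv (inl v) (inr w).
    have : 0 < #|[pred w | `[< eqv (inl v) (inr w) >]]|.
      by rewrite -class_card; apply/card_gt0P; exists v; apply/asboolP.
    by case/card_gt0P => w /asboolP; exists w.
  have exv w : exists v, eqv (inl v) (inr w).
    have : 0 < #|[pred v | `[< eqv (inr w) (inl v) >]]|.
      by rewrite class_card; apply/card_gt0P; exists w; apply/asboolP.
    by case/card_gt0P => v /asboolP h; exists v; apply: eq_sym'.
  case: x y => [v|w] [v'|w'] h /=.
  - by have [w vw'] := exw v; rewrite (vw _ _ vw') (vw v' w) //; apply: eq_tr vw'; apply: eq_sym'.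
  - exact: vw.
  - by apply/esym/vw/eq_sym'.
  - by have [v vw'] := exv w; rewrite -(vw _ _ vw') -(vw v w') //; apply: eq_tr vw' _.
have sumG : \sum_v f v = \sum_(c : V) #|[pred v | rep (inl v) == c]| * val c.
  rewrite (partition_big (fun v => rep (inl v)) xpredT) //=; apply: eq_bigr => c _.
  rewrite -sum_nat_const; apply: eq_bigr => v /eqP <-.
  by rewrite -[f v]/(val (inl v)); apply: val_eq.
have sumH : \sum_w g w = \sum_(c : V) #|[pred w | rep (inr w) == c]| * val c.
  rewrite (partition_big (fun w => rep (inr w)) xpredT) //=; apply: eq_bigr => c _.
  rewrite -sum_nat_const; apply: eq_bigr => v /eqP <-.
  by rewrite -[g v]/(val (inr v)); apply: val_eq.
rewrite sumG sumH; apply: eq_bigr => c _; congr (_ * _).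
have [[x xc]|no] := EM (exists x, rep x = c).
  rewrite (eq_card (B := [pred v | `[< eqv x (inl v) >]])); last by move=> v; rewrite !inE -xc eq_sym rep_eq.
  by rewrite class_card; apply: eq_card => w; rewrite !inE -xc eq_sym rep_eq.
have no_rep x : (rep x == c) = false by apply/negP => /eqP h; apply: no; exists x.
by rewrite !eq_card0 // => v; rewrite inE /= no_rep.
Qed.
End Step.

Lemma card_vertices D a b : 0 < k -> same_type D a b -> #|vertex G| = #|vertex H|.
Proof. by move=> k0 ab; have := sum_by_type k0 ab (f := fun=> 1) (g := fun=> 1); rewrite !sum1_card; apply. Qed.
End CountingLogic.

Section Extensions.
Variables (F G : graph).
Implicit Types (U : {set vertex F}) (s : {ffun vertex F -> vertex G}).

(** Edges outside [U] are not tested: along a decomposition they have been tested when their ends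
    were introduced. *)
Definition is_extension U s (f : {ffun vertex F -> vertex G}) : bool :=
  [forall x, (x \notin U) ==> (f x == s x)] &&
  [forall x, forall y, (x \in U) && adj x y ==> adj (f x) (f y)].
Definition extensions U s : nat := #|[set f | is_extension U s f]|.

Lemma is_extensionP U s (f : {ffun vertex F -> vertex G}) : reflect ((forall x, x \notin U -> f x = s x) /\
  (forall x y, x \in U -> adj x y -> adj (f x) (f y))) (is_extension U s f).
Proof.
apply: (iffP andP) => [[/forallP h1 /forallP h2]|[h1 h2]]; split.
- by move=> x xU; apply/eqP; have := h1 x; rewrite xU.
- by move=> x y xU xy; have /forallP/(_ y) := h2 x; rewrite xU xy.
- by apply/forallP => x; apply/implyP => /h1 ->.
- by apply/forallP => x; apply/forallP => y; apply/implyP => /andP[]; apply: h2.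
Qed.

Definition set_at s v g : {ffun vertex F -> vertex G} := [ffun x => if x == v then g else s x].

Lemma extensions0 s : extensions set0 s = 1.
Proof.
rewrite /extensions -(cards1 s); apply: eq_card => f; rewrite !inE.
apply/is_extensionP/eqP => [[h _]|->]; last by split=> // x y; rewrite inE.
by apply/ffunP => x; apply: h; rewrite inE.
Qed.

Lemma extensions_intro U s v : v \in U ->
  extensions U s = \sum_g [forall y in ~: (U :\ v), adj v y ==> adj g (set_at s v g y)] * extensions (U :\ v) (set_at s v g).
Proof.
move=> vU; rewrite {1}/extensions -sum1_card (partition_big (fun f : {ffun vertex F -> vertex G} => f v) xpredT) //=.
apply: eq_bigr => g _; rewrite sum1_card /extensions; case: forallP => [h|h].
  rewrite mul1n; apply: eq_card => f; rewrite !inE; apply/andP/is_extensionP.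
    rewrite !inE => -[/is_extensionP[h1 h2] /eqP fv]; split=> [x|x y]; rewrite !inE.
      by rewrite ffunE; case: eqP => [-> _|_] //=; apply: h1.
    by case/andP => _; apply: h2.
  case=> h1 h2; have fv : f v = g by rewrite h1 ?ffunE ?eqxx // !inE eqxx.
  split; last by rewrite fv.
  rewrite inE; apply/is_extensionP; split=> [x xU|x y xU xy].
    have xv : x != v by apply: contraNneq xU => ->.
    by rewrite h1 ?ffunE ?(negbTE xv) // !inE (negbTE xU) andbF.
  case: (eqVneq x v) => [E|xv]; last by apply: h2; rewrite // !inE xv.
  rewrite E in xy *; case yU: (y \in U :\ v).
    by rewrite adj_sym h2 // adj_sym.
  by rewrite fv (h1 y) ?yU //; have /implyP := h y; rewrite inE yU => /(_ isT) /implyP; apply.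
rewrite mul0n; apply: eq_card0 => f; apply/negP => /andP[]; rewrite !inE => /is_extensionP[h1 h2] /eqP fv.
apply: h => y; apply/implyP; rewrite !inE => yU; apply/implyP => vy.
rewrite ffunE; case: eqP => [yv|/eqP yv]; first by rewrite yv in vy; rewrite -fv h2.
by rewrite -h1; [rewrite -fv h2|move: yU; rewrite yv].
Qed.

Lemma extensions_union U1 U2 s : [disjoint U1 & U2] ->
  (forall x y, x \in U1 -> y \in U2 -> ~~ adj x y) ->
  extensions (U1 :|: U2) s = extensions U1 s * extensions U2 s.
Proof.
move=> dis noadj; rewrite /extensions -cardsX.
pose restr (U : {set vertex F}) (f : {ffun vertex F -> vertex G}) : {ffun vertex F -> vertex G} :=
  [ffun x => if x \in U then f x else s x].
pose phi f := (restr U1 f, restr U2 f).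
have noadj' x y : x \in U2 -> y \in U1 -> ~~ adj x y by move=> h1 h2; rewrite adj_sym noadj.
have d1 x : x \in U1 -> x \in U2 = false by move=> h; apply: (disjointFr dis).
have d2 x : x \in U2 -> x \in U1 = false by move=> h; apply: (disjointFl dis).
rewrite -(card_in_imset (f := phi)); last first.
  move=> f f'; rewrite !inE => /is_extensionP[h1 _] /is_extensionP[h1' _] [/ffunP E1 /ffunP E2].
  apply/ffunP => x; have := E1 x; have := E2 x; rewrite !ffunE.
  case x2: (x \in U2) => // _; case x1: (x \in U1) => // _.
  by rewrite h1 ?h1' // !inE x1 x2.
apply: eq_card => -[f1 f2]; rewrite !inE /=; apply/imsetP/andP => [[f]|].
  rewrite inE => /is_extensionP[h1 h2] [-> ->]; split; apply/is_extensionP; split=> [x xU|x y xU xy].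
  - by rewrite ffunE (negbTE xU).
  - rewrite !ffunE xU; case: ifP => yU; first by apply: h2; rewrite // !inE xU.
    have y2 : y \notin U2 by apply: contraL xy => /(noadj x y xU).
    by rewrite -h1; [apply: h2; rewrite // inE xU|rewrite !inE yU].
  - by rewrite ffunE (negbTE xU).
  - rewrite !ffunE xU; case: ifP => yU; first by apply: h2; rewrite // !inE xU orbT.
    have y2 : y \notin U1 by apply: contraL xy => /(noadj' x y xU).
    by rewrite -h1; [apply: h2; rewrite // inE xU orbT|rewrite !inE yU orbF].
case=> /is_extensionP[h1 h1'] /is_extensionP[h2 h2'].
exists [ffun x => if x \in U1 then f1 x else f2 x]; last first.
  congr (_, _); apply/ffunP => x; rewrite !ffunE.
    by case: (boolP (x \in U1)) => // xU; apply: h1.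
  by case: (boolP (x \in U2)) => xU; [rewrite d2|apply: h2].
rewrite inE; apply/is_extensionP; split=> [x|x y].
  by rewrite !inE negb_or ffunE => /andP[/negbTE -> /h2].
rewrite inE !ffunE => /orP[xU|xU] xy.
  rewrite xU; case: ifP => yU; first exact: h1'.
  have y2 : y \notin U2 by apply: contraL xy => /(noadj x y xU).
  by rewrite h2 // -h1 ?yU //; apply: h1'.
rewrite d2 //; have y1 : y \notin U1 by apply: contraL xy => /(noadj' x y xU).
by rewrite (negbTE y1); apply: h2'.
Qed.

Lemma extensionsT s : extensions setT s = hom F G.
Proof.
rewrite /extensions /hom; apply: eq_card => f; rewrite !inE; apply/is_extensionP/forallP => [[_ h] x|h].
  by apply/forallP => y; apply/implyP; apply: h; rewrite inE.
by split=> x; [rewrite inE|move=> y _; move/forallP: (h x) => /(_ y) /implyP].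
Qed.
End Extensions.

(** Induction along the decomposition, with the bag stored in variables by [nu]. When a vertex is
    introduced, the old bag occupies fewer than [k] variables, so a free one can take its value;
    atomic formulas of the common type then decide whether the edges to the bag are preserved. *)
Lemma extensions_by_type (F G H : graph) k (U S : {set vertex F}) : dec (@adj F) k U S ->
  [disjoint U & S] -> (forall x y, x \in U -> adj x y -> y \in U :|: S) ->
  forall (nu : vertex F -> nat) (s : {ffun vertex F -> vertex G}) (s' : {ffun vertex F -> vertex H})
    (a : nat -> option (vertex G)) (b : nat -> option (vertex H)),
  {in S &, injective nu} -> (forall x, x \in S -> nu x < k) ->
  (forall x, x \in S -> a (nu x) = Some (s x)) -> (forall x, x \in S -> b (nu x) = Some (s' x)) ->
  same_type k (fun j => [exists x in S, nu x == j]) a b -> extensions U s = extensions U s'.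
Proof.
elim=> {U S}.
- by move=> S _ _ _ nu s s' a b _ _ _ _ _; rewrite !extensions0.
- move=> U S S' S'S _ clU _ IH dis _ nu s s' a b inj lt aS bS st.
  have sub := subsetP S'S; apply: (IH _ _ nu s s' a b) => //.
  + exact: disjointWr dis.
  + by move=> x y /sub xS /sub yS; apply: inj.
  + by move=> x /sub; apply: lt.
  + by move=> x /sub; apply: aS.
  + by move=> x /sub; apply: bS.
  + move=> phi [p1 p2]; apply: st; split=> // j /p2 /existsP[x /andP[/sub xS xj]].
    by apply/existsP; exists x; rewrite xS.
- move=> U S v vU Sk dU IH dis clU nu s s' a b inj lt aS bS st.
  have vS : v \notin S by rewrite (disjointFr dis).
  have Sk' : #|S| < k by have := dec_card dU; rewrite cardsU1 vS.
  have k0 : 0 < k by apply: leq_ltn_trans Sk'.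
  pose used := [set insubd (Ordinal k0) (nu x) | x in S].
  have /subsetPn[i _ inS] : ~~ ([set: 'I_k] \subset used).
    apply: contraTN Sk' => /subset_leq_card; rewrite cardsT card_ord -leqNgt => h.
    exact: leq_trans h (leq_imset_card _ _).
  have nui x : x \in S -> nu x != i.
    move=> xS; apply: contraNneq inS => E; apply/imsetP; exists x => //.
    by apply/val_inj; rewrite val_insubd lt // E.
  rewrite (extensions_intro s vU) (extensions_intro s' vU).
  pose nu' x := if x == v then i : nat else nu x.
  have xv x : x \in S -> x != v by move=> xS; apply: contraNneq vS => <-.
  apply: (sum_by_type (ltn_ord i) st) => g h gh.
  have clv y : y \notin U :\ v -> adj v y -> y = v \/ y \in S.
    rewrite !inE negb_and negbK => /orP[/eqP ->|yU] vy; first by left.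
    by have := clU v y vU vy; rewrite inE (negbTE yU) /= => ->; right.
  have Ecsat i' j' : i' < k -> j' < k -> (i' == i) || [exists x in S, nu x == i'] ->
      (j' == i) || [exists x in S, nu x == j'] -> csat (upd a i g) (CAdj i' j') = csat (upd b i h) (CAdj i' j').
    move=> i'k j'k Hi' Hj'; apply: gh; split; first by rewrite /= i'k j'k.
    by move=> j; rewrite !inE => /orP[]/eqP ->.
  congr (nat_of_bool _ * _).
    apply/forallP/forallP => E y; move: (E y); rewrite !inE => /implyP Ey; apply/implyP => yU; apply/implyP => vy;
    have {Ey} /implyP/(_ vy) := Ey yU; rewrite !ffunE.
    - have yU' : y \notin U :\ v by rewrite !inE.
      case: (clv y yU' vy) => [->|yS].
        by rewrite !eqxx; have := Ecsat i i (ltn_ord i) (ltn_ord i); rewrite /= /upd !eqxx => <-.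
      rewrite (negbTE (xv y yS)); have := Ecsat i (nu y) (ltn_ord i) (lt y yS).
      rewrite /= /upd eqxx (negbTE (nui y yS)) aS // bS // => -> //.
      by apply/existsP; exists y; rewrite yS eqxx.
    - have yU' : y \notin U :\ v by rewrite !inE.
      case: (clv y yU' vy) => [->|yS].
        by rewrite !eqxx; have := Ecsat i i (ltn_ord i) (ltn_ord i); rewrite /= /upd !eqxx => ->.
      rewrite (negbTE (xv y yS)); have := Ecsat i (nu y) (ltn_ord i) (lt y yS).
      rewrite /= /upd eqxx (negbTE (nui y yS)) aS // bS // => <- //.
      by apply/existsP; exists y; rewrite yS eqxx.
  apply: (IH _ _ nu' _ _ (upd a i g) (upd b i h)).
  + by apply/pred0P => x; rewrite !inE; case: eqP => //= _; apply/negP => /andP[xU]; rewrite (disjointFr dis).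
  + move=> x y; rewrite !inE => /andP[_ xU] xy; case: eqP => //= _.
    by have := clU x y xU xy; rewrite inE.
  + move=> x y; rewrite !inE /nu'; case: (eqVneq x v) => [->|nx] /= xS; case: (eqVneq y v) => [->|ny] //= yS E.
    * by have := nui y yS; rewrite E eqxx.
    * by have := nui x xS; rewrite E eqxx.
    * exact: inj.
  + by move=> x; rewrite !inE /nu'; case: eqP => //= _; apply: lt.
  + move=> x; rewrite !inE /nu' /upd ffunE; case: eqP => [_|_ /= xS]; first by rewrite eqxx.
    by rewrite (negbTE (nui x xS)) aS.
  + move=> x; rewrite !inE /nu' /upd ffunE; case: eqP => [_|_ /= xS]; first by rewrite eqxx.
    by rewrite (negbTE (nui x xS)) bS.
  + move=> phi [p1 p2]; apply: gh; split=> // j /p2 /existsP[x /andP[]].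
    rewrite !inE /nu'; case: (eqVneq x v) => [_ _ /eqP <-|_ /= xS xj]; first by rewrite unfold_in /= eqxx.
    by rewrite unfold_in /=; apply/orP; right; apply/existsP; exists x; rewrite xS.
- move=> U1 U2 S d12 noadj _ IH1 _ IH2 dis clU nu s s' a b inj lt aS bS st.
  rewrite !extensions_union //; congr (_ * _).
    apply: (IH1 _ _ nu _ _ a b) => //; first by apply: disjointWl dis; apply: subsetUl.
    move=> x y xU xy; have := clU x y; rewrite !inE xU => /(_ isT xy).
    case y2: (y \in U2); last by rewrite orbF.
    by have := noadj x y xU y2; rewrite xy.
  apply: (IH2 _ _ nu _ _ a b) => //; first by apply: disjointWl dis; apply: subsetUr.
  move=> x y xU xy; have := clU x y; rewrite !inE xU orbT => /(_ isT xy).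
  case y1: (y \in U1) => //=.
  by have := noadj y x y1 xU; rewrite adj_sym xy.
Qed.

Lemma Ck_equiv_hom (F G H : graph) k : 0 < k -> Ck_equiv k G H ->
  dec (@adj F) k setT set0 -> vertex G -> vertex H -> hom F G = hom F H.
Proof.
move=> k0 GH dF g h.
rewrite -(extensionsT [ffun _ => g]) -(extensionsT [ffun _ => h]).
apply: (@extensions_by_type F G H k setT set0 dF _ _ (fun _ => 0) _ _ (fun _ => None) (fun _ => None)).
- by rewrite disjoint_sym -setI_eq0 set0I.
- by move=> x y _ _; rewrite !inE.
- by move=> x; rewrite inE.
- by move=> x; rewrite inE.
- by move=> x; rewrite inE.
- by move=> x; rewrite inE.
move=> phi [p1 p2]; apply: GH; rewrite /Ck_sentence p1 andbT.
case E: (cfv phi) p2 => [//|j s] /(_ j); rewrite mem_head => /(_ isT) /existsP[x].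
by rewrite inE.
Qed.

Lemma Ck_equiv_card (G H : graph) k : 0 < k -> Ck_equiv k G H -> #|vertex G| = #|vertex H|.
Proof.
move=> k0 GH; apply: (@card_vertices G H k pred0 (fun _ => None) (fun _ => None)) => // phi [p1 p2].
apply: GH; rewrite /Ck_sentence p1 andbT.
by case: (cfv phi) p2 => [//|j s] /(_ j); rewrite mem_head => /(_ isT).
Qed.

(** * Closure under minors *)

(** By induction on [#|S|], the count at [S] is the count below [S] less the counts at its proper
    subsets; a property [P] is then summed over the sets satisfying it. *)
Lemma moebius (I J T : finType) (D : pred I) (D' : pred J) (Y : I -> {set T}) (Y' : J -> {set T}) :
  (forall U : {set T}, #|[set i | D i & Y i \subset U]| = #|[set j | D' j & Y' j \subset U]|) ->
  forall P : pred {set T}, #|[set i | D i & P (Y i)]| = #|[set j | D' j & P (Y' j)]|.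
Proof.
move=> h.
have part (K : finType) (E : pred K) (Z : K -> {set T}) (Q : pred {set T}) :
    #|[set i | E i & Q (Z i)]| = \sum_(S | Q S) #|[set i | E i & Z i == S]|.
  rewrite -sum1_card (partition_big Z Q) /=; last by move=> i; rewrite inE => /andP[].
  apply: eq_bigr => S QS; rewrite -sum1_card; apply: eq_bigl => i; rewrite !inE.
  by case: (E i) => //=; case: eqP => [->|]; rewrite ?QS ?andbF.
have exact S : #|[set i | D i & Y i == S]| = #|[set j | D' j & Y' j == S]|.
  have [n] := ubnP #|S|; elim: n => // n IH in S *; rewrite ltnS => Sn.
  have := h S; rewrite (part _ D Y (fun Z => Z \subset S)) (part _ D' Y' (fun Z => Z \subset S)).
  rewrite (bigD1 S) //= [in RHS](bigD1 S) //=.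
  rewrite (eq_bigr (fun S' => #|[set j | D' j & Y' j == S']|)); first by move/addIn.
  move=> S' /andP[sS nS]; apply: IH; apply: leq_trans Sn; apply: proper_card.
  by rewrite properEneq nS.
by move=> P; rewrite !part; apply: eq_bigr => S _; apply: exact.
Qed.

Definition cross_adj (G K : graph) : rel (vertex G * vertex K)%type :=
  fun x y => adj x.1 y.1 && adj x.2 y.2.
Lemma cross_adj_sym (G K : graph) : symmetric (@cross_adj G K).
Proof. by move=> x y; rewrite /cross_adj adj_sym [adj x.2 _]adj_sym. Qed.
Definition cross (G K : graph) : graph := Graph (@cross_adj_sym G K).

Lemma hom_cross (F G K : graph) : hom F (cross G K) = hom F G * hom F K.
Proof.
rewrite /Defs.hom -cardsX.
pose phi (f : {ffun vertex F -> vertex (cross G K)}) := ([ffun x => (f x).1], [ffun x => (f x).2]).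
rewrite -(card_in_imset (f := phi)); last first.
  move=> f g _ _ [/ffunP E1 /ffunP E2]; apply/ffunP => x; move: (E1 x) (E2 x); rewrite !ffunE.
  by case: (f x) (g x) => ? ? [? ?] /= -> ->.
apply: eq_card => -[f g]; rewrite !inE; apply/imsetP/andP => [[h]|[/forallP h1 /forallP h2]].
  rewrite inE => /forallP hh [-> ->]; split; apply/forallP => x; apply/forallP => y; apply/implyP => xy;
  by move/forallP/(_ y): (hh x); rewrite xy !ffunE => /andP[].
exists [ffun x => (f x, g x)]; last by congr (_, _); apply/ffunP => x; rewrite !ffunE.
rewrite inE; apply/forallP => x; apply/forallP => y; apply/implyP => xy; rewrite !ffunE /= /cross_adj /=.
move/forallP/(_ y): (h1 x); move/forallP/(_ y): (h2 x); rewrite xy /= => -> ->.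
by [].
Qed.

Lemma simple_cross (G K : graph) : simple G -> simple (cross G K).
Proof. by move=> sG [x y]; rewrite /= /cross_adj negb_and sG. Qed.

Lemma simple_compl (G : graph) : simple (compl G).
Proof. by move=> x; rewrite /= /compl_adj eqxx. Qed.

Section MinorClosure.
Variable R : graph -> graph -> Prop.
Hypothesis R_op : forall G H K, simple G -> simple H -> R G H -> R (compl (cross G K)) (compl (cross H K)).

Definition closed_graph F : Prop := simple F /\
  forall G H, simple G -> simple H -> R G H -> hom F G = hom F H.

Section Profile.
Variables (F : graph) (X : finType).

(* Homomorphisms from F to the complement of G x colour_graph U are the proper pairs whose profile is
   contained in U; Moebius inversion over U isolates the pairs with a given profile. *)
Definition proper_pair G (fx : {ffun vertex F -> vertex G} * {ffun vertex F -> X}) : bool :=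
  [forall u, forall v, adj u v ==> ((fx.1 u != fx.1 v) || (fx.2 u != fx.2 v))].
Definition profile G (fx : {ffun vertex F -> vertex G} * {ffun vertex F -> X}) : {set X + X * X} :=
  [set inl (fx.2 v) | v in vertex F] :|:
  [set inr (fx.2 uv.1, fx.2 uv.2) | uv : vertex F * vertex F & adj uv.1 uv.2 && adj (fx.1 uv.1) (fx.1 uv.2)].

Section Colours.
Variable U : {set X + X * X}.
Let KT := {x : X | inl x \in U}.
(** Because the product is complemented, adjacent images in [G] are tolerated exactly when their
    colours are not adjacent here, that is, when [U] allows the pair in both orders. Loops may
    occur. *)
Let K_adj : rel KT := fun x y => ~~ ((inr (val x, val y) \in U) && (inr (val y, val x) \in U)).
Let K_adj_sym : symmetric K_adj. Proof. by move=> x y; rewrite /K_adj andbC. Qed.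
Definition colour_graph : graph := Graph K_adj_sym.

Lemma hom_colours G : hom F (compl (cross G colour_graph)) =
  #|[set fx | proper_pair fx & profile (G := G) fx \subset U]|.
Proof.
rewrite /Defs.hom.
pose phi (f : {ffun vertex F -> vertex (compl (cross G colour_graph))}) :=
  ([ffun v => (f v).1], [ffun v => val (f v).2]).
rewrite -(card_in_imset (f := phi)); last first.
  move=> f g _ _ [/ffunP E1 /ffunP E2]; apply/ffunP => x; move: (E1 x) (E2 x); rewrite !ffunE.
  by case: (f x) (g x) => ? ? [? ?] /= -> /val_inj ->.
apply: eq_card => -[f x]; rewrite !inE; apply/imsetP/andP => [[h]|[]].
  rewrite inE => /forallP hh [-> ->]; split.
    apply/forallP => u; apply/forallP => v; apply/implyP => uv; move/forallP/(_ v): (hh u).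
    rewrite uv /= /compl_adj !ffunE => /andP[ne _]; apply: contraNT ne.
    rewrite negb_or !negbK => /andP[/eqP E1 /eqP/val_inj E2]; apply/eqP.
    by rewrite [h u]surjective_pairing [h v]surjective_pairing E1 E2.
  rewrite subUset; apply/andP; split; apply/subsetP => y.
    by case/imsetP => v _ ->; rewrite ffunE; apply: (valP (h v).2).
  case/imsetP => -[u v]; rewrite inE /= !ffunE => /andP[uv fuv] ->.
  move/forallP/(_ v): (hh u); rewrite uv /= /compl_adj => /andP[_].
  by rewrite /= /cross_adj /= fuv /K_adj negbK => /andP[].
move=> /forallP pr; rewrite subUset => /andP[/subsetP s1 /subsetP s2].
have xU v : inl (x v) \in U by apply: s1; apply/imsetP; exists v.
exists [ffun v => (f v, Sub (x v) (xU v) : KT)]; last first.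
  by congr (_, _); apply/ffunP => v; rewrite !ffunE.
rewrite inE; apply/forallP => u; apply/forallP => v; apply/implyP => uv; rewrite /= /compl_adj !ffunE.
apply/andP; split.
  rewrite xpair_eqE negb_and -[(_ == _) in X in _ || ~~ X]val_eqE /=.
  by move/forallP/(_ v): (pr u); rewrite uv.
rewrite /cross_adj /= negb_and negbK; case fuv: (adj (f u) (f v)) => //=.
apply/andP; split; apply: s2; apply/imsetP.
  by exists (u, v); rewrite // inE /= uv fuv.
by exists (v, u); rewrite // inE /= adj_sym uv adj_sym fuv.
Qed.
End Colours.

Lemma profile_count G H (P : pred {set X + X * X}) : closed_graph F -> simple G -> simple H -> R G H ->
  #|[set fx | proper_pair fx & P (profile (G := G) fx)]| =
  #|[set fx | proper_pair fx & P (profile (G := H) fx)]|.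
Proof.
move=> [sF cF] sG sH GH; apply: moebius => U; rewrite -!hom_colours.
by apply: cF; [exact: simple_compl|exact: simple_compl|exact: R_op].
Qed.
End Profile.

Lemma card_slices (A B : finType) (C : pred (A * B)) :
  #|[set p | C p]| = \sum_b #|[set a | C (a, b)]|.
Proof.
rewrite -sum1dep_card big_mkcond /= (eq_bigr (fun p => if C (p.1, p.2) then 1 else 0)); last by case.
rewrite -(pair_bigA _ (fun a b => if C (a, b) then 1 else 0)) /= exchange_big /=.
by apply: eq_bigr => b _; rewrite -sum1dep_card [RHS]big_mkcond.
Qed.

Section ProfileMembership.
Variables (F G : graph) (X : finType) (f : {ffun vertex F -> vertex G}) (x : {ffun vertex F -> X}).

Lemma profile_inl a : reflect (exists v, x v = a) (inl a \in profile (f, x)).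
Proof.
apply: (iffP idP) => [|[v <-]]; last by rewrite inE; apply/orP; left; apply/imsetP; exists v.
by rewrite inE => /orP[/imsetP[v _ [->]]|/imsetP[]//]; exists v.
Qed.

Lemma profile_inr a b : reflect (exists u v, [/\ adj u v, adj (f u) (f v), x u = a & x v = b])
  (inr (a, b) \in profile (f, x)).
Proof.
apply: (iffP idP) => [|[u [v [uv fuv <- <-]]]].
  rewrite inE => /orP[/imsetP[]//|/imsetP[[u v]]]; rewrite inE /= => /andP[uv fuv] [-> ->].
  by exists u, v.
by rewrite inE; apply/orP; right; apply/imsetP; exists (u, v); rewrite // inE /= uv fuv.
Qed.

Lemma proper_pairP : reflect (forall u v, adj u v -> (f u, x u) <> (f v, x v)) (proper_pair (f, x)).
Proof.
apply: (iffP forallP) => [h u v uv [E1 E2]|h u].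
  by move/forallP/(_ v): (h u); rewrite uv /= E1 E2 !eqxx.
apply/forallP => v; apply/implyP => uv; have := h u v uv.
by case: eqP => //= ->; case: eqP => //= ->.
Qed.
End ProfileMembership.

Definition covers (X : finType) (r : rel X) (S : {set X + X * X}) : bool :=
  [forall v, inl v \in S] && [forall u, forall v, r u v ==> (inr (u, v) \in S)].

Lemma coversP (F G : graph) (X : finType) (r : rel X) (f : {ffun vertex F -> vertex G}) (x : {ffun vertex F -> X}) :
  reflect ((forall a, exists v, x v = a) /\
           forall a b, r a b -> exists u v, [/\ adj u v, adj (f u) (f v), x u = a & x v = b])
    (covers r (profile (f, x))).
Proof.
apply: (iffP andP) => [[/forallP h1 /forallP h2]|[h1 h2]]; split.
- by move=> a; apply/profile_inl.
- by move=> a b ab; apply/profile_inr; move/forallP/(_ b): (h2 a); rewrite ab.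
- by apply/forallP => a; apply/profile_inl.
- by apply/forallP => a; apply/forallP => b; apply/implyP => ab; apply/profile_inr/h2.
Qed.

Lemma homP (F G : graph) (f : {ffun vertex F -> vertex G}) :
  reflect (forall u v, adj u v -> adj (f u) (f v)) [forall u, forall v, adj u v ==> adj (f u) (f v)].
Proof.
apply: (iffP forallP) => [h u v uv|h u]; first by move/forallP/(_ v): (h u); rewrite uv.
by apply/forallP => v; apply/implyP; apply: h.
Qed.

Lemma surj_inj (A B : finType) (f : A -> B) : (forall b, exists a, f a = b) -> #|A| <= #|B| -> injective f.
Proof.
move=> sf AB; suff : {in [set: A] &, injective f} by move=> h x y; apply: h; rewrite inE.
apply/imset_injP; rewrite eqn_leq leq_imset_card /= cardsT (leq_trans AB) //.
rewrite -cardsT subset_leq_card //; apply/subsetP => b _.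
by have [a <-] := sf b; apply: imset_f.
Qed.

(** [F] is coloured by its own vertices, and the profiles containing all colours and all pairs of
    [r] are selected. A colouring that uses all colours is a bijection, so the count is the wanted
    number of homomorphisms times the number of suitable bijections; the identity is one of them, so
    the factor cancels. *)
Lemma closed_spanning F (r : rel (vertex F)) (r_sym : symmetric r) : closed_graph F -> subrel r (@adj F) ->
  closed_graph (Graph r_sym).
Proof.
move=> cF sub; have [sF _] := cF; split; first by move=> v; apply: contra (sF v); apply: sub.
pose good (x : {ffun vertex F -> vertex F}) := injectiveb x &&
  [forall u, forall v, r u v ==> [exists u', exists v', [&& adj u' v', x u' == u & x v' == v]]].
have slice G : simple G -> #|[set fx : {ffun vertex F -> vertex G} * {ffun vertex F -> vertex F} | proper_pair fx & covers r (profile fx)]| =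
    (\sum_x good x) * hom (Graph r_sym) G.
  move=> sG; rewrite card_slices big_distrl /=; apply: eq_bigr => x _.
  case gx: (good x); last first.
    rewrite mul0n; apply: eq_card0 => f; rewrite inE; apply/negP => /andP[_ /coversP[c1 c2]].
    case/negP: (negbT gx); apply/andP; split; first by apply/injectiveP; apply: surj_inj.
    apply/forallP => u; apply/forallP => v; apply/implyP => /c2[u' [v' [h1 _ <- <-]]].
    by apply/existsP; exists u'; apply/existsP; exists v'; rewrite h1 !eqxx.
  case/andP: gx => /injectiveP inj /forallP cov; rewrite mul1n /Defs.hom.
  pose m (g : {ffun vertex F -> vertex G}) : {ffun vertex F -> vertex G} := [ffun v => g (x v)].
  rewrite -[RHS](card_in_imset (f := m)); last first.
    move=> g g' _ _ /ffunP E; apply/ffunP => v; have := E (invF inj v); rewrite !ffunE.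
    by rewrite f_invF.
  apply: eq_card => f; rewrite [LHS]inE; apply/andP/imsetP => [[_ /coversP[_ c2]]|[g]].
    exists [ffun v => f (invF inj v)]; last by apply/ffunP => v; rewrite !ffunE invF_f.
    rewrite inE; apply/homP => u v /= uv; rewrite !ffunE.
    by have [u' [v' [_ h <- <-]]] := c2 u v uv; rewrite !invF_f.
  rewrite inE => /homP hg ->; split.
    by apply/proper_pairP => u v uv [_ /inj E]; have := sF u; rewrite {2}E uv.
  apply/coversP; split=> [a|a b ab]; first by exists (invF inj a); rewrite f_invF.
  move/forallP/(_ b): (cov a); rewrite ab /= => /existsP[u /existsP[v /and3P[uv /eqP xu /eqP xv]]].
  by exists u, v; rewrite !ffunE xu xv; split=> //; apply: hg.
move=> G H sG sH GH; have := profile_count (F := F) (covers r) cF sG sH GH; rewrite !slice //.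
move/eqP; rewrite eqn_mul2l => /orP[|/eqP //]; rewrite sum_nat_eq0 => /forallP/(_ [ffun v => v]).
rewrite eqb0 => /negP[]; apply/andP; split; first by apply/injectiveP => u v; rewrite !ffunE.
apply/forallP => u; apply/forallP => v; apply/implyP => uv.
by apply/existsP; exists u; apply/existsP; exists v; rewrite sub // !ffunE !eqxx.
Qed.

Definition pattern (F G : graph) (f : {ffun vertex F -> vertex G}) : {set vertex F * vertex F} :=
  [set uv | adj uv.1 uv.2 && adj (f uv.1) (f uv.2)].

(** Spanning subgraphs count the maps whose pattern contains a given set, while [moebius] asks for
    counts below a set; hence the complements. *)
Lemma pattern_count F G H (P : pred {set vertex F * vertex F}) : closed_graph F -> simple G -> simple H ->
  R G H -> #|[set f | P (pattern (G := G) f)]| = #|[set f | P (pattern (G := H) f)]|.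
Proof.
move=> cF sG sH GH.
have := @moebius _ _ _ xpredT xpredT (fun f => ~: pattern (G := G) f) (fun f => ~: pattern (G := H) f) _
  (fun S => P (~: S)).
move=> h; have {h} := h _; rewrite /= => h.
have E (G' : graph) : #|[set f | P (pattern (G := G') f)]| = #|[set f : {ffun vertex F -> vertex G'} | P (~: ~: pattern f)]|.
  by apply: eq_card => f; rewrite !inE setCK.
rewrite !E; apply: h => U.
have F' (G' : graph) : #|[set f | ~: pattern (G := G') f \subset U]| =
    #|[set f : {ffun vertex F -> vertex G'} | ~: U \subset pattern f]|.
  by apply: eq_card => f; rewrite !inE -[in LHS](setCK U) setCS.
rewrite !F'; pose r : rel (vertex F) := fun u v => ((u, v) \notin U) || ((v, u) \notin U).
have r_sym : symmetric r by move=> u v; rewrite /r orbC.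
have [sub|nsub] := EM (subrel r (@adj F)).
  have [_ /(_ G H sG sH GH)] := closed_spanning r_sym cF sub; rewrite /Defs.hom.
  have sup (G' : graph) : [set f : {ffun vertex F -> vertex G'} | ~: U \subset pattern f] =
     [set f : {ffun vertex (Graph r_sym) -> vertex G'} | [forall x, forall y, adj x y ==> adj (f x) (f y)]].
    apply/setP => f; rewrite !inE; apply/subsetP/homP => [h u v /orP[uv|uv]|h [u v]].
    - by have := h (u, v); rewrite !inE uv /= => /(_ isT) /andP[].
    - by have := h (v, u); rewrite !inE uv /= adj_sym [adj (f v) _]adj_sym => /(_ isT) /andP[].
    - rewrite !inE => uv; have ruv : r u v by rewrite /r uv.
      by rewrite /= sub //; apply: h.
  by rewrite !sup.
have zero (G' : graph) : #|[set f : {ffun vertex F -> vertex G'} | ~: U \subset pattern f]| = 0.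
  apply: eq_card0 => f; rewrite inE; apply/negP => /subsetP h; apply: nsub => u v /orP[uv|uv].
    by have := h (u, v); rewrite !inE uv /= => /(_ isT) /andP[].
  by have := h (v, u); rewrite !inE uv /= adj_sym => /(_ isT) /andP[].
by rewrite !zero.
Qed.

Section Contraction.
Variables (F : graph) (p q : vertex F).
Let X := {v : vertex F | v != q}.
Definition contr_rel (r : rel (vertex F)) : rel X := fun a b =>
  (a != b) && [|| r (val a) (val b), (val a == p) && r q (val b) | (val b == p) && r (val a) q].
Lemma contr_sym : symmetric (contr_rel (@adj F)).
Proof.
move=> a b; rewrite /contr_rel eq_sym [adj (val a) (val b)]adj_sym; congr (_ && (_ || _)).
by rewrite orbC [adj q (val b)]adj_sym [adj (val a) q]adj_sym.
Qed.
Definition contraction : graph := Graph contr_sym.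

(** [F] is coloured with one colour fewer than it has vertices, so a surjective colouring merges
    exactly one pair. If this pair is adjacent, properness excludes the maps that agree on it, and
    the excluded maps covering [r] correspond to homomorphisms from the contraction. Proper maps are
    counted by profiles and all maps by patterns, so the difference is known, and it is a multiple
    of the wanted number. *)
Lemma closed_contraction : adj p q -> closed_graph F -> closed_graph contraction.
Proof.
move=> pq cF; have [sF _] := cF; split; first by move=> a; rewrite /= /contr_rel eqxx.
have pnq : p != q by apply: contraTneq pq => ->; apply: sF.
have cX : #|vertex F| = #|{: X}|.+1.
  rewrite card_sig; have := cardC1 q; rewrite (eq_card (B := [pred v | v != q])) // => ->.
  by rewrite prednK //; apply/card_gt0P; exists q.
pose r := contr_rel (@adj F).
pose surj (x : {ffun vertex F -> X}) := [forall a, exists v, x v == a].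
have surjP (x : {ffun vertex F -> X}) : reflect (forall a, exists v, x v = a) (surj x).
  apply: (iffP forallP) => h a; first by have /existsP[v /eqP] := h a; exists v.
  by have [v <-] := h a; apply/existsP; exists v.
pose cov (x : {ffun vertex F -> X}) := [forall a, forall b, r a b ==>
   [exists u, exists v, [&& adj u v, x u == a & x v == b]]].
pose w (x : {ffun vertex F -> X}) := [&& surj x, [exists u, exists v, adj u v && (x u == x v)] & cov x].
pose good (x : {ffun vertex F -> X}) (S : {set vertex F * vertex F}) := [forall a, forall b, r a b ==>
   [exists u, exists v, [&& (u, v) \in S, x u == a & x v == b]]].
have goodP G (x : {ffun vertex F -> X}) (f : {ffun vertex F -> vertex G}) : reflect
   (forall a b, r a b -> exists u v, [/\ adj u v, adj (f u) (f v), x u = a & x v = b]) (good x (pattern f)).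
  apply: (iffP forallP) => [h a b ab|h a].
    move/forallP/(_ b): (h a); rewrite ab /= => /existsP[u /existsP[v /and3P[]]].
    by rewrite inE /= => /andP[uv fuv] /eqP xu /eqP xv; exists u, v.
  apply/forallP => b; apply/implyP => /h[u [v [uv fuv xu xv]]].
  by apply/existsP; exists u; apply/existsP; exists v; rewrite inE /= uv fuv xu xv !eqxx.
have fibre (x : {ffun vertex F -> X}) s t u v : surj x -> x s = x t -> s != t -> x u = x v -> u != v ->
    (u = s /\ v = t) \/ (u = t /\ v = s).
  move=> /surjP sx st s_t uv u_v.
  have inj (z z' : vertex F) : z != z' -> x z = x z' -> {in [set~ z] &, injective x}.
    move=> zz E; apply/imset_injP; rewrite eqn_leq leq_imset_card /= cardsC1 cX /= -cardsT.
    apply: subset_leq_card; apply/subsetP => a _; have [y <-] := sx a.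
    case: (eqVneq y z) => [->|yz]; last by apply: imset_f; rewrite !inE.
    by rewrite E; apply: imset_f; rewrite !inE eq_sym.
  have t_s : t != s by rewrite eq_sym.
  have is_ := inj s t s_t st; have it := inj t s t_s (esym st).
  case: (eqVneq u s) => [us|us]; last first.
    case: (eqVneq v s) => [vs|vs]; last by case/eqP: u_v; apply: is_; rewrite // !inE.
    right; split=> //; apply/eqP; apply: contraT => ut.
    by case/eqP: us; apply: it; rewrite ?inE // ?s_t // uv vs.
  left; split=> //; apply/eqP; apply: contraT => vt.
  have vs : v != s by rewrite -us eq_sym.
  by case/eqP: vs; apply: it; rewrite ?inE // ?s_t // -uv us.
have slice G : simple G -> #|[set fx : {ffun vertex F -> vertex G} * {ffun vertex F -> X} | proper_pair fx & covers r (profile fx)]| +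
    (\sum_x w x) * hom contraction G = \sum_(x | surj x) #|[set f : {ffun vertex F -> vertex G} | good x (pattern f)]|.
  move=> sG; rewrite card_slices big_distrl /= -big_split /= [RHS]big_mkcond /=; apply: eq_bigr => x _.
  case sx: (surj x); last first.
    rewrite /w sx mul0n addn0; apply: eq_card0 => f; rewrite inE; apply/negP => /andP[_ /coversP[c _]].
    by move/surjP: c; rewrite sx.
  have sxP := surjP _ sx.
  have covE (f : {ffun vertex F -> vertex G}) : covers r (profile (f, x)) = good x (pattern f).
    by apply/coversP/goodP => [[]//|h].
  case inner: [exists u, exists v, adj u v && (x u == x v)]; last first.
    rewrite /w inner andbF mul0n addn0; apply: eq_card => f; rewrite !inE covE.
    rewrite andb_idl // => _; apply/proper_pairP => u v uv [_ E].
    case/negP: (negbT inner); apply/existsP; exists u; apply/existsP; exists v; by rewrite uv E eqxx.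
  case/existsP: (inner) => s /existsP[t /andP[st /eqP xst]].
  have s_t : s != t by apply: contraTneq st => ->; apply: sF.
  rewrite -[RHS](cardsID [set f : {ffun vertex F -> vertex G} | f s != f t]); congr (_ + _).
    apply: eq_card => f; rewrite !inE covE andbC; congr (_ && _).
    apply/proper_pairP/idP => [h|/eqP h u v uv [E1 E2]].
      by apply/eqP => E; apply: (h s t); rewrite // E xst.
    have u_v : u != v by apply: contraTneq uv => ->; apply: sF.
    by case: (fibre x s t u v sx xst s_t E2 u_v) => -[E3 E4]; apply: h; rewrite -E3 -E4.
  rewrite /w sx inner /=; case cx: (cov x); last first.
    rewrite mul0n; apply/esym/eq_card0 => f; rewrite !inE; apply/negP => /andP[_ /goodP h].
    case/negP: (negbT cx); apply/forallP => a; apply/forallP => b; apply/implyP => /h[u [v [uv _ <- <-]]].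
    by apply/existsP; exists u; apply/existsP; exists v; rewrite uv !eqxx.
  rewrite mul1n /Defs.hom.
  pose m (g : {ffun X -> vertex G}) : {ffun vertex F -> vertex G} := [ffun v => g (x v)].
  have /choice[y yP] : forall a, exists v, x v = a by exact: sxP.
  rewrite -[LHS](card_in_imset (f := m)); last first.
    by move=> g g' _ _ /ffunP E; apply/ffunP => a; have := E (y a); rewrite !ffunE yP.
  apply: eq_card => f; rewrite !inE negbK; apply/imsetP/andP => [[g]|[/eqP fst /goodP gf]].
    rewrite inE => /homP hg ->; split; first by rewrite !ffunE xst.
    apply/goodP => a b ab; move/forallP/(_ b): (forallP cx a); rewrite ab /=.
    case/existsP=> u /existsP[v /and3P[uv /eqP xu /eqP xv]]; exists u, v.
    by rewrite !ffunE xu xv; split=> //; apply: hg.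
  have fy v : f (y (x v)) = f v.
    case: (eqVneq (y (x v)) v) => [->//|ne].
    by case: (fibre x s t (y (x v)) v sx xst s_t (yP _) ne) => -[E1 E2]; rewrite E1 E2.
  exists [ffun a => f (y a)]; last by apply/ffunP => v; rewrite !ffunE fy.
  rewrite inE; apply/homP => a b ab; rewrite !ffunE.
  by have [u [v [_ fuv <- <-]]] := gf a b ab; rewrite !fy.
move=> G H sG sH GH; have := slice H sH; rewrite -(profile_count (F := F) (covers r) cF sG sH GH).
under [in RHS]eq_bigr => x _ do rewrite -(pattern_count (good x) cF sG sH GH).
rewrite -slice // => /addnI/eqP; rewrite eqn_mul2l => /orP[|/eqP //].
(* This colouring merges [q] with [p] and fixes everything else; it shows that the multiplicity is
   not zero. *)
pose x0 : {ffun vertex F -> X} := [ffun v => insubd (Sub p pnq : X) v].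
have x0q : x0 q = Sub p pnq by rewrite ffunE; apply: val_inj; rewrite val_insubd eqxx.
have x0v (a : X) : x0 (val a) = a by rewrite ffunE valKd.
have x0p : x0 p = Sub p pnq by rewrite -[p in LHS]/(val (Sub p pnq : X)) x0v.
rewrite sum_nat_eq0 => /forallP/(_ x0); rewrite eqb0 => /negP[]; apply/and3P; split.
- by apply/surjP => a; exists (val a).
- by apply/existsP; exists p; apply/existsP; exists q; rewrite pq x0q x0p eqxx.
- apply/forallP => a; apply/forallP => b; apply/implyP => /andP[_ /or3P[ab|/andP[/eqP ap qb]|/andP[/eqP bp aq]]].
  + by apply/existsP; exists (val a); apply/existsP; exists (val b); rewrite ab !x0v !eqxx.
  + apply/existsP; exists q; apply/existsP; exists (val b); rewrite qb !x0v x0q eqxx andbT.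
    by rewrite -val_eqE /= ap.
  + apply/existsP; exists (val a); apply/existsP; exists q; rewrite aq !x0v x0q eqxx /=.
    by rewrite -val_eqE /= bp.
Qed.
End Contraction.
End MinorClosure.

(** * Equality and adjacency constraints along minors *)

Section Constraints.
Variable R : graph -> graph -> Prop.
Hypothesis R_op : forall G H K, simple G -> simple H -> R G H -> R (compl (cross G K)) (compl (cross H K)).

Definition constraint_count (X : finType) (a b : rel X) (G : graph) : nat :=
  #|[set f : {ffun X -> vertex G} |
      [forall x, forall y, (a x y ==> adj (f x) (f y)) && (b x y ==> (f x == f y))]]|.

Lemma constraintP (X : finType) (a b : rel X) G (f : {ffun X -> vertex G}) :
  reflect ((forall x y, a x y -> adj (f x) (f y)) /\ (forall x y, b x y -> f x = f y))
   [forall x, forall y, (a x y ==> adj (f x) (f y)) && (b x y ==> (f x == f y))].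
Proof.
apply: (iffP forallP) => [h|[h1 h2] x].
  by split=> x y xy; move/forallP/(_ y): (h x); rewrite xy /= => /andP[h1 h2] //; apply/eqP.
by apply/forallP => y; apply/andP; split; apply/implyP => xy; [apply: h1|apply/eqP/h2].
Qed.

Variables (G H : graph).
Hypotheses (sG : simple G) (sH : simple H) (GH : R G H).

(** Without equalities the count is that of a spanning subgraph. An equality along an edge is
    imposed by contracting the edge, unless the edge also carries an adjacency constraint; then
    there is no map into a graph without loops and both counts vanish. *)
Lemma closed_constraints (F : graph) (a b : rel (vertex F)) : closed_graph R F ->
  subrel a (@adj F) -> subrel b (@adj F) -> constraint_count a b G = constraint_count a b H.
Proof.
have [n] := ubnP #|vertex F|; elim: n => // n IH in F a b *; rewrite ltnS => Fn cF aF bF.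
have [sF _] := cF.
case: (pickP [pred uv | b uv.1 uv.2]) => [[p q] /= bpq|b0]; last first.
  pose r : rel (vertex F) := fun u v => a u v || a v u.
  have r_sym : symmetric r by move=> u v; rewrite /r orbC.
  have sub : subrel r (@adj F) by move=> u v /orP[/aF//|/aF]; rewrite adj_sym.
  have [_ cr] := closed_spanning R_op r_sym cF sub.
  have E (G' : graph) : constraint_count a b G' = Defs.hom (Graph r_sym) G'.
    apply: eq_card => f; rewrite !inE; apply/constraintP/homP => [[h _] u v /orP[/h//|/h]|h].
      by rewrite adj_sym.
    split=> u v uv; first by apply: h; rewrite /= /r uv.
    by have := b0 (u, v); rewrite /= uv.
  by rewrite !E; apply: cr.
have pq := bF _ _ bpq.
have pnq : p != q by apply: contraTneq pq => ->; apply: sF.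
case apq: (a p q || a q p).
  have zero (G' : graph) : simple G' -> constraint_count a b G' = 0.
    move=> sG'; apply: eq_card0 => f; rewrite inE; apply/negP => /constraintP[h1 h2].
    have E := h2 _ _ bpq; case/orP: apq => /h1; rewrite E; exact/negP/sG'.
  by rewrite !zero.
have cC := closed_contraction R_op pq cF.
pose X := vertex (contraction p q).
pose x0 v : X := insubd (Sub p pnq : X) v.
have x0v (x : X) : x0 (val x) = x by rewrite /x0 valKd.
have val_x0 v : val (x0 v) = if v == q then p else v.
  by rewrite /x0 val_insubd; case: eqP.
pose m (G' : graph) (g : {ffun X -> vertex G'}) : {ffun vertex F -> vertex G'} := [ffun v => g (x0 v)].
have mono (r : rel (vertex F)) : subrel r (@adj F) -> subrel (@contr_rel F p q r) (@adj (contraction p q)).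
  move=> sub x y /andP[xy h]; apply/andP; split=> //.
  by case/or3P: h => [/sub ->//|/andP[-> /sub ->]|/andP[-> /sub ->]]; rewrite ?orbT.
have E (G' : graph) : simple G' -> constraint_count a b G' =
    constraint_count (@contr_rel F p q a) (@contr_rel F p q b) G'.
  move=> sG'; rewrite [RHS]/constraint_count -[RHS](card_in_imset (f := m G')); last first.
    by move=> g g' _ _ /ffunP Eg; apply/ffunP => x; have := Eg (val x); rewrite !ffunE x0v.
  apply: eq_card => f; rewrite [LHS]inE; apply/constraintP/imsetP => [[h1 h2]|[g]].
    have fpq := h2 _ _ bpq.
    have fx0 v : f (val (x0 v)) = f v by rewrite val_x0; case: eqP => // ->.
    exists [ffun x : X => f (val x)]; last by apply/ffunP => v; rewrite !ffunE fx0.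
    rewrite inE; apply/constraintP; split=> x y /andP[_]; rewrite !ffunE => /or3P[|/andP[/eqP ->]|/andP[/eqP ->]].
    - exact: h1.
    - by rewrite fpq; apply: h1.
    - by rewrite fpq; apply: h1.
    - exact: h2.
    - by rewrite fpq; apply: h2.
    - by rewrite fpq; apply: h2.
  rewrite inE => /constraintP[h1 h2] ->.
  have contr (r : rel (vertex F)) u v : r u v -> x0 u != x0 v -> @contr_rel F p q r (x0 u) (x0 v).
    move=> ruv ne; rewrite /contr_rel ne /= !val_x0; case: (eqVneq u q) ruv ne => [->|uq]; case: (eqVneq v q) => [->|vq] ruv ne.
    - by rewrite eqxx in ne.
    - by rewrite eqxx ruv orbT.
    - by rewrite eqxx ruv !orbT.
    - by rewrite ruv.
  split=> u v uv; rewrite !ffunE; last first.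
    by case: (eqVneq (x0 u) (x0 v)) => [->//|ne]; apply: h2; apply: contr.
  case: (eqVneq (x0 u) (x0 v)) => [Euv|ne]; last by apply: h1; apply: contr.
  have := congr1 val Euv; rewrite !val_x0; move: uv (aF _ _ uv).
  case: (eqVneq u q) => [->|uq]; case: (eqVneq v q) => [->|vq] uv Fuv E'.
  - by have := sF q; rewrite Fuv.
  - by move: apq; rewrite E' uv orbT.
  - by move: apq; rewrite -E' uv.
  - by have := sF v; rewrite -{1}E' Fuv.
rewrite !E //; apply: (IH (contraction p q)) => //; try exact: mono.
apply: leq_trans Fn; have -> : #|vertex (contraction p q)| = #|[pred v | v != q]| by apply: card_sig.
have := cardC1 q; rewrite (eq_card (B := [pred v | v != q])) // => ->.
by rewrite prednK //; apply/card_gt0P; exists q.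
Qed.

Lemma closed_card (F : graph) : closed_graph R F -> vertex F -> #|vertex G| = #|vertex H|.
Proof.
move=> cF v.
have r_sym : symmetric (fun _ _ : vertex F => false) by [].
have [_ /(_ G H sG sH GH)] := closed_spanning R_op r_sym cF (fun _ _ h => match Bool.diff_false_true h with end).
have E (G' : graph) : Defs.hom (Graph r_sym) G' = #|vertex G'| ^ #|vertex F|.
  rewrite -card_ffun; apply: eq_card => f; rewrite !inE.
  by apply/homP => x y.
rewrite !E; have : 0 < #|vertex F| by apply/card_gt0P; exists v.
by case: #|vertex F| => // n _ /eqP; rewrite eqn_exp2r // => /eqP.
Qed.

(** Equalities inside a branch set force one value on it, and vertices outside all branch sets
    remain free. The count over [F] is thus the wanted one times a power of the number of vertices,
    which is the same for both graphs and can be cancelled unless they are empty. *)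
Lemma closed_model (F : graph) (X : finType) (Br : X -> {set vertex F}) (a b : rel X) (x0 : X) :
  closed_graph R F -> (forall x, conn (@adj F) (Br x)) -> (forall x, Br x != set0) ->
  (forall x y v, v \in Br x -> v \in Br y -> x = y) ->
  (forall x y, a x y -> adjacent (@adj F) (Br x) (Br y)) ->
  (forall x y, b x y -> adjacent (@adj F) (Br x) (Br y)) ->
  constraint_count a b G = constraint_count a b H.
Proof.
move=> cF Bconn B0 Bdis Ba Bb.
pose a' : rel (vertex F) := fun u v => adj u v &&
  [exists x, exists y, [&& a x y, u \in Br x & v \in Br y]].
pose b' : rel (vertex F) := fun u v => adj u v &&
  ([exists x, (u \in Br x) && (v \in Br x)] || [exists x, exists y, [&& b x y, u \in Br x & v \in Br y]]).
have ab' : constraint_count a' b' G = constraint_count a' b' H.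
  by apply: (closed_constraints cF) => u v /andP[].
have /choice[rep repP] : forall x, exists v, v \in Br x by move=> x; apply/set0Pn.
have cGH := closed_card cF (rep x0).
pose c G' := \prod_(v : vertex F) (if [pick x | v \in Br x] is Some _ then 1 else #|vertex G'|).
have E (G' : graph) : constraint_count a' b' G' = constraint_count a b G' * c G'.
  rewrite {1}/constraint_count -sum1_card.
  rewrite (partition_big (fun f : {ffun vertex F -> vertex G'} => [ffun x => f (rep x)]) xpredT) //=.
  rewrite /constraint_count -sum1_card big_distrl /= [RHS]big_mkcond /=; apply: eq_bigr => t _.
  rewrite inE; case: constraintP => [[t1 t2]|nt]; last first.
    rewrite big1 // => f /andP[]; rewrite inE => /constraintP[f1 f2] /eqP tE.
    have const x : {in Br x &, forall u v, f u = f v}.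
      move=> u v uB vB; have /connectP[p pp ->] := Bconn x u v uB vB.
      elim: p u {uB} pp => //= w p IHp u /andP[/and3P[uB wB uw] pp].
      rewrite (f2 u w); first exact: IHp.
      by rewrite /b' uw /=; apply/orP; left; apply/existsP; exists x; rewrite uB wB.
    case: nt; split=> x y xy; rewrite -tE !ffunE.
      have [u [v [uB vB uv]]] := Ba x y xy.
      rewrite (const x (rep x) u) // (const y (rep y) v) //; apply: f1.
      by rewrite /a' uv /=; apply/existsP; exists x; apply/existsP; exists y; rewrite xy uB vB.
    have [u [v [uB vB uv]]] := Bb x y xy.
    rewrite (const x (rep x) u) // (const y (rep y) v) //; apply: f2.
    by rewrite /b' uv /=; apply/orP; right; apply/existsP; exists x; apply/existsP; exists y; rewrite xy uB vB.
  rewrite mul1n sum1_card /c.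
  pose fam (v : vertex F) : pred (vertex G') := if [pick x | v \in Br x] is Some x then pred1 (t x) else predT.
  rewrite (eq_bigr (fun v => #|fam v|)); last first.
    by move=> v _; rewrite /fam; case: pickP => [x _|_]; rewrite ?card1 ?cardT // -cardE.
  have := card_family fam; rewrite foldrE big_map big_enum /= => <-.
  apply: eq_card => f; rewrite [LHS]inE [in LHS]inE.
  have pickB v x : v \in Br x -> [pick x | v \in Br x] = Some x.
    by move=> vB; case: pickP => [y vy|/(_ x)]; [rewrite (Bdis _ _ _ vy vB)|rewrite vB].
  apply/andP/familyP => [[/constraintP[f1 f2] /eqP tE] v|ff].
    rewrite /fam; case: pickP => [x vB|//]; rewrite inE -tE ffunE.
    have /connectP[p pp ->] := Bconn x v (rep x) vB (repP x).
    apply/eqP; elim: p v {vB} pp => //= w p IHp u /andP[/and3P[uB wB uw] pp].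
    rewrite (f2 u w); first exact: IHp.
    by rewrite /b' uw /=; apply/orP; left; apply/existsP; exists x; rewrite uB wB.
  have fB v x : v \in Br x -> f v = t x.
    by move=> vB; have := ff v; rewrite /fam (pickB v x vB) inE => /eqP.
  split; last by apply/eqP/ffunP => x; rewrite ffunE; apply: fB.
  apply/constraintP; split=> u v /andP[_].
    by case/existsP=> x /existsP[y /and3P[xy uB vB]]; rewrite (fB u x) // (fB v y) //; apply: t1.
  case/orP=> [/existsP[x /andP[uB vB]]|/existsP[x /existsP[y /and3P[xy uB vB]]]].
    by rewrite (fB u x) // (fB v x).
  by rewrite (fB u x) // (fB v y) //; apply: t2.
have cE : c G = c H by rewrite /c cGH.
case: (posnP #|vertex G|) => [G0|Gpos].
  have zero (G' : graph) : #|vertex G'| = 0 -> constraint_count a b G' = 0.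
    by move=> G'0; apply: eq_card0 => f; have := card0_eq G'0 (f x0); rewrite inE.
  by rewrite !zero // -cGH.
have c0 : 0 < c G by rewrite /c prodn_gt0 // => v; case: pickP.
by move: ab'; rewrite !E -cE => /eqP; rewrite eqn_pmul2r // => /eqP.
Qed.
End Constraints.

(** * Planar tensors as words *)

(* A word describes a planar tensor with n open wires: Ins i adds an unconstrained i-th wire, Sum i sums
   over a wire inserted at position i, Res i r restricts wires i and i+1 to be adjacent (r) or equal (~~ r).
   The head of the list is the outermost operation. *)
Inductive op := Ins of nat | Sum of nat | Res of nat & bool.

Fixpoint wf (w : seq op) (n : nat) : bool :=
  match w with
  | [::] => n == 0
  | Ins i :: w' => (i < n) && wf w' n.-1
  | Sum i :: w' => (i <= n) && wf w' n.+1
  | Res i _ :: w' => (i.+1 < n) && wf w' n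
  end.

Definition delete (T : Type) i (x : seq T) := take i x ++ drop i.+1 x.
Definition insert (T : Type) i (v : T) (x : seq T) := take i x ++ v :: drop i x.

Definition related (G : graph) (r : bool) (u v : vertex G) : bool := if r then adj u v else u == v.

Definition res_at (G : graph) i r (x : seq (vertex G)) : bool :=
  if drop i x is u :: v :: _ then related r u v else false.

Fixpoint ev (G : graph) (w : seq op) (x : seq (vertex G)) : nat :=
  match w with
  | [::] => 1
  | Ins i :: w' => ev w' (delete i x)
  | Sum i :: w' => \sum_v ev w' (insert i v x)
  | Res i r :: w' => res_at i r x * ev w' x
  end.

Fixpoint width (w : seq op) (n : nat) : nat :=
  match w with
  | [::] => n
  | Ins i :: w' => maxn n (width w' n.-1)
  | Sum i :: w' => maxn n (width w' n.+1)
  | Res i _ :: w' => maxn n (width w' n)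
  end.

(* a layer of a ladder: an optional column released before the next layer, and an optional constraint
   between columns i and i+1 *)
Definition layer := (option nat * (nat * option bool))%type.

Section LayerValue.
Variable G : graph.
Implicit Types (x : nat -> vertex G) (o : seq layer).

Definition put x j v : nat -> vertex G := fun j' => if j' == j then v else x j'.

Definition rung_ok (l : layer) x : bool :=
  if l.2.2 is Some r then related r (x l.2.1) (x l.2.1.+1) else true.

Fixpoint lval o x : nat :=
  if o is l :: o' then
    rung_ok l x * (if l.1 is Some j then \sum_v lval o' (put x j v) else lval o' x)
  else 1.

(** To release a column and then to equate it with its neighbour overwrites it by the neighbour's
    value. Wires are moved by such copies because a rung joins only neighbouring columns. *)
Definition copy_up j o : seq layer := (Some j.+1, (0, None)) :: (None, (j, Some false)) :: o.
Definition copy_down j o : seq layer := (Some j, (0, None)) :: (None, (j, Some false)) :: o.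

Lemma lval_copy_up j o x : lval (copy_up j o) x = lval o (put x j.+1 (x j)).
Proof.
rewrite /= mul1n (bigD1 (x j)) //= big1 => [|v vx]; rewrite /rung_ok /= /put eqxx (ltn_eqF (ltnSn j)).
  by rewrite eqxx mul1n addn0.
by rewrite eq_sym (negbTE vx).
Qed.

Lemma lval_copy_down j o x : lval (copy_down j o) x = lval o (put x j (x j.+1)).
Proof.
rewrite /= mul1n (bigD1 (x j.+1)) //= big1 => [|v vx]; rewrite /rung_ok /= /put eqxx (gtn_eqF (ltnSn j)).
  by rewrite eqxx mul1n addn0.
by rewrite (negbTE vx).
Qed.

(** The outermost copy is executed first. Shifting up starts at the top column and shifting down at
    the bottom one, so no value is overwritten before it has been copied. *)
Fixpoint shift_up n d o : seq layer := if d is d'.+1 then shift_up n d' (copy_up (n - d) o) else o.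
Fixpoint shift_down i d o : seq layer := if d is d'.+1 then shift_down i d' (copy_down (i + d') o) else o.

Lemma lval_shift_up n d o x : d <= n ->
  lval (shift_up n d o) x = lval o (fun j => if n - d < j <= n then x j.-1 else x j).
Proof.
elim: d o => [|d IH] o dn.
  by congr lval; apply/funext => j; rewrite subn0; case: ltngtP.
rewrite [shift_up _ _ _]/= IH ?(ltnW dn) // lval_copy_up; congr lval; apply/funext => j; rewrite /put.
case: (eqVneq j (n - d.+1).+1) => [->|jn].
  rewrite ifF; last by move: dn; clear; lia.
  by rewrite ifT //; move: dn; clear; lia.
suff -> : (n - d < j <= n) = (n - d.+1 < j <= n) by [].
by move: dn jn; clear; lia.
Qed.

Lemma lval_shift_down i d o x :
  lval (shift_down i d o) x = lval o (fun j => if i <= j < i + d then x j.+1 else x j).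
Proof.
elim: d o => [|d IH] o.
  by congr lval; apply/funext => j; rewrite addn0; case: ltngtP.
rewrite [shift_down _ _ _]/= IH lval_copy_down; congr lval; apply/funext => j; rewrite /put.
case: (eqVneq j (i + d)) => [->|jn].
  rewrite ifF; last by clear; lia.
  by rewrite ifT //; clear; lia.
suff -> : (i <= j < i + d) = (i <= j < i + d.+1) by [].
by move: jn; clear; lia.
Qed.

End LayerValue.

(** Wire [j] sits in column [j], and the contents of the columns from [n] on are immaterial. [Ins]
    drops a wire by moving those above it down; [Sum] moves them up and releases the gap. *)
Fixpoint layers (w : seq op) (n : nat) : seq layer :=
  match w with
  | [::] => [::]
  | Ins i :: w' => shift_down i (n.-1 - i) (layers w' n.-1)
  | Sum i :: w' => shift_up n (n - i) ((Some i, (0, None)) :: layers w' n.+1)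
  | Res i r :: w' => (None, (i, Some r)) :: layers w' n
  end.

Lemma lval_layers (G : graph) w n (x : nat -> vertex G) : wf w n -> lval (layers w n) x = ev w (mkseq x n).
Proof.
elim: w n x => [|[i|i|i r] w IH] n x //= /andP[i_n wfw].
- rewrite lval_shift_down IH //; congr ev; apply: (@eq_from_nth _ (x 0)).
    by rewrite size_mkseq size_cat size_take size_drop size_mkseq i_n; lia.
  rewrite size_mkseq => j jn; rewrite nth_mkseq // nth_cat size_take size_mkseq i_n.
  case: (ltnP j i) => ji; first by rewrite /= nth_take // nth_mkseq // (ltn_trans ji).
  rewrite nth_drop nth_mkseq; last by lia.
  have -> : i.+1 + (j - i) = j.+1 by lia.
  by rewrite ifT //; lia.
- rewrite lval_shift_up ?leq_subr // subKn //= mul1n; apply: eq_bigr => v _; rewrite IH //.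
  congr ev; apply: (@eq_from_nth _ v).
    by rewrite size_mkseq size_cat /= size_take size_drop size_mkseq; case: ltnP; lia.
  rewrite size_mkseq => j jn; rewrite nth_mkseq // nth_cat size_take size_mkseq /put.
  have -> : (if i < n then i else n) = i by case: ltnP => //; lia.
  case: (ltngtP j i) => ji.
  + rewrite nth_take // nth_mkseq; last by lia.
    by [].
  + case E: (j - i) => [|d]; first by lia.
    rewrite /= nth_drop nth_mkseq; last by lia.
    rewrite ?ifT; last by lia.
    by congr x; lia.
  + by rewrite ji subnn.
- rewrite /rung_ok /= IH //; congr (nat_of_bool _ * _); rewrite /res_at.
  have -> : drop i (mkseq x n) = [:: x i, x i.+1 & drop i.+2 (mkseq x n)].
    by rewrite (drop_nth (x 0)) ?size_mkseq ?(ltnW i_n) // (drop_nth (x 0)) ?size_mkseq // !nth_mkseq // ltnW.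
  by [].
Qed.

(** * Ladders as systems of constraints *)

Section LadderCount.
Variable s : nat.
Definition ladder_node (o : seq layer) : finType := ('I_s * 'I_(size o).+1)%type.
Let layer0 : layer := (None, (0, None)).

Definition ladder_adj o : rel (ladder_node o) := fun p q =>
  let l := nth layer0 o p.2 in
  [&& p.2 == q.2, p.2 < size o, l.2.2 == Some true, p.1 == l.2.1 :> nat & q.1 == l.2.1.+1 :> nat].
Definition ladder_eq o : rel (ladder_node o) := fun p q =>
  let l := nth layer0 o p.2 in
  (p.2 < size o) &&
  ([&& p.2 == q.2, l.2.2 == Some false, p.1 == l.2.1 :> nat & q.1 == l.2.1.+1 :> nat] ||
   [&& q.2 == p.2.+1 :> nat, p.1 == q.1 & l.1 != Some (nat_of_ord p.1)]).

Lemma ladder_adjE o i t j t' : @ladder_adj o (i, t) (j, t') =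
  [&& t == t', t < size o, (nth layer0 o t).2.2 == Some true, i == (nth layer0 o t).2.1 :> nat &
   j == (nth layer0 o t).2.1.+1 :> nat].
Proof. by []. Qed.

Lemma ladder_eqE o i t j t' : @ladder_eq o (i, t) (j, t') = (t < size o) &&
  ([&& t == t', (nth layer0 o t).2.2 == Some false, i == (nth layer0 o t).2.1 :> nat &
       j == (nth layer0 o t).2.1.+1 :> nat] ||
   [&& t' == t.+1 :> nat, i == j & (nth layer0 o t).1 != Some (nat_of_ord i)]).
Proof. by []. Qed.

Definition in_range (l : layer) : bool :=
  ((l.2.2 == None) || (l.2.1.+1 < s)) && (if l.1 is Some j then j < s else true).

Variables (G : graph) (v0 : vertex G).
Definition state (y : {ffun 'I_s -> vertex G}) : nat -> vertex G :=
  fun j => if insub j is Some i then y i else v0.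

Lemma stateE y (i : 'I_s) : state y i = y i.
Proof. by rewrite /state valK. Qed.

Lemma rung_okE y l : in_range l -> rung_ok l (state y) <->
  forall (i j : 'I_s) r, l.2.2 = Some r -> i = l.2.1 :> nat -> j = l.2.1.+1 :> nat -> related r (y i) (y j).
Proof.
case/andP => rng _; rewrite /rung_ok; case El: (l.2.2) rng => [r|] //= rs; split=> [h i j r' [<-] Ei Ej|h].
  by rewrite -!stateE Ei Ej.
by have := h (Ordinal (ltnW rs)) (Ordinal rs) r erefl erefl erefl; rewrite -!stateE.
Qed.

Let hd n (f : {ffun 'I_s * 'I_n.+1 -> vertex G}) : {ffun 'I_s -> vertex G} := [ffun i => f (i, ord0)].
Let tl n (f : {ffun 'I_s * 'I_n.+2 -> vertex G}) : {ffun 'I_s * 'I_n.+1 -> vertex G} :=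
  [ffun p => f (p.1, lift ord0 p.2)].
Let sat o : pred {ffun 'I_s * 'I_(size o).+1 -> vertex G} := fun f =>
  [forall x, forall y, (@ladder_adj o x y ==> adj (f x) (f y)) && (@ladder_eq o x y ==> (f x == f y))].

Definition agree (l : layer) (y y' : {ffun 'I_s -> vertex G}) : bool :=
  [forall i, (l.1 != Some (nat_of_ord i)) ==> (y i == y' i)].

Let sat_cons l o f : in_range l ->
  sat (o := l :: o) f = [&& rung_ok l (state (hd f)), agree l (hd f) (hd (tl f)) & sat (tl f)].
Proof.
move=> rng; apply/constraintP/and3P => [[h1 h2]|[r0 ag /constraintP[h1 h2]]].
  split.
  - apply/rung_okE => // i j r Er Ei Ej; rewrite !ffunE.
    case: r Er => Er; rewrite /related.
      by apply: h1; rewrite /ladder_adj /= Er Ei Ej !eqxx.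
    by apply/eqP/h2; rewrite /ladder_eq /= Er Ei Ej !eqxx.
  - apply/forallP => i; apply/implyP => li; rewrite !ffunE; apply/eqP/h2.
    by rewrite /ladder_eq /= li ?eqxx ?orbT.
  - apply/constraintP; split=> -[i t] [j t']; rewrite !ffunE /= => h.
      by apply: h1; move: h; rewrite !ladder_adjE !lift0 (inj_eq lift_inj).
    by apply: h2; move: h; rewrite !ladder_eqE !lift0 (inj_eq lift_inj) eqSS.
split=> -[i t] [j t'].
  rewrite ladder_adjE => /and5P[/eqP <-].
  case: (unliftP ord0 t) => [u ->|->]; last first.
    move=> _ /eqP lr /eqP Ei /eqP Ej; have := (rung_okE (hd f) rng).1 r0 i j true lr Ei Ej.
    by rewrite /related !ffunE.
  rewrite !lift0 => us lr Ei Ej; have := h1 (i, u) (j, u); rewrite !ffunE /=; apply.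
  by rewrite ladder_adjE eqxx; apply/and5P; split; [by []|exact: us|exact: lr|exact: Ei|exact: Ej].
rewrite ladder_eqE => /andP[].
case: (unliftP ord0 t) => [u ->|->].
  rewrite !lift0 => us; case: (unliftP ord0 t') => [u' ->|->]; last by rewrite -val_eqE.
  rewrite !lift0 (inj_eq lift_inj) eqSS => h.
  by have := h2 (i, u) (j, u'); rewrite !ffunE /=; apply; rewrite ladder_eqE; apply/andP; split; [exact: us|exact: h].
move=> _ /orP[/and4P[/eqP <- /eqP lr /eqP Ei /eqP Ej]|/and3P[/eqP t1 /eqP ij li]].
  have := (rung_okE (hd f) rng).1 r0 i j false lr Ei Ej.
  by rewrite /related !ffunE => /eqP.
have -> : t' = lift ord0 ord0 by apply: val_inj; exact: t1.
by rewrite -ij; have /implyP/(_ li) := forallP ag i; rewrite !ffunE => /eqP.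
Qed.

(** The first layer is peeled off. Once [hd] is fixed, [tl] is injective, and its values are the
    solutions of the shorter ladder that start in agreement with [y] outside the released column. *)
Lemma lval_count o y : all in_range o -> #|[set f | sat (o := o) f & hd f == y]| = lval o (state y).
Proof.
elim: o y => [|l o IH] y /=.
  move=> _; apply/eqP/cards1P; exists [ffun p => y p.1]; apply/setP => f; rewrite !inE.
  apply/andP/eqP => [[_ /eqP <-]|->].
    by apply/ffunP => -[i t]; rewrite !ffunE /= (ord1 t).
  split; last by apply/eqP/ffunP => i; rewrite !ffunE.
  by apply/constraintP; split=> -[i t] [j t']; rewrite ?ladder_adjE ?ladder_eqE ltn0 ?andbF.
case/andP => rng rngs.
have sum_agree : \sum_(y' | agree l y y') lval o (state y') =
    (if l.1 is Some j then \sum_v lval o (put (state y) j v) else lval o (state y)).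
  case El: (l.1) => [j|]; last first.
    rewrite (big_pred1 y) // => y'; apply/forallP/eqP => [h|-> i]; last by rewrite eqxx implybT.
    by apply/ffunP => i; have := h i; rewrite El /= => /eqP.
  have js : j < s by move: rng; rewrite /in_range El => /andP[].
  pose j' := Ordinal js.
  pose st v : {ffun 'I_s -> vertex G} := [ffun i => if i == j' then v else y i].
  rewrite (reindex_onto st (fun y' => y' j')) /=; last first.
    move=> y' /forallP ag; apply/ffunP => i; rewrite ffunE; case: eqP => [->//|ne].
    have := ag i; rewrite El; case: eqP => [[E]|_ /= /eqP //].
    by case: ne; apply: val_inj.
  apply: eq_big => v.
    rewrite ffunE eqxx eqxx andbT; apply/forallP => i; rewrite El ffunE.
    by case: (eqVneq i j') => [->|_]; rewrite ?eqxx ?implybT.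
  move=> _; congr lval; apply/funext => i; rewrite /put /state.
  case: insubP => [u _ Eu|]; first by rewrite ffunE -Eu -val_eqE.
  by case: eqP => // ->; rewrite js.
have tl_inj : {in [set f : {ffun 'I_s * 'I_(size o).+2 -> vertex G} | hd f == y] &, injective (@tl (size o))}.
  move=> f f'; rewrite !inE => /eqP hf /eqP hf' /ffunP E; apply/ffunP => -[i t].
  case: (unliftP ord0 t) => [u ->|->]; first by have := E (i, u); rewrite !ffunE.
  by rewrite -hf' in hf; move/ffunP/(_ i): hf; rewrite !ffunE.
case ok: (rung_ok l (state y)); last first.
  rewrite mul0n; apply: eq_card0 => f; rewrite inE sat_cons //.
  by apply/negP => /andP[/and3P[h _ _] /eqP E]; rewrite E ok in h.
rewrite mul1n -sum_agree -(card_in_imset (f := @tl (size o))); last first.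
  by move=> f f'; rewrite !inE => /andP[_ h] /andP[_ h']; apply: tl_inj; rewrite inE.
transitivity #|[set f : {ffun 'I_s * 'I_(size o).+1 -> vertex G} | sat (o := o) f & agree l y (hd f)]|.
  apply: eq_card => f; rewrite [RHS]inE; apply/imsetP/andP => [[g]|[sf ag]].
    by rewrite inE sat_cons // => /andP[/and3P[_ h1 h2] /eqP E] ->; rewrite -E.
  pose g : {ffun 'I_s * 'I_(size o).+2 -> vertex G} :=
    [ffun p => if unlift ord0 p.2 is Some u then f (p.1, u) else y p.1].
  have tg : tl g = f by apply/ffunP => -[i t]; rewrite !ffunE /= liftK.
  have hg : hd g = y by apply/ffunP => i; rewrite !ffunE /= unlift_none.
  by exists g; rewrite // inE sat_cons // hg tg ok ag sf eqxx.
rewrite -sum1_card (partition_big (@hd (size o)) (agree l y)) /=; last by move=> f; rewrite inE => /andP[].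
apply: eq_bigr => y' ag; rewrite -IH // -sum1_card; apply: eq_bigl => f; rewrite !inE.
by case: eqP => [->|]; rewrite ?ag ?andbT ?andbF.
Qed.

Lemma ladder_count o : all in_range o ->
  constraint_count (@ladder_adj o) (@ladder_eq o) G = \sum_(y : {ffun 'I_s -> vertex G}) lval o (state y).
Proof.
move=> rng; rewrite /constraint_count -sum1_card (partition_big (@hd (size o)) xpredT) //=.
by apply: eq_bigr => y _; rewrite -lval_count // -sum1_card; apply: eq_bigl => f; rewrite !inE.
Qed.
End LadderCount.

Lemma shift_up_range s n d o : n < s -> d <= n -> all (in_range s) (shift_up n d o) = all (in_range s) o.
Proof.
move=> ns; elim: d o => //= d IH o dn; rewrite IH ?(ltnW dn) //= /in_range /=.
have -> : (n - d.+1).+1 = n - d by rewrite subnS prednK // subn_gt0.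
by rewrite (leq_ltn_trans (leq_subr _ _) ns).
Qed.

Lemma shift_down_range s i d o : i + d < s -> all (in_range s) (shift_down i d o) = all (in_range s) o.
Proof.
elim: d o => //= d IH o; rewrite addnS => ds; rewrite IH ?(ltnW ds) //= /in_range /=.
by rewrite ds (ltnW ds).
Qed.

Lemma layers_range s w n : wf w n -> width w n < s -> all (in_range s) (layers w n).
Proof.
elim: w n => //= -[i|i|i r] w IH n /andP[i_n wfw]; rewrite gtn_max => /andP[ns ws].
- by rewrite shift_down_range ?IH //; lia.
- rewrite shift_up_range ?leq_subr //= IH // andbT /in_range /=.
  exact: leq_ltn_trans ns.
- by rewrite /= IH // andbT /in_range /= andbT (ltn_trans i_n).
Qed.

Lemma dec_mono (V : finType) (e : rel V) k k' U S : k <= k' -> dec e k U S -> dec e k' U S.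
Proof.
move=> kk; elim=> {U S}.
- by move=> S Sk; apply: dec0; apply: leq_trans kk.
- by move=> U S S' sS Sk cl _ IH; apply: dec_forget IH => //; apply: leq_trans kk.
- by move=> U S v vU Sk _ IH; apply: dec_intro IH => //; apply: leq_trans kk.
- by move=> U1 U2 S d na _ IH1 _ IH2; apply: dec_union.
Qed.

Section PlanarWords.
Variable R : graph -> graph -> Prop.
Hypothesis R_op : forall G H K, simple G -> simple H -> R G H -> R (compl (cross G K)) (compl (cross H K)).
Hypothesis unbounded : forall k, exists F, closed_graph R F /\ ~ dec (@adj F) k setT set0.
Variables (G H : graph).
Hypotheses (sG : simple G) (sH : simple H) (GH : R G H).

(** A word without open wires ignores the initial contents of the columns, so the number of
    solutions is its value times [#|vertex G| ^ s]. This factor is positive and the same for [H]. *)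
Lemma planar_words_equal w : vertex G -> wf w 0 -> ev (G := G) w [::] = ev (G := H) w [::].
Proof.
move=> v0 wfw; pose o := layers w 0; pose s := (width w 0).+1.
have rng : all (in_range s) o by apply: layers_range.
pose layer0 : layer := (None, (0, None)).
have [k lad] := ladder_exists s (size o).+1 (fun t => (nth layer0 o t).2.1).
have [F [cF ndec]] := unbounded k.
have [Br [B1 B2 B3 B4]] := lad _ _ (@adj_sym F) ndec.
pose X := ladder_node s o; pose Br' (p : X) := Br p.1 p.2.
have x0 : X by exact: (ord0, ord0).
have eq_count : constraint_count (@ladder_adj s o) (@ladder_eq s o) G =
                constraint_count (@ladder_adj s o) (@ladder_eq s o) H.
  apply: (closed_model R_op sG sH GH (F := F) (Br := Br') x0 cF).
  - by move=> p; have [] := B1 p.1 p.2 (ltn_ord _) (ltn_ord _).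
  - by move=> p; have [] := B1 p.1 p.2 (ltn_ord _) (ltn_ord _).
  - move=> [i t] [j t'] v v1 v2; have [] := B2 i t j t' v; rewrite ?ltn_ord //.
    by move=> /ord_inj -> /ord_inj ->.
  - move=> [i t] [j t']; rewrite ladder_adjE => /and5P[/eqP <- to _ /eqP Ei /eqP Ej].
    by rewrite /Br' /= Ei Ej; apply: B4; rewrite ?ltn_ord // -/(layer) -Ej.
  - move=> [i t] [j t']; rewrite ladder_eqE => /andP[to /orP[/and4P[/eqP <- _ /eqP Ei /eqP Ej]|/and3P[/eqP t1 /eqP ij _]]].
      by rewrite /Br' /= Ei Ej; apply: B4; rewrite ?ltn_ord // -/(layer) -Ej.
    by rewrite /Br' /= -ij t1; apply: B3; rewrite ?ltn_ord // -t1.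
have [_ ne] := B1 (x0.1) (x0.2) (ltn_ord _) (ltn_ord _); have [x _] := set0Pn _ ne.
have cGH := closed_card R_op sG sH GH cF x.
have cG : 0 < #|vertex G| by apply/card_gt0P; exists v0.
have [w0 _] : exists w0, w0 \in vertex H by apply/card_gt0P; rewrite -cGH.
have E (G' : graph) (v : vertex G') : constraint_count (@ladder_adj s o) (@ladder_eq s o) G' =
    #|vertex G'| ^ s * ev (G := G') w [::].
  rewrite (ladder_count v) // (eq_bigr (fun _ => ev (G := G') w [::])); last first.
    by move=> y _; rewrite lval_layers.
  by rewrite sum_nat_const card_ffun card_ord.
move: eq_count; rewrite (E G v0) (E H w0) -cGH => /eqP.
by rewrite eqn_pmul2l ?expn_gt0 ?cG // => /eqP.
Qed.
End PlanarWords.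

(** * Invariance of the equivalence and closed graphs of unbounded tree-width *)

Section Logic.
Variables (L : Type) (models : graph -> L -> Prop).
Hypotheses (logic : is_logic models) (self_compl : self_complementary models).
Variable Fc : graph -> Prop.
Hypotheses (Fc_simple : forall F, Fc F -> simple F)
  (Fc_equiv : forall G H, simple G -> simple H -> (hom_indist Fc G H <-> L_equiv models G H)).

Lemma compl_compl_iso (G : graph) : simple G -> isomorphic (compl (compl G)) G.
Proof.
move=> sG; exists id; split; first by exists id.
move=> x y; rewrite /= /compl_adj /= /compl_adj; case: eqP => [->|_] /=; first exact/esym/negbTE/sG.
by rewrite negbK.
Qed.

Lemma L_equiv_compl (G H : graph) : simple G -> simple H -> L_equiv models G H ->
  L_equiv models (compl G) (compl H).
Proof.
move=> sG sH GH phi; have [psi psiP] := self_compl phi.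
have h G' : simple G' -> models (compl G') phi <-> models G' psi.
  move=> sG'; rewrite psiP; last exact: simple_compl.
  exact: logic (compl_compl_iso sG') psi.
by rewrite !h.
Qed.

(** Counts into a product are products of counts, so indistinguishability over [Fc] passes to the
    product with any [K], even with loops, since the product with a simple graph is simple.
    Complementation is then covered by [L_equiv_compl]. *)
Lemma L_equiv_op (G H K : graph) : simple G -> simple H -> L_equiv models G H ->
  L_equiv models (compl (cross G K)) (compl (cross H K)).
Proof.
move=> sG sH GH; apply: L_equiv_compl; rewrite -?Fc_equiv; try exact: simple_cross.
by move=> F FF; rewrite !hom_cross; congr (_ * _); apply: (proj2 (Fc_equiv sG sH) GH).
Qed.

(** A member of [Fc] that distinguishes two [k.+1]-variable equivalent graphs is closed and has no
    decomposition with bags of size [k]. The index [k.+1] provides a variable even when [k] is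
    zero. *)
Lemma closed_unbounded : (forall k : nat, exists G H : graph,
      [/\ simple G, simple H, Ck_equiv k G H & ~ L_equiv models G H]) ->
  forall k, exists F, closed_graph (L_equiv models) F /\ ~ dec (@adj F) k setT set0.
Proof.
move=> ex k; have [G [H [sG sH CGH nGH]]] := ex k.+1.
have cGH := Ck_equiv_card (ltn0Sn k) CGH.
have nh : ~ hom_indist Fc G H by rewrite Fc_equiv.
have [F /not_implyP[FF nF]] : exists F, ~ (Fc F -> Defs.hom F G = Defs.hom F H).
  by apply: contrapT => no; apply: nh => F; apply: contrapT => nF; apply: no; exists F.
exists F; split.
  by split; [exact: Fc_simple|move=> G' H' sG' sH' /(Fc_equiv sG' sH').2; apply].
move=> dF; apply: nF.
(* Two empty graphs are isomorphic, hence equivalent in the logic, so this case cannot arise. *)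
case: (pickP (mem (vertex G))) => [v _|G0]; last first.
  case: nGH => phi; apply: logic.
  have H0 (x : vertex H) : False.
    have : 0 < #|vertex H| by apply/card_gt0P; exists x.
    by rewrite -cGH => /card_gt0P[y]; have := G0 y; rewrite /= => ->.
  have G0' (x : vertex G) : False by have := G0 x; rewrite inE.
  exists (fun x => False_rect _ (G0' x)); split; last by move=> x; case: (G0' x).
  by exists (fun x => False_rect _ (H0 x)) => x; [case: (G0' x)|case: (H0 x)].
have [v' _] : exists v', v' \in vertex H.
  by apply/card_gt0P; rewrite -cGH; apply/card_gt0P; exists v.
exact: (Ck_equiv_hom (ltn0Sn k) CGH (dec_mono (leqnSn k) dF) v v').
Qed.
End Logic.

Import Order.TTheory GRing.Theory Num.Theory.

(** * Sums over sequences and the planar operations on words *)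

Section TupleSums.
Local Open Scope ring_scope.
Variables (K : comNzRingType) (V : finType).
Implicit Types (f g : seq V -> K).

(** Plain sequences rather than tuples: the operations change the number of wires, and no value has
    to be transported along an equation between lengths. *)
Fixpoint sumT n f : K := if n is n'.+1 then \sum_v sumT n' (fun x => f (v :: x)) else f [::].

Lemma eq_sumT n f g : (forall x, size x = n -> f x = g x) -> sumT n f = sumT n g.
Proof.
elim: n f g => [|n IH] f g fg /=; first exact: fg.
by apply: eq_bigr => v _; apply: IH => x xn; apply: fg; rewrite /= xn.
Qed.

Lemma sumT_lin n a f g : sumT n (fun x => a * f x + g x) = a * sumT n f + sumT n g.
Proof.
elim: n f g => [//|n IH] f g /=.
by rewrite mulr_sumr -big_split /=; apply: eq_bigr => v _; rewrite IH.
Qed.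

Lemma sumT0 n : sumT n (fun _ => 0) = 0.
Proof. by elim: n => //= n IH; rewrite big1. Qed.

Lemma sumTZ n a f : sumT n (fun x => a * f x) = a * sumT n f.
Proof.
rewrite -[RHS]addr0 -(sumT0 n) -sumT_lin; apply: eq_sumT => x _; by rewrite addr0.
Qed.

Lemma sumT_sum (I : Type) (r : seq I) (P : pred I) n (F : I -> seq V -> K) :
  sumT n (fun x => \sum_(i <- r | P i) F i x) = \sum_(i <- r | P i) sumT n (F i).
Proof.
elim: n F => [//|n IH] F /=; rewrite exchange_big /=; apply: eq_bigr => v _; exact: IH.
Qed.

Lemma sumT_cat n m f : sumT (n + m) f = sumT n (fun x => sumT m (fun y => f (x ++ y))).
Proof. by elim: n f => //= n IH f; apply: eq_bigr => v _; rewrite IH. Qed.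

Lemma sumT_exchange n m (f : seq V -> seq V -> K) :
  sumT n (fun x => sumT m (f x)) = sumT m (fun y => sumT n (fun x => f x y)).
Proof. by elim: n f => //= n IH f; under eq_bigr do rewrite IH; rewrite -sumT_sum. Qed.

Lemma sumT_insert n i f : (i <= n)%N -> sumT n.+1 f = \sum_v sumT n (fun x => f (insert i v x)).
Proof.
elim: i n f => [|i IH] n f.
  by move=> _; apply: eq_bigr => v _; apply: eq_sumT => x _; rewrite /insert take0 drop0.
case: n => // n i_n; rewrite [LHS]/=.
under eq_bigr => u _ do rewrite -/(sumT n.+1 (fun x => f (u :: x))) (IH n) //.
by rewrite exchange_big.
Qed.

Lemma sumT_rcons n f : sumT n.+1 f = \sum_v sumT n (fun x => f (rcons x v)).
Proof.
rewrite (@sumT_insert n n) //; apply: eq_bigr => v _; apply: eq_sumT => x xn.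
by rewrite /insert -xn take_size drop_size cats1.
Qed.

Lemma sumT_rev n f : sumT n (fun x => f (rev x)) = sumT n f.
Proof.
elim: n f => // n IH f; rewrite sumT_rcons /=; apply: eq_bigr => v _.
by rewrite -[RHS]IH; apply: eq_sumT => x _; rewrite rev_rcons.
Qed.

Lemma sumT_delta n x f : size x = n -> sumT n (fun y => (x == y)%:R * f y) = f x.
Proof.
elim: n x f => [|n IH] [|u x] f //= => [_|[xn]]; first by rewrite mul1r.
rewrite (bigD1 u) //= big1 => [|v vu].
  by rewrite addr0 -(IH x (fun y => f (u :: y))) //; apply: eq_sumT => y _; rewrite eqseq_cons eqxx.
rewrite -[RHS](sumT0 n); apply: eq_sumT => y _.
by rewrite eqseq_cons eq_sym (negbTE vu) mul0r.
Qed.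

Lemma sumT_tuple n f : sumT n f = \sum_(x : n.-tuple V) f x.
Proof.
elim: n f => [|n IH] f /=.
  rewrite (eq_bigr (fun=> f [::])) => [|x _]; last by rewrite tuple0.
  by rewrite sumr_const card_tuple expn0.
rewrite (reindex (fun p : V * n.-tuple V => [tuple of p.1 :: p.2])) /=; last first.
  exists (fun x => (thead x, [tuple of behead x])) => [[v x] _|x _].
    by congr (_, _); apply: val_inj.
  by rewrite -tuple_eta.
rewrite -(pair_bigA _ (fun v (x : n.-tuple V) => f (v :: x))) /=.
by apply: eq_bigr => v _; rewrite IH.
Qed.
End TupleSums.

Section WordOperations.
Local Open Scope ring_scope.
Variables (K : comNzRingType).

Definition evR (G : graph) w (x : seq (vertex G)) : K := (ev w x)%:R.

Lemma evR_Sum (G : graph) i w (x : seq (vertex G)) : evR (Sum i :: w) x = \sum_v evR w (insert i v x).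
Proof. by rewrite /evR /= natr_sum. Qed.
Lemma evR_Res (G : graph) i r w (x : seq (vertex G)) : evR (Res i r :: w) x = (res_at i r x)%:R * evR w x.
Proof. by rewrite /evR /= natrM. Qed.

Lemma size_insert (T : Type) i (v : T) x : size (insert i v x) = (size x).+1.
Proof. by rewrite /insert size_cat /= addnS -size_cat cat_take_drop. Qed.
Lemma size_delete (T : Type) i (x : seq T) : (i < size x)%N -> size (delete i x) = (size x).-1.
Proof. by move=> ix; rewrite /delete size_cat size_drop size_take ix; lia. Qed.
Lemma delete_insert (T : Type) i (v : T) x : (i <= size x)%N -> delete i (insert i v x) = x.
Proof.
move=> ix; rewrite /delete /insert take_size_cat ?size_takel // drop_cat size_takel //.
by rewrite ltnNge leqnSn /= subSn // subnn /= drop0 cat_take_drop.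
Qed.

Lemma related_sym (G : graph) r : symmetric (@related G r).
Proof. by case: r => u v; [exact: adj_sym | exact: eq_sym]. Qed.

Definition shift_op d (o : op) : op :=
  match o with Ins i => Ins (d + i) | Sum i => Sum (d + i) | Res i r => Res (d + i) r end.
Definition tensor n w w' := map (shift_op n) w' ++ w.

Lemma wf_tensor n m w w' : wf w n -> wf w' m -> wf (tensor n w w') (n + m).
Proof.
rewrite /tensor => wfw; elim: w' m => [m /eqP ->|[i|i|i r] w' IH m /=].
- by rewrite addn0.
- case/andP => im /IH h; rewrite ltn_add2l im /=.
  by case: m im h => // m _; rewrite addnS.
- by case/andP => im /IH h; rewrite leq_add2l im -addnS.
- by case/andP => im /IH ->; rewrite -addnS ltn_add2l im.
Qed.

Lemma evR_tensor (G : graph) n m w w' (x y : seq (vertex G)) : size x = n -> size y = m ->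
  wf w' m -> evR (tensor n w w') (x ++ y) = evR w x * evR w' y.
Proof.
move=> xn; rewrite /tensor; elim: w' m y => [m y ym wf'|[i|i|i r] w' IH m y ym /= /andP[im wf']].
- by move: ym; rewrite (eqP wf') => /size0nil ->; rewrite cats0 /evR mulr1.
- rewrite -[LHS]/(evR _ (delete (n + i) (x ++ y))) -[evR (Ins i :: w') y]/(evR w' (delete i y)).
  rewrite /delete take_cat drop_cat xn ltnNge leq_addr /= addKn ltnNge -addnS leq_addr /= addKn -catA.
  by rewrite (IH m.-1) // -/(delete i y) size_delete ym.
- rewrite !evR_Sum mulr_sumr; apply: eq_bigr => v _.
  rewrite /insert take_cat drop_cat xn ltnNge leq_addr /= addKn -catA.
  by rewrite (IH m.+1) // -/(insert i v y) size_insert ym.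
- rewrite !evR_Res (IH m) // mulrCA /res_at drop_cat xn ltnNge leq_addr /= addKn.
  by [].
Qed.

(** Reflection reverses the order of the wires. For a tensor on [n.*2] wires, read as a matrix with
    entries at [rev x ++ y], this is transposition. *)
Fixpoint mirror w n : seq op :=
  match w with
  | [::] => [::]
  | Ins i :: w' => Ins (n.-1 - i) :: mirror w' n.-1
  | Sum i :: w' => Sum (n - i) :: mirror w' n.+1
  | Res i r :: w' => Res (n.-2 - i) r :: mirror w' n
  end.

Lemma wf_mirror w n : wf w n -> wf (mirror w n) n.
Proof.
elim: w n => //= -[i|i|i r] w IH n /= /andP[i_n /IH ->]; rewrite andbT; move: i_n; clear; lia.
Qed.

Lemma evR_mirror (G : graph) w n (x : seq (vertex G)) : size x = n -> wf w n ->
  evR (mirror w n) x = evR w (rev x).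
Proof.
elim: w n x => [//|[i|i|i r] w IH n x xn /= /andP[i_n wfw]].
- rewrite -[LHS]/(evR _ (delete (n.-1 - i) x)) -[RHS]/(evR w (delete i (rev x))) IH //; last first.
    by rewrite size_delete xn //; move: i_n; clear; lia.
  congr evR; rewrite /delete rev_cat take_rev drop_rev xn; congr (rev (drop _ _) ++ rev (take _ _)).
    by move: i_n; clear; lia.
  by move: i_n; clear; lia.
- rewrite !evR_Sum; apply: eq_bigr => v _; rewrite IH ?size_insert ?xn //.
  congr evR; rewrite /insert rev_cat rev_cons cat_rcons take_rev drop_rev xn.
  by congr (rev (drop _ _) ++ v :: rev (take _ _)); move: i_n; clear; lia.
- rewrite !evR_Res IH //; congr (_%:R * _); rewrite /res_at drop_rev xn.
  have E : (n - i = (n.-2 - i).+2)%N by move: i_n; clear; lia.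
  rewrite E; set j := (n.-2 - i)%N in E *.
  have jn : (j.+1 < size x)%N by rewrite xn; move: i_n E; clear; lia.
  case: x xn jn => // x0 x xn jn.
  rewrite (drop_nth x0 (ltnW jn)) (drop_nth x0 jn) (take_nth x0 jn) (take_nth x0 (ltnW jn)) !rev_rcons.
  by rewrite related_sym.
Qed.

Definition contract p w := [:: Sum p, Sum p, Res p false & w].

Lemma insert_size_cat (T : Type) p (v : T) l r : size l = p -> insert p v (l ++ r) = l ++ v :: r.
Proof. by move=> lp; rewrite /insert take_size_cat // drop_size_cat. Qed.

Lemma evR_contract (G : graph) p w (l r : seq (vertex G)) : size l = p ->
  evR (contract p w) (l ++ r) = \sum_v evR w (l ++ v :: v :: r).
Proof.
move=> lp; rewrite /contract evR_Sum; apply: eq_bigr => v _.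
rewrite evR_Sum (bigD1 v) //= big1 ?addr0 => [|u uv].
  by rewrite evR_Res !insert_size_cat // /res_at drop_size_cat // /= eqxx mul1r.
by rewrite evR_Res !insert_size_cat // /res_at drop_size_cat // /= (negbTE uv) mul0r.
Qed.

Fixpoint contract_iter n p w := if n is n'.+1 then contract p (contract_iter n' p.+1 w) else w.

Lemma wf_contract_iter n p q w : wf w (p + n.*2 + q) -> wf (contract_iter n p w) (p + q).
Proof.
elim: n p q => [|n IH] p q; first by rewrite addn0.
move=> h /=; apply/and4P; split; try by lia.
have := IH p.+1 q.+1; rewrite [(p.+1 + q.+1)%N]addnS [(p.+1 + q)%N]addSn; apply.
by move: h; congr (is_true (wf w _)); rewrite doubleS; lia.
Qed.

Lemma evR_contract_iter (G : graph) n p w (l r : seq (vertex G)) : size l = p ->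
  evR (contract_iter n p w) (l ++ r) = sumT n (fun y => evR w (l ++ y ++ rev y ++ r)).
Proof.
elim: n p l r => [//|n IH] p l r lp; rewrite [contract_iter _ _ _]/= evR_contract // [sumT _ _]/=.
apply: eq_bigr => v _; rewrite -cat_rcons IH ?size_rcons ?lp //; apply: eq_sumT => y _.
by rewrite cat_rcons rev_cons cat_rcons.
Qed.

(** Matrix multiplication by nested caps on the middle wires. The caps are planar only because the
    row index is read in reverse, which explains the form [rev x ++ y]. *)
Definition product n w w' := contract_iter n n (tensor n.*2 w w').

Lemma wf_product n w w' : wf w n.*2 -> wf w' n.*2 -> wf (product n w w') n.*2.
Proof.
move=> h h'; rewrite -addnn; apply: wf_contract_iter.
by have := wf_tensor h h'; congr (is_true (wf _ _)); rewrite -!addnn; lia.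
Qed.

Lemma evR_product (G : graph) n w w' (x z : seq (vertex G)) : size x = n -> size z = n -> wf w' n.*2 ->
  evR (product n w w') (rev x ++ z) = sumT n (fun y => evR w (rev x ++ y) * evR w' (rev y ++ z)).
Proof.
move=> xn zn wf'; rewrite /product evR_contract_iter ?size_rev //; apply: eq_sumT => y yn.
by rewrite catA (@evR_tensor G n.*2 n.*2) // size_cat !size_rev -addnn ?xn ?yn ?zn.
Qed.
End WordOperations.

(** * The canonical intertwiner of planar tensors *)

Section OrthonormalBases.
Local Open Scope ring_scope.
Variables (K : rcfType).

Section Functions.
Variable I : finType.
Implicit Types f g : I -> K.

Definition dot f g : K := \sum_x f x * g x.

Lemma dotC f g : dot f g = dot g f.
Proof. by apply: eq_bigr => x _; rewrite mulrC. Qed.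

Lemma dot_lin a f g h : dot (fun x => a * f x + g x) h = a * dot f h + dot g h.
Proof. by rewrite mulr_sumr -big_split; apply: eq_bigr => x _; rewrite /= mulrDl mulrA. Qed.

Lemma dot_ge0 f : 0 <= dot f f.
Proof. by apply: sumr_ge0 => x _; rewrite -expr2 sqr_ge0. Qed.

Lemma dot_eq0 f : dot f f = 0 -> forall x, f x = 0.
Proof.
move=> f0 x; have := psumr_eq0P (fun x _ => sqr_ge0 (f x)) f0 (i := x) isT.
by move/eqP; rewrite sqrf_eq0 => /eqP.
Qed.

Definition orthonormal d (e : 'I_d -> I -> K) := forall i j, dot (e i) (e j) = (i == j)%:R.

Lemma dot_sum d (a : 'I_d -> K) (e : 'I_d -> I -> K) g :
  dot (fun x => \sum_i a i * e i x) g = \sum_i a i * dot (e i) g.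
Proof.
rewrite {1}/dot; under eq_bigr do rewrite mulr_suml.
rewrite exchange_big; apply: eq_bigr => i _; rewrite mulr_sumr.
by apply: eq_bigr => x _; rewrite mulrA.
Qed.

Lemma dot_orthonormal d (a : 'I_d -> K) (e : 'I_d -> I -> K) j : orthonormal e ->
  dot (fun x => \sum_i a i * e i x) (e j) = a j.
Proof.
move=> eON; rewrite dot_sum (bigD1 j) //= big1 ?addr0 => [|i ij]; first by rewrite eON eqxx mulr1.
by rewrite eON (negbTE ij) mulr0.
Qed.

Lemma orthonormal_size d (e : 'I_d -> I -> K) : orthonormal e -> (d <= #|I|)%N.
Proof.
move=> eON; pose M := \matrix_(i < d, j < #|I|) e i (enum_val j).
have E : M *m M^T = 1%:M.
  apply/matrixP => i j; rewrite !mxE -eON /dot (big_enum_val (fun x => e i x * e j x)).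
  by apply: eq_bigr => k _; rewrite !mxE.
have := mxrankM_maxl M M^T; rewrite E mxrank1 => /leq_trans; apply; exact: rank_leq_col.
Qed.

(** Orthonormal systems have at most [#|I|] members, so a largest one exists; if an expansion left a
    nonzero remainder, that could be normalised and added. *)
Lemma orthonormal_basis (P : (I -> K) -> Prop) :
  P (fun=> 0) -> (forall a f g, P f -> P g -> P (fun x => a * f x + g x)) ->
  exists d (e : 'I_d -> I -> K),
    [/\ forall i, P (e i), orthonormal e & forall f, P f -> forall x, f x = \sum_i dot f (e i) * e i x].
Proof.
move=> P0 Plin.
pose Q d := `[< exists e : 'I_d -> I -> K, (forall i, P (e i)) /\ orthonormal e >].
have Q0 : exists d, Q d by exists 0%N; apply/asboolP; exists (fun _ _ => 0); split; case.
have Qb d : Q d -> (d <= #|I|)%N by case/asboolP => e [_ /orthonormal_size].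
case: (ex_maxnP Q0 Qb) => d /asboolP[e [eP eON]] dmax; exists d, e; split=> // f Pf.
have Psum (s : seq 'I_d) : P (fun x => \sum_(i <- s) dot f (e i) * e i x).
  elim: s => [|i s IH].
    by rewrite (_ : (fun _ => _) = fun=> 0) //; apply/funext => x; rewrite big_nil.
  rewrite (_ : (fun _ => _) = fun x => dot f (e i) * e i x + \sum_(i <- s) dot f (e i) * e i x).
    exact: Plin.
  by apply/funext => x; rewrite big_cons.
pose r x := -1 * (\sum_i dot f (e i) * e i x) + f x.
have Pr : P r by apply: Plin.
have re j : dot r (e j) = 0.
  rewrite dot_lin dot_orthonormal //.
  by rewrite mulN1r addNr.
case: (eqVneq (dot r r) 0) => [/dot_eq0 r0 x|rr].
  by have := r0 x; rewrite /r mulN1r => /eqP; rewrite addrC subr_eq0 => /eqP.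
pose c := (Num.sqrt (dot r r))^-1.
have crr : c * (c * dot r r) = 1.
  rewrite mulrA -expr2 exprVn sqr_sqrtr ?dot_ge0 // mulVf //.
pose n x := c * r x + 0.
have Pn : P n by apply: Plin.
have nr g : dot n g = c * dot r g.
  by rewrite dot_lin /dot [X in _ + X]big1 ?addr0 // => x _; rewrite mul0r.
have : Q d.+1.
  apply/asboolP; exists (fun i => if unlift ord0 i is Some j then e j else n).
  split=> [i|i j]; first by case: (unlift ord0 i).
  case: (unliftP ord0 i) => [i' ->|->]; case: (unliftP ord0 j) => [j' ->|->].
  - by rewrite eON (inj_eq lift_inj).
  - by rewrite dotC nr re mulr0 eq_sym (negbTE (neq_lift _ _)).
  - by rewrite nr re mulr0 (negbTE (neq_lift _ _)).
  - by rewrite nr dotC nr crr eqxx.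
by move/dmax; rewrite ltnn.
Qed.
End Functions.

Lemma trace_sqr_ge0 p q (A : 'M[K]_(p, q)) : 0 <= \tr (A^T *m A).
Proof. by apply: sumr_ge0 => i _; rewrite mxE sumr_ge0 // => j _; rewrite mxE -expr2 sqr_ge0. Qed.

(** [f] is the orthogonal projection of [c] onto the space of intertwiners for the trace form. *)
Lemma intertwiner_projection p q (P : 'M[K]_p -> 'M[K]_q -> Prop) (c : 'M[K]_(p, q)) :
  exists f, (forall a b, P a b -> a *m f = f *m b) /\
    forall g : 'M_(p, q), (forall a b, P a b -> a *m g = g *m b) -> \tr ((c - f)^T *m g) = 0.
Proof.
pose M (f : 'I_p * 'I_q -> K) := \matrix_(i, j) f (i, j).
pose Fix f := forall a b, P a b -> a *m M f = M f *m b.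
have Mlin a f g : M (fun x => a * f x + g x) = a *: M f + M g by apply/matrixP => i j; rewrite !mxE.
have [||d [e [eF eON eB]]] := @orthonormal_basis _ Fix.
- by move=> a b _; have -> : M (fun=> 0) = 0 by [apply/matrixP => i j; rewrite !mxE]; rewrite mulmx0 mul0mx.
- move=> x f g Ff Fg a b ab; rewrite Mlin mulmxDr mulmxDl -scalemxAr -scalemxAl.
  by rewrite (Ff _ _ ab) (Fg _ _ ab).
pose v (g : 'M[K]_(p, q)) (x : 'I_p * 'I_q) : K := g x.1 x.2.
have vM g : M (v g) = g by apply/matrixP => i j; rewrite mxE.
pose f := \sum_i dot (v c) (e i) *: M (e i).
have trdot (g h : 'M_(p, q)) : \tr (g^T *m h) = dot (v g) (v h).
  rewrite /mxtrace /dot -(pair_bigA _ (fun i j => v g (i, j) * v h (i, j))) exchange_big.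
  by apply: eq_bigr => i _; rewrite mxE; apply: eq_bigr => j _; rewrite mxE.
exists f; split=> [a b ab|g Fg].
  rewrite mulmx_sumr mulmx_suml; apply: eq_bigr => i _.
  by rewrite -scalemxAr -scalemxAl (eF i _ _ ab).
have Fvg : Fix (v g) by move=> a b /Fg; rewrite vM.
have fe j : dot (v f) (e j) = dot (v c) (e j).
  have -> : v f = fun x => \sum_i dot (v c) (e i) * e i x.
    by apply/funext => -[x y]; rewrite /v /= summxE; apply: eq_bigr => i _; rewrite !mxE.
  exact: dot_orthonormal.
rewrite trdot; have -> : v (c - f) = fun x => -1 * v f x + v c x.
  by apply/funext => x; rewrite /v !mxE mulN1r addrC.
have -> : v g = fun x => \sum_i dot (v g) (e i) * e i x by apply/funext => x; exact: eB.
rewrite dotC dot_sum big1 // => i _.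
by rewrite [dot (e i) _]dotC dot_lin fe mulN1r addNr mulr0.
Qed.

(* The operator c |-> sum_i T_i c S_i^T is self-adjoint with range in the space of intertwiners f, and there
   its quadratic form is the sum of the squares of the T_i^T f, since f S_i^T = T_i^T f. *)
Lemma intertwiner_psd p q d (T : 'I_d -> 'M[K]_p) (S : 'I_d -> 'M[K]_q) (P : 'M[K]_p -> 'M[K]_q -> Prop) :
  (forall a b, P a b -> P a^T b^T) -> (forall i, P (T i) (S i)) ->
  (forall a b (c : 'M_(p, q)), P a b ->
    a *m (\sum_i T i *m c *m (S i)^T) = (\sum_i T i *m c *m (S i)^T) *m b) ->
  (forall c : 'M_(p, q), \sum_i T i *m c *m (S i)^T = \sum_i (T i)^T *m c *m S i) ->
  forall c : 'M_(p, q), 0 <= \tr (c^T *m \sum_i T i *m c *m (S i)^T).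
Proof.
move=> Ptr PTS fixO symO c; set Om := (fun c : 'M_(p, q) => \sum_i T i *m c *m (S i)^T).
rewrite -[\sum_i _]/(Om c); have [f [Ff pF]] := intertwiner_projection P c.
have decomp g : (forall a b, P a b -> a *m g = g *m b) -> \tr (c^T *m g) = \tr (f^T *m g).
  by move=> /pF; rewrite linearB /= mulmxBl linearB /= => /eqP; rewrite subr_eq0 => /eqP.
have selfadj (g h : 'M_(p, q)) : \tr (g^T *m Om h) = \tr (h^T *m Om g).
  rewrite -[RHS]mxtrace_tr trmx_mul trmxK.
  have -> : Om g = \sum_i (T i)^T *m g *m S i by exact: symO.
  rewrite /Om [X in (X *m h)]linear_sum mulmx_sumr mulmx_suml !linear_sum.
  apply: eq_bigr => i _; rewrite /= !trmx_mul trmxK !mulmxA [LHS]mxtrace_mulC.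
  by rewrite !mulmxA.
rewrite decomp => [|a b]; last exact: fixO.
rewrite selfadj decomp => [|a b]; last exact: fixO.
rewrite /Om mulmx_sumr linear_sum sumr_ge0 // => i _.
have -> : T i *m f *m (S i)^T = T i *m ((T i)^T *m f) by rewrite (Ff _ _ (Ptr _ _ (PTS i))) mulmxA.
have := trace_sqr_ge0 ((T i)^T *m f); by rewrite trmx_mul trmxK !mulmxA.
Qed.
End OrthonormalBases.

Section PlanarSpan.
Local Open Scope ring_scope.
Variables (K : rcfType) (G H : graph).

(** Both components come from the same words with the same coefficients. That this relation between
    tensors is an isometry is a consequence of the equality of closed words. [span_ext] disregards
    sequences of the wrong length. *)
Inductive span n : (seq (vertex G) -> K) -> (seq (vertex H) -> K) -> Prop :=
| span_word w : wf w n -> span n (@evR K G w) (@evR K H w)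
| span0 : span n (fun=> 0) (fun=> 0)
| span_lin a T S T' S' : span n T S -> span n T' S' ->
    span n (fun x => a * T x + T' x) (fun x => a * S x + S' x)
| span_ext T S T' S' : span n T S -> (forall x, size x = n -> T x = T' x) ->
    (forall x, size x = n -> S x = S' x) -> span n T' S'.

Definition linear_op (V : finType) n m (A : (seq V -> K) -> (seq V -> K)) :=
  (forall T T', (forall x, size x = n -> T x = T' x) -> forall x, size x = m -> A T x = A T' x) /\
  (forall a T T' x, size x = m -> A (fun z => a * T z + T' z) x = a * A T x + A T' x).

Lemma linear_op0 (V : finType) n m (A : (seq V -> K) -> (seq V -> K)) x :
  linear_op n m A -> size x = m -> A (fun=> 0) x = 0.
Proof.
case=> [ext lin] xm; rewrite (ext _ (fun z => -1 * 0 + 0)) => [|z _|//].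
  by rewrite (lin (-1) (fun=> 0) (fun=> 0)) // mulN1r addNr.
by rewrite mulr0 addr0.
Qed.

Lemma span_map n m A B : linear_op n m A -> linear_op n m B ->
  (forall w, wf w n -> span m (A (@evR K G w)) (B (@evR K H w))) ->
  forall T S, span n T S -> span m (A T) (B S).
Proof.
move=> linA linB AB T S; elim=> [w /AB //||a {}T {}S T' S' _ h _ h'|{}T {}S T' S' _ h TT' SS'].
- by apply: span_ext (span0 m) _ _ => x xm; [rewrite (linear_op0 linA)|rewrite (linear_op0 linB)].
- by apply: span_ext (span_lin a h h') _ _ => x xm; [rewrite linA.2|rewrite linB.2].
- by apply: span_ext h _ _ => x xm; [apply: linA.1|apply: linB.1].
Qed.

Definition op_ins (V : finType) i (T : seq V -> K) x := T (delete i x).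
Definition op_sum (V : finType) i (T : seq V -> K) x := \sum_v T (insert i v x).
Definition op_res (F : graph) i r (T : seq (vertex F) -> K) x := (res_at i r x)%:R * T x.
Definition op_mul (V : finType) n (a T : seq V -> K) x :=
  sumT n (fun y => a (take n x ++ y) * T (rev y ++ drop n x)).

Lemma linear_ins (V : finType) n i : (i <= n)%N -> linear_op n n.+1 (@op_ins V i).
Proof.
by move=> i_n; split=> // T T' TT' x xn; apply: TT'; rewrite size_delete xn.
Qed.

Lemma linear_sum (V : finType) n i : (i <= n)%N -> linear_op n.+1 n (@op_sum V i).
Proof.
move=> i_n; split=> [T T' TT' x xn|a T T' x _].
  by apply: eq_bigr => v _; apply: TT'; rewrite size_insert xn.
by rewrite /op_sum mulr_sumr -big_split.
Qed.

Lemma linear_res (F : graph) n i r : linear_op n n (@op_res F i r).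
Proof.
split=> [T T' TT' x xn|a T T' x _]; first by rewrite /op_res TT'.
by rewrite /op_res mulrDr mulrCA.
Qed.

Lemma linear_rev (V : finType) n : linear_op n n (fun (T : seq V -> K) x => T (rev x)).
Proof. by split=> // T T' TT' x xn; rewrite TT' // size_rev. Qed.

Lemma linear_mul_l (V : finType) n (T : seq V -> K) : linear_op n.*2 n.*2 (fun a => op_mul n a T).
Proof.
split=> [a a' aa' x xn|c a a' x xn].
  apply: eq_sumT => y yn; rewrite aa' // size_cat yn size_takel ?xn -addnn ?leq_addr //.
by rewrite /op_mul -sumT_lin; apply: eq_sumT => y _; rewrite mulrDl mulrA.
Qed.

Lemma linear_mul_r (V : finType) n (a : seq V -> K) : linear_op n.*2 n.*2 (op_mul n a).
Proof.
split=> [T T' TT' x xn|c T T' x xn].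
  by apply: eq_sumT => y yn; rewrite TT' // size_cat size_rev yn size_drop xn -addnn addnK.
by rewrite /op_mul -sumT_lin; apply: eq_sumT => y _; rewrite mulrDr mulrCA.
Qed.

Lemma span_ins n i T S : (i <= n)%N -> span n T S -> span n.+1 (op_ins i T) (op_ins i S).
Proof.
move=> i_n; apply: span_map; [exact: linear_ins|exact: linear_ins|] => w wfw.
by apply: (@span_word n.+1 (Ins i :: w)); rewrite /= ltnS i_n.
Qed.

Lemma span_sum n i T S : (i <= n)%N -> span n.+1 T S -> span n (op_sum i T) (op_sum i S).
Proof.
move=> i_n; apply: span_map; [exact: linear_sum|exact: linear_sum|] => w wfw.
apply: (@span_ext n _ _ _ _ (@span_word n (Sum i :: w) _)) => [|x _|x _]; first by rewrite /= i_n.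
all: exact: evR_Sum.
Qed.

Lemma span_res n i r T S : (i.+1 < n)%N -> span n T S -> span n (op_res i r T) (op_res i r S).
Proof.
move=> i_n; apply: span_map; [exact: linear_res|exact: linear_res|] => w wfw.
apply: (@span_ext n _ _ _ _ (@span_word n (Res i r :: w) _)) => [|x _|x _]; first by rewrite /= i_n.
all: exact: evR_Res.
Qed.

Lemma span_rev n T S : span n T S -> span n (fun x => T (rev x)) (fun x => S (rev x)).
Proof.
move: T S; apply: (span_map (linear_rev (vertex G) n) (linear_rev (vertex H) n)) => w wfw.
apply: (@span_ext n _ _ _ _ (span_word (wf_mirror wfw))) => x xn; exact: evR_mirror.
Qed.

Lemma span_mul n a b T S : span n.*2 a b -> span n.*2 T S -> span n.*2 (op_mul n a T) (op_mul n b S).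
Proof.
move=> ab TS; move: a b ab; apply: (span_map (linear_mul_l n T) (linear_mul_l n S)) => w wfw.
move: T S TS; apply: (span_map (linear_mul_r n _) (linear_mul_r n _)) => w' wfw'.
apply: (@span_ext n.*2 _ _ _ _ (span_word (wf_product wfw wfw'))) => x xn.
all: have xn' : size (take n x) = n by rewrite size_takel // xn -addnn leq_addr.
all: have xn'' : size (drop n x) = n by rewrite size_drop xn -addnn addnK.
all: rewrite -{1}(cat_take_drop n x) -{1}(revK (take n x)) evR_product ?size_rev //.
all: by rewrite revK.
Qed.

Hypothesis closed_eq : forall w, wf w 0 -> ev (G := G) w [::] = ev (G := H) w [::].

Definition ip (V : finType) n (T T' : seq V -> K) := sumT n (fun x => T x * T' x).

Lemma ipC (V : finType) n (T T' : seq V -> K) : ip n T T' = ip n T' T.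
Proof. by apply: eq_sumT => x _; rewrite mulrC. Qed.

Lemma ip_lin (V : finType) n a (T T' U : seq V -> K) :
  ip n (fun x => a * T x + T' x) U = a * ip n T U + ip n T' U.
Proof. by rewrite /ip -sumT_lin; apply: eq_sumT => x _; rewrite mulrDl mulrA. Qed.

Lemma ip_sum_ins (V : finType) n i (T U : seq V -> K) : (i <= n)%N ->
  ip n (op_sum i T) U = ip n.+1 T (op_ins i U).
Proof.
move=> i_n; rewrite /ip (sumT_insert _ i_n) -sumT_sum; apply: eq_sumT => x xn.
by rewrite mulr_suml; apply: eq_bigr => v _; rewrite /op_ins delete_insert // xn.
Qed.

Lemma ip_res (F : graph) n i r (T U : seq (vertex F) -> K) : ip n (op_res i r T) U = ip n T (op_res i r U).
Proof. by apply: eq_sumT => x _; rewrite /op_res mulrCA mulrA. Qed.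

Lemma ip_mul (V : finType) n (a T U : seq V -> K) :
  ip n.*2 (op_mul n a T) U = ip n.*2 T (op_mul n (fun x => a (rev x)) U).
Proof.
rewrite /ip -addnn !sumT_cat.
transitivity (sumT n (fun y => sumT n (fun x' => sumT n (fun x => a (x ++ rev y) * T (y ++ x') * U (x ++ x'))))).
  rewrite -[RHS]sumT_rev; under [RHS]eq_sumT => y yn do rewrite revK sumT_exchange.
  rewrite [RHS]sumT_exchange; apply: eq_sumT => x xn; rewrite [RHS]sumT_exchange; apply: eq_sumT => x' xn'.
  rewrite /op_mul take_size_cat // drop_size_cat // mulrC -sumTZ; apply: eq_sumT => y _.
  by rewrite mulrC.
apply: eq_sumT => y yn; apply: eq_sumT => x' xn'.
rewrite /op_mul take_size_cat // drop_size_cat // -sumTZ -[RHS]sumT_rev; apply: eq_sumT => x _.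
by rewrite revK rev_cat revK mulrCA mulrA.
Qed.

Lemma span_ip_closed T S : span 0 T S -> T [::] = S [::].
Proof.
elim=> {T S} [w wfw||a T S T' S' _ h _ h'|T S T' S' _ h <- // <- //]; rewrite ?h ?h' //.
by rewrite /evR closed_eq.
Qed.

(** The operations of the word are moved one by one to the other argument: [Ins i] and [Sum i] are
    adjoint to each other and [Res i r] to itself. A closed tensor remains, and closed tensors
    agree. *)
Lemma span_ip_word w n T S : wf w n -> span n T S -> ip n (evR K w) T = ip n (evR K w) S.
Proof.
elim: w n T S => [n T S|[i|i|i r] w IH n T S].
- move=> /eqP -> /span_ip_closed; rewrite /ip /= => ->; by rewrite /evR.
- case: n => [//|n] /= /andP[i_n wfw] TS.
  rewrite -[LHS]/(ip n.+1 (op_ins i (evR K w)) T) -[RHS]/(ip n.+1 (op_ins i (evR K w)) S).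
  by rewrite ipC -ip_sum_ins // [RHS]ipC -ip_sum_ins // ipC [RHS]ipC; apply/IH/span_sum.
- move=> /= /andP[i_n wfw] TS.
  have E F (U : seq (vertex F) -> K) : ip n (evR K (Sum i :: w)) U = ip n.+1 (evR K w) (op_ins i U).
    by rewrite -ip_sum_ins //; apply: eq_sumT => x _; rewrite evR_Sum.
  by rewrite !E; apply/IH/span_ins.
- move=> /= /andP[i_n wfw] TS.
  have E F (U : seq (vertex F) -> K) : ip n (evR K (Res i r :: w)) U = ip n (evR K w) (op_res i r U).
    by rewrite -ip_res; apply: eq_sumT => x _; rewrite evR_Res.
  by rewrite !E; apply/IH/span_res.
Qed.

Lemma span_ip n T S T' S' : span n T S -> span n T' S' -> ip n T T' = ip n S S'.
Proof.
move=> TS TS'; elim: TS => {T S} [w wfw||a T S U V _ h _ h'|T S U V _ h TU SV].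
- exact: span_ip_word.
- have E (F : finType) (X : seq F -> K) : ip n (fun=> 0) X = 0.
    by rewrite -[RHS](sumT0 K F n); apply: eq_sumT => x _; rewrite mul0r.
  by rewrite !E.
- by rewrite !ip_lin h h'.
- have <- : ip n T T' = ip n U T' by apply: eq_sumT => x xn; rewrite TU.
  by rewrite h; apply: eq_sumT => x xn; rewrite SV.
Qed.

Lemma span_sumr n d (a : 'I_d -> K) T S : (forall i, span n (T i) (S i)) ->
  span n (fun x => \sum_i a i * T i x) (fun x => \sum_i a i * S i x).
Proof.
move=> TS; elim: (index_enum _) => [|i s IH].
  by apply: span_ext (span0 n) _ _ => x _; rewrite big_nil.
by apply: span_ext (span_lin (a i) (TS i) IH) _ _ => x _; rewrite big_cons.
Qed.

Record planar_basis n := PlanarBasis {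
  bdim : nat;
  basG : 'I_bdim -> seq (vertex G) -> K;
  basH : 'I_bdim -> seq (vertex H) -> K;
  bas_span : forall i, span n (basG i) (basH i);
  bas_complete : forall T S, span n T S ->
    (forall x, size x = n -> T x = \sum_i ip n T (basG i) * basG i x) /\
    (forall y, size y = n -> S y = \sum_i ip n S (basH i) * basH i y)
}.

Arguments basG {n} p i x.
Arguments basH {n} p i y.
Arguments bas_span {n} p i.
Arguments bas_complete {n} p {T S}.

Lemma ip_eq0 (V : finType) n (T : seq V -> K) x : ip n T T = 0 -> size x = n -> T x = 0.
Proof.
rewrite /ip sumT_tuple => T0 /eqP xn.
exact: (@dot_eq0 K (n.-tuple V : finType) (fun x => T x) T0 (Tuple xn)).
Qed.

(** A basis is chosen over [G] and lifted to pairs. The second components are complete as well: the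
    remainder of an expansion vanishes over [G], so by the isometry its partner has norm zero. *)
Lemma planar_basis_exists n : exists b : planar_basis n, True.
Proof.
pose P (f : n.-tuple (vertex G) -> K) := exists TS : (seq (vertex G) -> K) * (seq (vertex H) -> K),
  span n TS.1 TS.2 /\ forall x : n.-tuple (vertex G), f x = TS.1 x.
have [||d [e [eP eON eB]]] := @orthonormal_basis K (n.-tuple (vertex G) : finType) P.
- by exists (fun=> 0, fun=> 0); split=> //; exact: span0.
- move=> a f g [[T S] /= [TS fT]] [[T' S'] /= [TS' gT']].
  exists (fun x => a * T x + T' x, fun x => a * S x + S' x); split; first exact: span_lin.
  by move=> x; rewrite fT gT'.
case: (choice eP) => TS TSP; pose T i := (TS i).1; pose S i := (TS i).2.
have sTS i : span n (T i) (S i) by case: (TSP i).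
have completeG X Y : span n X Y -> forall x, size x = n -> X x = \sum_i ip n X (T i) * T i x.
  move=> XY x /eqP xn; have PX : P (fun x => X x) by exists (X, Y).
  rewrite (eB _ PX (Tuple xn)); apply: eq_bigr => i _; rewrite (TSP i).2; congr (_ * _).
  by rewrite /ip sumT_tuple; apply: eq_bigr => z _; rewrite (TSP i).2.
have completeH X Y : span n X Y -> forall y, size y = n -> Y y = \sum_i ip n Y (S i) * S i y.
  move=> XY y yn; have sp := span_lin (-1) (span_sumr (fun i => ip n X (T i)) sTS) XY.
  have := span_ip sp sp; rewrite [LHS](_ : _ = 0); last first.
    rewrite -[RHS](sumT0 K (vertex G) n); apply: eq_sumT => x xn.
    by rewrite -(completeG X Y) // mulN1r addNr mul0r.
  move=> /esym Z; have := @ip_eq0 _ n _ y Z yn.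
  rewrite mulN1r addrC => /eqP; rewrite subr_eq0 => /eqP ->; apply: eq_bigr => i _.
  by rewrite (span_ip XY (sTS i)).
exists (@PlanarBasis n d T S sTS (fun X Y XY => conj (completeG X Y XY) (completeH X Y XY))); by [].
Qed.

Definition basis n : planar_basis n := sval (cid (planar_basis_exists n)).
(** The kernel of the partial isometry that takes the second component of a planar pair to the
    first. *)
Definition W n x y : K := \sum_i basG (basis n) i x * basH (basis n) i y.

(** Applying an operation to the first argument of the kernel amounts to applying its adjoint to the
    second: the matrix coefficients in the bases agree over [G] and [H]. The sum and orthogonality
    relations of a quantum isomorphism are instances of this identity. *)
Lemma W_adjoint n m AG AH BG BH :
  (forall T S, span n T S -> span m (AG T) (AH S)) ->
  (forall T S, span m T S -> span n (BG T) (BH S)) ->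
  (forall U U', ip m (AH U) U' = ip n U (BH U')) ->
  forall x y, size x = m -> size y = n ->
    \sum_i AG (basG (basis n) i) x * basH (basis n) i y =
    \sum_j basG (basis m) j x * BH (basH (basis m) j) y.
Proof.
move=> spA spB adjAB x y xm yn.
transitivity (\sum_i \sum_j ip n (basH (basis n) i) (BH (basH (basis m) j)) *
    basG (basis m) j x * basH (basis n) i y).
  apply: eq_bigr => i _; have sp := spA _ _ (bas_span (basis n) i).
  rewrite ((bas_complete (basis m) sp).1 x xm) mulr_suml; apply: eq_bigr => j _.
  by rewrite (span_ip sp (bas_span _ j)) adjAB.
rewrite exchange_big; apply: eq_bigr => j _; have sp := spB _ _ (bas_span (basis m) j).
rewrite ((bas_complete (basis n) sp).2 y yn) mulr_sumr; apply: eq_bigr => i _.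
by rewrite ipC mulrAC mulrC.
Qed.

Lemma W_sumG n i x y : (i <= n)%N -> size x = n -> size y = n.+1 ->
  \sum_g W n.+1 (insert i g x) y = W n x (delete i y).
Proof.
move=> i_n xn yn; rewrite exchange_big /=; under eq_bigr do rewrite -mulr_suml.
apply: (@W_adjoint n.+1 n (op_sum i) (op_sum i) (op_ins i) (op_ins i)) => // T S.
- exact: span_sum.
- exact: span_ins.
- exact: ip_sum_ins.
Qed.

Lemma W_sumH n i x y : (i <= n)%N -> size x = n.+1 -> size y = n ->
  \sum_h W n.+1 x (insert i h y) = W n (delete i x) y.
Proof.
move=> i_n xn yn; rewrite exchange_big /=; under eq_bigr do rewrite -mulr_sumr.
apply/esym; apply: (@W_adjoint n n.+1 (op_ins i) (op_ins i) (op_sum i) (op_sum i)) => // T S.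
- exact: span_ins.
- exact: span_sum.
- by rewrite ipC -ip_sum_ins // ipC.
Qed.

(** The restriction may be applied to either argument of [W], so [W] vanishes where the two
    indicators differ. *)
Lemma W_res n i r x y : (i.+1 < n)%N -> size x = n -> size y = n ->
  res_at i r x != res_at i r y -> W n x y = 0.
Proof.
move=> i_n xn yn.
have : (res_at i r x)%:R * W n x y = (res_at i r y)%:R * W n x y.
  have := @W_adjoint n n (op_res i r) (op_res i r) (op_res i r) (op_res i r) _ _ _ x y xn yn.
  rewrite /op_res !mulr_sumr => E; under eq_bigr do rewrite mulrA.
  rewrite E; first by apply: eq_bigr => j _; rewrite mulrCA.
  - by move=> T S; exact: span_res.
  - by move=> T S; exact: span_res.
  - by move=> T S; exact: ip_res.
by case: (res_at i r x); case: (res_at i r y) => //=; rewrite mul1r mul0r.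
Qed.

Lemma W_rev n x y : size x = n -> size y = n -> W n (rev x) y = W n x (rev y).
Proof.
pose A (V : finType) (T : seq V -> K) x := T (rev x).
apply: (@W_adjoint n n (@A _) (@A _) (@A _) (@A _)); try exact: span_rev.
by move=> U U'; rewrite /ip -sumT_rev; apply: eq_sumT => z _; rewrite /A revK.
Qed.

Lemma W0 : W 0 [::] [::] = 1.
Proof.
have := (bas_complete (basis 0) (@span_word 0 [::] isT)).2 [::] erefl.
move=> E; transitivity (@evR K H [::] [::]); last by [].
rewrite E; apply: eq_bigr => i _; by rewrite (span_ip_closed (bas_span _ i)) /ip /= [evR _ _ _]/1%:R mul1r.
Qed.

Definition point (V : finType) n (i : 'I_#|{: n.-tuple V}|) : seq V := tval (enum_val i).

Lemma size_point (V : finType) n (i : 'I_#|{: n.-tuple V}|) : size (point i) = n.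
Proof. exact: size_tuple. Qed.

Lemma sumT_point (V : finType) n (f : seq V -> K) : sumT n f = \sum_i f (@point V n i).
Proof. by rewrite sumT_tuple (big_enum_val (fun x : n.-tuple V => f x)). Qed.

Definition mx (V : finType) n (T : seq V -> K) : 'M[K]_#|{: n.-tuple V}| :=
  \matrix_(i, j) T (rev (point i) ++ point j).

Lemma mx_rev (V : finType) n (T : seq V -> K) : mx n (fun x => T (rev x)) = (mx n T)^T.
Proof. by apply/matrixP => i j; rewrite !mxE rev_cat revK. Qed.

Lemma mx_mul (V : finType) n (a T : seq V -> K) : mx n (op_mul n a T) = mx n a *m mx n T.
Proof.
apply/matrixP => i j; rewrite !mxE /op_mul take_size_cat ?drop_size_cat ?size_rev ?size_point //.
by rewrite sumT_point; apply: eq_bigr => k _; rewrite !mxE.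
Qed.

(** The operator depends only on the tensor formed by the pairs of matrices, which lets identities
    for [W] be used as identities of operators. *)
Lemma sum_mulmx_tensor p q d d' (A : 'I_d -> 'M[K]_p) (B : 'I_d -> 'M[K]_q) (A' : 'I_d' -> 'M[K]_p)
    (B' : 'I_d' -> 'M[K]_q) :
  (forall x k y l, \sum_i A i x k * B i y l = \sum_i A' i x k * B' i y l) ->
  forall c, \sum_i A i *m c *m (B i)^T = \sum_i A' i *m c *m (B' i)^T.
Proof.
move=> E c; apply/matrixP => x y.
have expand e (X : 'I_e -> 'M[K]_p) (Y : 'I_e -> 'M[K]_q) :
    (\sum_i X i *m c *m (Y i)^T) x y = \sum_l \sum_k (\sum_i X i x k * Y i y l) * c k l.
  rewrite summxE; under eq_bigr => i _.
    rewrite mxE; under eq_bigr => l _ do rewrite !mxE mulr_suml.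
    over.
  rewrite exchange_big; apply: eq_bigr => l _; rewrite exchange_big; apply: eq_bigr => k _.
  by rewrite mulr_suml; apply: eq_bigr => i _; rewrite mulrAC.
by rewrite !expand; apply: eq_bigr => l _; apply: eq_bigr => k _; rewrite E.
Qed.

(** With half of the wires as row index, [W] is the kernel of [c |-> \sum_i T i *m c *m (S i)^T].
    Its values are intertwiners because multiplication by a planar tensor has multiplication by the
    reversed one as adjoint, and reversal invariance of [W] gives self-adjointness. *)
Lemma W_psd n (c : seq (vertex G) -> seq (vertex H) -> K) :
  0 <= sumT n (fun x => sumT n (fun y => sumT n (fun x' => sumT n (fun y' =>
         c x y * W n.*2 (rev x ++ x') (rev y ++ y') * c x' y')))).
Proof.
pose b := basis n.*2; pose T i := mx n (basG b i); pose S i := mx n (basH b i).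
pose P a a' := exists X Y, [/\ span n.*2 X Y, a = mx n X & a' = mx n Y].
pose C := \matrix_(i < #|{: n.-tuple (vertex G)}|, j < #|{: n.-tuple (vertex H)}|)
  c (point i) (point j).
have sz (V : finType) (i j : 'I_#|{: n.-tuple V}|) : size (rev (point i) ++ point j) = n.*2.
  by rewrite size_cat size_rev !size_point addnn.
have := @intertwiner_psd K _ _ _ T S P _ _ _ _ C; set Q := \tr _ => psd.
have : 0 <= Q.
  apply: psd => {Q} [_ _ [X [Y [XY -> ->]]]|i|_ _ c' [X [Y [XY -> ->]]]|c'].
  - by exists (fun x => X (rev x)), (fun y => Y (rev y)); rewrite !mx_rev; split=> //; exact: span_rev.
  - by exists (basG b i), (basH b i); split=> //; exact: bas_span.
  - rewrite mulmx_sumr mulmx_suml.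
    under eq_bigr do rewrite !mulmxA.
    under [RHS]eq_bigr => i _.
      rewrite -mulmxA -{1}(trmxK (mx n Y)) -trmx_mul.
      over.
    apply: sum_mulmx_tensor => x k y l.
    have := @W_adjoint n.*2 n.*2 (op_mul n X) (op_mul n Y) (op_mul n (fun x => X (rev x)))
      (op_mul n (fun y => Y (rev y))) _ _ _ (rev (point x) ++ point k) (rev (point y) ++ point l).
    rewrite !sz => E; transitivity (\sum_i op_mul n X (basG b i) (rev (point x) ++ point k)
        * basH b i (rev (point y) ++ point l)).
      by apply: eq_bigr => i _; rewrite -mx_mul !mxE.
    rewrite E //; first by apply: eq_bigr => i _; rewrite -mx_rev -mx_mul !mxE.
    + by move=> ? ?; exact: span_mul.
    + by move=> ? ?; apply: span_mul; exact: span_rev.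
    + exact: ip_mul.
  - rewrite (@sum_mulmx_tensor _ _ _ _ T S (fun i => (T i)^T) (fun i => (S i)^T)) => [|x k y l].
      by apply: eq_bigr => i _; rewrite trmxK.
    have := @W_rev n.*2 (rev (point k) ++ point x) (rev (point y) ++ point l) (sz _ _ _) (sz _ _ _).
    rewrite /W !rev_cat !revK => E.
    transitivity (\sum_i basG b i (rev (point x) ++ point k) * basH b i (rev (point y) ++ point l)).
      by apply: eq_bigr => i _; rewrite !mxE.
    by rewrite E; apply: eq_bigr => i _; rewrite !mxE.
move=> {psd}; congr (0 <= _); rewrite {}/Q /mxtrace sumT_point; under eq_bigr do rewrite mxE.
rewrite exchange_big; apply: eq_bigr => x _; rewrite sumT_point; apply: eq_bigr => y _.
rewrite mxE [C x y]mxE.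
under eq_sumT => x' _ do rewrite (eq_sumT (fun _ _ => esym (mulrA _ _ _))) sumTZ.
rewrite sumTZ; congr (_ * _); rewrite summxE sumT_point.
under eq_bigr => i _.
  rewrite mxE; under eq_bigr => l _ do rewrite !mxE mulr_suml.
  over.
rewrite /= exchange_big /=; under eq_bigr do rewrite exchange_big.
rewrite exchange_big /=; apply: eq_bigr => k _; rewrite sumT_point; apply: eq_bigr => l _.
rewrite /W mulr_suml; apply: eq_bigr => i _; by rewrite !mxE mulrAC.
Qed.

Notation pairs := (vertex G * vertex H)%type.
Definition phi (w : seq pairs) : K := W (size w) (unzip1 w) (unzip2 w).

Lemma phi_sumH l r g : \sum_h phi (l ++ (g, h) :: r) = phi (l ++ r).
Proof.
have E := @W_sumH (size (l ++ r)) (size l) (unzip1 l ++ g :: unzip1 r) (unzip2 (l ++ r)).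
have D : unzip1 (l ++ r) = delete (size l) (unzip1 l ++ g :: unzip1 r).
  rewrite -(size_map fst l) -(@insert_size_cat _ (size (unzip1 l)) g (unzip1 l)) // delete_insert ?size_cat ?leq_addr //.
  by rewrite /unzip1 map_cat.
rewrite /phi D.
rewrite -E ?size_map ?size_cat ?leq_addr //=; last by rewrite !size_map addnS.
apply: eq_bigr => h _; rewrite /unzip1 /unzip2 !map_cat !size_cat /= addnS; congr (W _ _ _).
by rewrite insert_size_cat ?size_map.
Qed.

Lemma phi_sumG l r h : \sum_g phi (l ++ (g, h) :: r) = phi (l ++ r).
Proof.
have E := @W_sumG (size (l ++ r)) (size l) (unzip1 (l ++ r)) (unzip2 l ++ h :: unzip2 r).
have D : unzip2 (l ++ r) = delete (size l) (unzip2 l ++ h :: unzip2 r).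
  rewrite -(size_map snd l) -(@insert_size_cat _ (size (unzip2 l)) h (unzip2 l)) // delete_insert ?size_cat ?leq_addr //.
  by rewrite /unzip2 map_cat.
rewrite /phi D.
rewrite -E ?size_map ?size_cat ?leq_addr //=; last by rewrite !size_map addnS.
apply: eq_bigr => g _; rewrite /unzip1 /unzip2 !map_cat !size_cat /= addnS; congr (W _ _ _).
by rewrite insert_size_cat ?size_map.
Qed.

Lemma res_at_cat (F : graph) r (x z : seq (vertex F)) u v : res_at (size x) r (x ++ u :: v :: z) = related r u v.
Proof. by rewrite /res_at drop_size_cat. Qed.

Lemma phi_res0 l r (a a' : pairs) b : related b a.1 a'.1 != related b a.2 a'.2 -> phi (l ++ a :: a' :: r) = 0.
Proof.
move=> aa'; apply: (@W_res _ (size l) b); rewrite ?size_map //; first by rewrite size_cat /= addnS ltnS addnS ltnS leq_addr.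
rewrite /unzip1 /unzip2 !map_cat -{1}(size_map fst) -(size_map snd l) !res_at_cat.
exact: aa'.
Qed.

Lemma phi_orth l r (a a' : pairs) : vrel a.1 a'.1 <> vrel a.2 a'.2 -> phi (l ++ a :: a' :: r) = 0.
Proof.
case: (boolP ((a.1 == a'.1) == (a.2 == a'.2))) => [/eqP E aa'|ne _]; last exact: (@phi_res0 l r a a' false).
apply: (@phi_res0 l r a a' true); apply/eqP => /= E'; apply: aa'.
by rewrite /vrel E E'.
Qed.

(** Insert a letter [(g, h')] summed over [h']: next to [(g, h)] only [h' = h] survives. *)
Lemma phi_dup l r (a : pairs) : phi (l ++ a :: a :: r) = phi (l ++ a :: r).
Proof.
case: a => g h; have := phi_sumH l ((g, h) :: r) g; rewrite (bigD1 h) //= big1 ?addr0 // => h' h'h.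
by apply: (@phi_res0 _ _ _ _ false); rewrite /= eqxx (negbTE h'h).
Qed.

Lemma phi_rev w : phi (rev w) = phi w.
Proof.
have := @W_rev (size w) (unzip1 w) (rev (unzip2 w)).
by rewrite revK /phi size_rev /unzip1 /unzip2 !map_rev ?size_map ?size_rev ?size_map; apply.
Qed.

Lemma phi_nil : phi [::] = 1. Proof. exact: W0. Qed.

Lemma sumT_zip n (F : seq pairs -> K) :
  sumT n F = sumT n (fun x => sumT n (fun y => F (zip x y))).
Proof.
elim: n F => //= n IH F; rewrite (eq_bigr (fun p : pairs => sumT n (fun w => F ((p.1, p.2) :: w)))) => [|[] //].
rewrite -(pair_bigA _ (fun g h => sumT n (fun w => F ((g, h) :: w)))) /=.
apply: eq_bigr => g _; rewrite sumT_sum; apply: eq_bigr => h _; exact: IH.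
Qed.

(* Since sum_h u_gh = 1, a word may be extended by the letters (g, h), summed over h, which brings words of
   different lengths to a common length N. *)
Section Padding.
Variable g : vertex G.
Definition extendable (F : seq pairs -> K) := forall w, F w = \sum_h F (rcons w (g, h)).

Lemma padding N w : (size w <= N)%N ->
  exists C : seq pairs -> K, forall F, extendable F -> F w = sumT N (fun z => C z * F z).
Proof.
move=> wN; move: (N - size w)%N (subnKC wN) => m; elim: m w {wN} => [|m IH] w.
  rewrite addn0 => wN; exists (fun z => (w == z)%:R) => F _; by rewrite sumT_delta.
move=> wN; have /choice[C CP] h : exists C : seq pairs -> K,
    forall F, extendable F -> F (rcons w (g, h)) = sumT N (fun z => C z * F z).
  by apply: IH; rewrite size_rcons -wN addnS.
exists (fun z => \sum_h C h z) => F extF; rewrite extF.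
under eq_bigr do rewrite CP //.
by rewrite -sumT_sum; apply: eq_sumT => z _; rewrite mulr_suml.
Qed.

Lemma padding_sum N (s : seq (K * seq pairs)) : all (fun p => size p.2 <= N)%N s ->
  exists C : seq pairs -> K, forall F, extendable F -> \sum_(p <- s) p.1 * F p.2 = sumT N (fun z => C z * F z).
Proof.
elim: s => [_|[a w] s IH /= /andP[/padding[C CP] /IH[C' CP']]].
  by exists (fun=> 0) => F _; rewrite big_nil -[LHS](sumT0 K pairs N); apply: eq_sumT => z _; rewrite mul0r.
exists (fun z => a * C z + C' z) => F extF; rewrite big_cons CP' //= (CP F) // -sumT_lin.
by apply: eq_sumT => z _; rewrite mulrDl mulrA.
Qed.

Lemma phi_psd (s : seq (K * seq pairs)) :
  0 <= \sum_(p <- s) \sum_(q <- s) p.1 * phi (rev p.2 ++ q.2) * q.1.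
Proof.
pose N := (\max_(p <- s) size p.2)%N.
have sN : all (fun p => size p.2 <= N)%N s.
  by apply/allP => p ps; exact: (@leq_bigmax_seq _ _ xpredT (fun p => size p.2)).
have [C CP] := padding_sum sN.
have extr w : extendable (fun w' => phi (rev w ++ w')).
  move=> w' /=; rewrite -[w' in LHS]cats0 catA -(phi_sumH _ _ g).
  by apply: eq_bigr => h _; rewrite -cats1 catA.
have extl w : extendable (fun w' => phi (rev w' ++ w)).
  move=> w' /=; rewrite -(phi_sumH [::] (rev w' ++ w) g).
  by apply: eq_bigr => h _; rewrite rev_rcons.
under eq_bigr => p _.
  rewrite (eq_bigr (fun q => p.1 * (q.1 * phi (rev p.2 ++ q.2)))) => [|q _]; last by rewrite -mulrA [phi _ * _]mulrC.
  rewrite -mulr_sumr (CP _ (extr p.2)) -sumTZ.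
  over.
rewrite -sumT_sum (eq_sumT (g := fun z => sumT N (fun z' => C z' * phi (rev z' ++ z) * C z))); last first.
  move=> z _; under eq_bigr do rewrite mulrCA.
  rewrite -mulr_sumr (CP _ (extl z)) -sumTZ; apply: eq_sumT => z' _; by rewrite mulrC.
rewrite sumT_exchange; have := @W_psd N (fun x y => C (zip x y)); congr (0 <= _).
rewrite sumT_zip; apply: eq_sumT => x xN; apply: eq_sumT => y yN.
rewrite sumT_zip; apply: eq_sumT => x' x'N; apply: eq_sumT => y' y'N.
congr (_ * _ * _); rewrite /phi size_cat size_rev !size_zip xN yN x'N y'N minnn addnn.
have -> : unzip1 (rev (zip x y) ++ zip x' y') = rev x ++ x'.
  by rewrite [LHS]map_cat map_rev -!/(unzip1 _) !unzip1_zip ?yN ?y'N ?xN ?x'N.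
have -> // : unzip2 (rev (zip x y) ++ zip x' y') = rev y ++ y'.
by rewrite [LHS]map_cat map_rev -!/(unzip2 _) !unzip2_zip ?yN ?y'N ?xN ?x'N.
Qed.
End Padding.
End PlanarSpan.

(** * A C*-algebra of operator sequences *)

Local Notation R := Rdefinitions.R.
Local Notation Re := complex.Re.
Local Notation Im := complex.Im.

(** The form may be degenerate, as it is on formal combinations of words; null vectors are removed
    only when operators are identified. [inner_neq0] keeps the unit of the algebra different from
    zero. *)
Record prehilbert := Prehilbert {
  pv :> lmodType CC;
  inner : pv -> pv -> CC;
  inner_lin : forall u (c : CC) v w, (inner u (c *: v + w) = c * inner u v + inner u w)%R;
  inner_conj : forall u v, inner v u = conjc (inner u v);
  inner_ge0 : forall u, (0 <= inner u u)%R;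
  inner_neq0 : exists u, inner u u <> 0%R
}.

Section Seminorm.
Local Open Scope ring_scope.
Variable E : prehilbert.
Implicit Types (u v w : E) (c : CC).

Lemma inner_linl c u v w : inner (c *: u + v) w = conjc c * inner u w + inner v w.
Proof. by rewrite inner_conj inner_lin rmorphD rmorphM /= -!inner_conj. Qed.

Lemma inner0r u : inner u 0 = 0.
Proof. by have := inner_lin u (-1) 0 0; rewrite scaler0 addr0 mulN1r addNr. Qed.
Lemma innerDr u v w : inner u (v + w) = inner u v + inner u w.
Proof. by have := inner_lin u 1 v w; rewrite scale1r mul1r. Qed.
Lemma innerZr c u v : inner u (c *: v) = c * inner u v.
Proof. by have := inner_lin u c v 0; rewrite addr0 inner0r addr0. Qed.
Lemma innerDl u v w : inner (u + v) w = inner u w + inner v w.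
Proof. by rewrite inner_conj innerDr rmorphD /= -!inner_conj. Qed.
Lemma innerZl c u v : inner (c *: u) v = conjc c * inner u v.
Proof. by rewrite inner_conj innerZr rmorphM /= -inner_conj. Qed.

Lemma innerNr u v : inner u (- v) = - inner u v.
Proof. by rewrite -(scaleN1r v) innerZr mulN1r. Qed.
Lemma innerNl u v : inner (- u) v = - inner u v.
Proof. by rewrite inner_conj innerNr rmorphN /= -inner_conj. Qed.

Definition nrm u : R := Num.sqrt (Re (inner u u)).

Lemma Re_inner_ge0 u : 0 <= Re (inner u u).
Proof. by have := inner_ge0 u; rewrite lecE => /andP[]. Qed.
Lemma Im_inner u : Im (inner u u) = 0.
Proof. exact/ger0_Im/inner_ge0. Qed.
Lemma nrm_ge0 u : 0 <= nrm u. Proof. exact: sqrtr_ge0. Qed.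
Lemma nrm_sqr u : nrm u ^+ 2 = Re (inner u u).
Proof. by rewrite sqr_sqrtr // Re_inner_ge0. Qed.

Lemma ReD (x y : CC) : Re (x + y) = Re x + Re y. Proof. by case: x; case: y. Qed.
Lemma ReC (x : CC) : Re (conjc x) = Re x. Proof. by case: x. Qed.
Lemma ReZ (a : R) (x : CC) : Re (a%:C%C * x) = a * Re x.
Proof. by case: x => x y /=; rewrite mul0r subr0. Qed.
Lemma conjcR (a : R) : conjc a%:C%C = a%:C%C.
Proof. exact: conjc_real. Qed.

Lemma Re_inner_comb (a b : R) u v : 0 <= a ^+ 2 * nrm u ^+ 2 + 2 * a * b * Re (inner u v) + b ^+ 2 * nrm v ^+ 2.
Proof.
have := Re_inner_ge0 (a%:C%C *: u + b%:C%C *: v).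
rewrite innerDr !innerDl !innerZr !innerZl !conjcR !ReD !ReZ (inner_conj u v) ReC -!nrm_sqr.
by congr (0 <= _); ring.
Qed.

(** The coefficients [- q] and [p] in the nonnegative quadratic form give the inequality when both
    norms are positive. If one norm vanishes and [B] were positive, the coefficient with denominator
    [B] would make the form negative. *)
Lemma cauchy_schwarz u v : Re (inner u v) <= nrm u * nrm v.
Proof.
have := Re_inner_comb; have := nrm_ge0 u; have := nrm_ge0 v.
move: (Re (inner u v)) (nrm u) (nrm v) (fun a b => Re_inner_comb a b u v) => B p q H q0 p0 _.
case: (eqVneq p 0) => [p_0|p_n0].
  rewrite p_0 mul0r leNgt; apply/negP => B0.
  have := H (- (q ^+ 2 + 1) / B) 1; rewrite p_0.
  have -> : (- (q ^+ 2 + 1) / B) ^+ 2 * 0 ^+ 2 + 2 * (- (q ^+ 2 + 1) / B) * 1 * B + 1 ^+ 2 * q ^+ 2 = - q ^+ 2 - 2.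
    by field; rewrite gt_eqF.
  by have := sqr_ge0 q; lra.
have {}p0 : 0 < p by rewrite lt_def p_n0.
have := H (- q) p; have -> : (- q) ^+ 2 * p ^+ 2 + 2 * - q * p * B + p ^+ 2 * q ^+ 2 = 2 * p * q * (p * q - B) by ring.
case: (eqVneq q 0) => [q_0 _|q_n0].
  rewrite q_0 mulr0 leNgt; apply/negP => B0.
  have := H 1 (- (p ^+ 2 + 1) / B); rewrite q_0.
  have -> : 1 ^+ 2 * p ^+ 2 + 2 * 1 * (- (p ^+ 2 + 1) / B) * B + (- (p ^+ 2 + 1) / B) ^+ 2 * 0 ^+ 2 = - p ^+ 2 - 2.
    by field; rewrite gt_eqF.
  by have := sqr_ge0 p; lra.
have {}q0 : 0 < q by rewrite lt_def q_n0.
rewrite pmulr_rge0 ?subr_ge0 //; first by rewrite !mulr_gt0.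
Qed.

Lemma nrmD u v : nrm (u + v) <= nrm u + nrm v.
Proof.
rewrite -(@ler_pXn2r _ 2) ?nnegrE ?nrm_ge0 ?addr_ge0 ?nrm_ge0 //.
rewrite nrm_sqr innerDr !innerDl !ReD (inner_conj u v) ReC -!nrm_sqr.
by have := cauchy_schwarz u v; nra.
Qed.

Lemma nrmZ c u : nrm (c *: u) = ComplexField.Normc.normc c * nrm u.
Proof.
rewrite /nrm innerZr innerZl mulrA; case: c => a b.
have -> : Complex a b * conjc (Complex a b) = ((a ^+ 2 + b ^+ 2)%:C)%C.
  by apply/eqP; rewrite eq_complex /=; apply/andP; split; apply/eqP; ring.
by rewrite ReZ sqrtrM ?addr_ge0 ?sqr_ge0.
Qed.

Lemma nrmN u : nrm (- u) = nrm u.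
Proof. by rewrite -scaleN1r nrmZ normcN ComplexField.Normc.normc1 mul1r. Qed.

Lemma nrm0 : nrm 0 = 0 :> R.
Proof. by rewrite /nrm inner0r sqrtr0. Qed.

Lemma nrm_eq0 v : (forall u, inner u v = 0) -> nrm v = 0.
Proof. by move=> v0; rewrite /nrm v0 sqrtr0. Qed.

End Seminorm.

Local Notation normc := ComplexField.Normc.normc.

Section OperatorSequences.
Local Open Scope ring_scope.
Variable E : prehilbert.
Implicit Types (u v w : E) (c : CC) (t s : nat -> E -> E) (M : R).

(* The limit superior of the operator norms of the t n is at most M. *)
Definition asymp_bound t M := 0 <= M /\
  forall e, 0 < e -> exists N, forall n, (N <= n)%N -> forall v, nrm (t n v) <= (M + e) * nrm v.

Lemma asymp_bound_le t M M' : M <= M' -> asymp_bound t M -> asymp_bound t M'.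
Proof.
move=> MM' [M0 tM]; split=> [|e /tM[N tN]]; first exact: le_trans MM'.
exists N => n /tN h v; apply: le_trans (h v) _; by rewrite ler_wpM2r ?nrm_ge0 // lerD2r.
Qed.

Lemma asymp_bound_inf t M : 0 <= M -> (forall e, 0 < e -> asymp_bound t (M + e)) -> asymp_bound t M.
Proof.
move=> M0 h; split=> // e e0; have e2 : 0 < e / 2 by lra.
have [_ /(_ _ e2)[N tN]] := h _ e2; exists N => n /tN h' v; move: (h' v).
by have -> : M + e / 2 + e / 2 = M + e by lra.
Qed.

Lemma asymp_boundD t s M M' : asymp_bound t M -> asymp_bound s M' ->
  asymp_bound (fun n v => t n v + s n v) (M + M').
Proof.
move=> [M0 tM] [M'0 sM']; split=> [|e e0]; first exact: addr_ge0.
have e2 : 0 < e / 2 by lra.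
have [N tN] := tM _ e2; have [N' sN'] := sM' _ e2; exists (maxn N N') => n; rewrite geq_max => /andP[/tN h /sN' h'] v.
apply: le_trans (nrmD _ _) _; have := h v; have := h' v; have := nrm_ge0 v; nra.
Qed.

Lemma asymp_boundZ c t M : asymp_bound t M -> asymp_bound (fun n v => c *: t n v) (normc c * M).
Proof.
have c0 : 0 <= normc c by case: c => a b; exact: sqrtr_ge0.
move=> [M0 tM]; split=> [|e e0]; first exact: mulr_ge0.
have e1 : 0 < e / (normc c + 1) by rewrite divr_gt0 // ltr_wpDl.
have [N tN] := tM _ e1; exists N => n /tN h v; rewrite nrmZ.
apply: le_trans (ler_wpM2l c0 (h v)) _; rewrite mulrA ler_wpM2r ?nrm_ge0 // mulrDr lerD2l.
rewrite mulrA ler_pdivrMr ?ltr_wpDl // mulrDr mulr1 [e * _]mulrC lerDl; exact: ltW.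
Qed.

Lemma asymp_boundM t s M M' : asymp_bound t M -> asymp_bound s M' ->
  asymp_bound (fun n v => t n (s n v)) (M * M').
Proof.
move=> [M0 tM] [M'0 sM']; split=> [|e e0]; first exact: mulr_ge0.
have M1 : 0 < M + M' + 1 by lra.
pose d := Num.min 1 (e / (M + M' + 1)).
have d0 : 0 < d by rewrite lt_min ltr01 divr_gt0.
have d1 : d <= 1 by rewrite ge_min lexx.
have de : d * (M + M' + 1) <= e by rewrite -ler_pdivlMr // ge_min lexx orbT.
have [N tN] := tM _ d0; have [N' sN'] := sM' _ d0; exists (maxn N N') => n; rewrite geq_max => /andP[/tN h /sN' h'] v.
apply: le_trans (h _) _; apply: le_trans (ler_wpM2l _ (h' v)) _; first by lra.
rewrite mulrA ler_wpM2r ?nrm_ge0 //; nra.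
Qed.

Lemma asymp_bound_adj t s M : (forall n u v, inner (s n u) v = inner u (t n v)) ->
  asymp_bound t M -> asymp_bound s M.
Proof.
move=> adj [M0 tM]; split=> // e /[dup] e0 /tM[N tN]; exists N => n /tN h v.
case: (eqVneq (nrm (s n v)) 0) => [->|s0]; first by rewrite mulr_ge0 ?nrm_ge0 // addr_ge0 // ltW.
have {}s0 : 0 < nrm (s n v) by rewrite lt_def s0 nrm_ge0.
rewrite -(ler_pM2r s0) -expr2 nrm_sqr adj; apply: le_trans (cauchy_schwarz _ _) _.
by apply: le_trans (ler_wpM2l (nrm_ge0 _) (h _)) _; rewrite mulrCA mulrA.
Qed.

Lemma asymp_bound_id : asymp_bound (fun _ v => v) 1.
Proof.
split=> // e e0; exists 0%N => n _ v; have := nrm_ge0 v; nra.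
Qed.

Lemma asymp_bound0 t : (forall n v, nrm (t n v) = 0) -> asymp_bound t 0.
Proof.
by move=> t0; split=> // e e0; exists 0%N => n _ v; rewrite t0 add0r mulr_ge0 ?nrm_ge0 // ltW.
Qed.

Lemma asymp_boundN t M : asymp_bound t M -> asymp_bound (fun n v => - t n v) M.
Proof.
move=> [M0 tM]; split=> // e /tM[N tN]; exists N => n /tN h v; by rewrite nrmN.
Qed.

Definition opnorm t : R := inf (asymp_bound t).

Lemma opnorm_le t M : asymp_bound t M -> opnorm t <= M.
Proof. by move=> tM; apply: ge_inf => //; exists 0 => x []. Qed.

(** The slack [e] in [asymp_bound] makes the infimum itself a bound. *)
Lemma opnorm_bound t M : asymp_bound t M -> asymp_bound t (opnorm t).
Proof.
move=> tM; have i : classical_sets.has_inf (asymp_bound t) by split; [exists M|exists 0 => x []].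
have i0 : 0 <= opnorm t by apply: lb_le_inf => [|x []]; first by exists M.
apply: asymp_bound_inf => // e e0; have [x tx xe] := inf_adherent e0 i.
by apply: asymp_bound_le tx; exact: ltW.
Qed.

(* Each operator carries its adjoint, since E need not be complete. *)
Record opseq := Opseq {
  fwd : nat -> E -> E;
  bwd : nat -> E -> E;
  fwd_lin : forall n c u v, fwd n (c *: u + v) = c *: fwd n u + fwd n v;
  bwd_lin : forall n c u v, bwd n (c *: u + v) = c *: bwd n u + bwd n v;
  bwdE : forall n u v, inner (bwd n u) v = inner u (fwd n v);
  fwd_bounded : exists M, asymp_bound fwd M
}.

Lemma opseq_eq (a b : opseq) : (forall n v, fwd a n v = fwd b n v) -> (forall n v, bwd a n v = bwd b n v) -> a = b.
Proof.
case: a b => t s ? ? ? ? [t' s' ? ? ? ?] /= tt' ss'.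
have E1 : t = t' by apply/funext => n; apply/funext => v.
have E2 : s = s' by apply/funext => n; apply/funext => v.
by subst t' s'; congr Opseq; exact: Prop_irrelevance.
Qed.

Definition norm (a : opseq) := opnorm (fwd a).

Lemma normP a : asymp_bound (fwd a) (norm a).
Proof. by have [M /opnorm_bound] := fwd_bounded a. Qed.
Lemma norm_ge0 a : 0 <= norm a. Proof. by case: (normP a). Qed.

Lemma fwdE a n u v : inner (fwd a n u) v = inner u (bwd a n v).
Proof. by rewrite inner_conj -bwdE -inner_conj. Qed.

Lemma fwdD a n u v : fwd a n (u + v) = fwd a n u + fwd a n v.
Proof. by have := fwd_lin a n 1 u v; rewrite !scale1r. Qed.
Lemma fwd0 a n : fwd a n 0 = 0.
Proof. by have := fwd_lin a n (-1) 0 0; rewrite scaler0 addr0 scaleN1r addNr. Qed.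
Lemma fwdZ a n c u : fwd a n (c *: u) = c *: fwd a n u.
Proof. by have := fwd_lin a n c u 0; rewrite !addr0 fwd0 addr0. Qed.

Lemma fwdN a n u : fwd a n (- u) = - fwd a n u.
Proof. by rewrite -(scaleN1r u) fwdZ scaleN1r. Qed.

Definition star_op (a : opseq) : opseq.
Proof.
by refine (@Opseq (bwd a) (fwd a) (bwd_lin a) (fwd_lin a) (fwdE a) (ex_intro _ (norm a) (asymp_bound_adj (bwdE a) (normP a)))).
Defined.

Lemma bwdD a n u v : bwd a n (u + v) = bwd a n u + bwd a n v.
Proof. exact: (fwdD (star_op a)). Qed.
Lemma bwdZ a n c u : bwd a n (c *: u) = c *: bwd a n u.
Proof. exact: (fwdZ (star_op a)). Qed.

Definition add_op (a b : opseq) : opseq.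
Proof.
refine (@Opseq (fun n v => fwd a n v + fwd b n v) (fun n v => bwd a n v + bwd b n v) _ _ _
  (ex_intro _ (norm a + norm b) (asymp_boundD (normP a) (normP b)))).
- by move=> n c u v; rewrite !fwd_lin scalerDr addrACA.
- by move=> n c u v; rewrite !bwd_lin scalerDr addrACA.
- by move=> n u v; rewrite innerDl innerDr !bwdE.
Defined.

Definition mul_op (a b : opseq) : opseq.
Proof.
refine (@Opseq (fun n v => fwd a n (fwd b n v)) (fun n v => bwd b n (bwd a n v)) _ _ _
  (ex_intro _ (norm a * norm b) (asymp_boundM (normP a) (normP b)))).
- by move=> n c u v; rewrite !fwd_lin.
- by move=> n c u v; rewrite !bwd_lin.
- by move=> n u v; rewrite !bwdE.
Defined.

Definition scale_op c (a : opseq) : opseq.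
Proof.
refine (@Opseq (fun n v => c *: fwd a n v) (fun n v => conjc c *: bwd a n v) _ _ _
  (ex_intro _ (normc c * norm a) (asymp_boundZ c (normP a)))).
- by move=> n d u v; rewrite fwd_lin scalerDr !scalerA mulrC.
- by move=> n d u v; rewrite bwd_lin scalerDr !scalerA mulrC.
- by move=> n u v; rewrite innerZl innerZr bwdE conjcK.
Defined.

Lemma fwd_add a b n v : fwd (add_op a b) n v = fwd a n v + fwd b n v. Proof. by []. Qed.
Lemma bwd_add a b n v : bwd (add_op a b) n v = bwd a n v + bwd b n v. Proof. by []. Qed.
Lemma fwd_scale c a n v : fwd (scale_op c a) n v = c *: fwd a n v. Proof. by []. Qed.
Lemma bwd_scale c a n v : bwd (scale_op c a) n v = conjc c *: bwd a n v. Proof. by []. Qed.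

Definition one_op : opseq := @Opseq (fun _ v => v) (fun _ v => v) (fun _ _ _ _ => erefl) (fun _ _ _ _ => erefl)
  (fun _ _ _ => erefl) (ex_intro _ 1 asymp_bound_id).

Definition zero_op := scale_op 0 one_op.
Definition opp_op := scale_op (-1).

Definition eqv (a b : opseq) : bool := `[< asymp_bound (fun n v => fwd a n v - fwd b n v) 0 >].

Lemma eqvP a b : reflect (asymp_bound (fun n v => fwd a n v - fwd b n v) 0) (eqv a b).
Proof. exact: asboolP. Qed.

Lemma asymp_bound_ext t s M : (forall n v, t n v = s n v) -> asymp_bound t M -> asymp_bound s M.
Proof. by move=> ts [M0 tM]; split=> // e /tM[N tN]; exists N => n /tN h v; rewrite -ts. Qed.

Lemma eqv_refl : reflexive eqv.
Proof. by move=> a; apply/eqvP/asymp_bound0 => n v; rewrite subrr nrm0. Qed.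
Lemma eqv_sym : symmetric eqv.
Proof.
move=> a b; apply/eqvP/eqvP => /asymp_boundN; apply: asymp_bound_ext => n v; exact: opprB.
Qed.
Lemma eqv_trans : transitive eqv.
Proof.
move=> b a c /eqvP h /eqvP h'; apply/eqvP; have := asymp_boundD h h'; rewrite addr0.
by apply: asymp_bound_ext => n v; rewrite addrA subrK.
Qed.

(** A difference with values in the radical of the form has seminorm zero, so identities between
    operators need only be tested inside [inner]. *)
Lemma eqv_inner a b : (forall n u v, inner u (fwd a n v) = inner u (fwd b n v)) -> eqv a b.
Proof.
move=> ab; apply/eqvP/asymp_bound0 => n v; apply: nrm_eq0 => u.
by rewrite innerDr innerNr ab subrr.
Qed.

Lemma eqv_add a a' b b' : eqv a a' -> eqv b b' -> eqv (add_op a b) (add_op a' b').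
Proof.
move=> /eqvP h /eqvP h'; apply/eqvP; have := asymp_boundD h h'; rewrite addr0.
by apply: asymp_bound_ext => n v /=; rewrite opprD addrACA.
Qed.

Lemma eqv_scale c a a' : eqv a a' -> eqv (scale_op c a) (scale_op c a').
Proof.
move=> /eqvP/(asymp_boundZ c); rewrite mulr0 => h; apply/eqvP; apply: asymp_bound_ext h => n v /=.
exact: scalerBr.
Qed.

Lemma eqv_mul a a' b b' : eqv a a' -> eqv b b' -> eqv (mul_op a b) (mul_op a' b').
Proof.
move=> /eqvP h /eqvP h'; apply/eqvP; have := asymp_boundD (asymp_boundM h (normP b)) (asymp_boundM (normP a') h').
rewrite mul0r mulr0 addr0; apply: asymp_bound_ext => n v /=.
by rewrite fwdD fwdN addrA subrK.
Qed.

Lemma eqv_star a a' : eqv a a' -> eqv (star_op a) (star_op a').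
Proof.
move=> /eqvP; move/(@asymp_bound_adj _ (fun n v => bwd a n v - bwd a' n v)) => h; apply/eqvP; apply: h => n u v.
by rewrite innerDl innerDr innerNl innerNr !bwdE.
Qed.

Lemma norm_add a b : norm (add_op a b) <= norm a + norm b.
Proof. exact: opnorm_le (asymp_boundD (normP a) (normP b)). Qed.
Lemma norm_mul a b : norm (mul_op a b) <= norm a * norm b.
Proof. exact: opnorm_le (asymp_boundM (normP a) (normP b)). Qed.
Lemma norm_scale_le c a : norm (scale_op c a) <= normc c * norm a.
Proof. exact: opnorm_le (asymp_boundZ c (normP a)). Qed.
Lemma norm_star_le a : norm (star_op a) <= norm a.
Proof. exact: opnorm_le (asymp_bound_adj (bwdE a) (normP a)). Qed.

Lemma norm_eqv a a' : eqv a a' -> norm a = norm a'.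
Proof.
suff h b b' : eqv b b' -> norm b <= norm b' by move=> aa'; apply/le_anti; rewrite !h // eqv_sym.
move=> /eqvP bb'; apply: opnorm_le; have := asymp_boundD bb' (normP b'); rewrite add0r.
by apply: asymp_bound_ext => n v; rewrite subrK.
Qed.

Lemma norm_eq0 a : norm a = 0 -> eqv a zero_op.
Proof.
move=> a0; apply/eqvP; have := normP a; rewrite a0; apply: asymp_bound_ext => n v /=.
by rewrite scale0r subr0.
Qed.

Lemma norm_scale c a : norm (scale_op c a) = normc c * norm a.
Proof.
apply/le_anti/andP; split; first exact: norm_scale_le.
case: (eqVneq c 0) => [->|c0]; first by rewrite ComplexField.Normc.normc0 mul0r norm_ge0.
have := norm_scale_le c^-1 (scale_op c a).
have -> : scale_op c^-1 (scale_op c a) = a.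
  apply: opseq_eq => n v /=; first by rewrite scalerA mulVf // scale1r.
  by rewrite scalerA -rmorphM mulVf // rmorph1 scale1r.
have nc0 : 0 < normc c.
  rewrite lt_def; apply/andP; split; last by case: c {c0} => x y; exact: sqrtr_ge0.
  by apply: contra_neq c0 => /ComplexField.Normc.eq0_normc.
by rewrite ComplexField.Normc.normcV -ler_pdivlMl ?invr_gt0 // invrK.
Qed.

Lemma norm_star a : norm (star_op a) = norm a.
Proof.
apply/le_anti; rewrite norm_star_le /=; have := norm_star_le (star_op a).
by have -> : star_op (star_op a) = a by exact: opseq_eq.
Qed.

Lemma norm_cstar a : norm (mul_op (star_op a) a) = norm a ^+ 2.
Proof.
apply/le_anti/andP; split; first by have := norm_mul (star_op a) a; rewrite norm_star.
have [M0 h] := normP (mul_op (star_op a) a); set M := norm (mul_op _ _) in M0 h *.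
suff : norm a <= Num.sqrt M.
  move=> aM; rewrite -[leRHS]sqr_sqrtr // ler_pXn2r ?nnegrE ?norm_ge0 ?sqrtr_ge0 //.
apply: opnorm_le; split=> [|e e0]; first exact: sqrtr_ge0.
(* A slack of [e ^+ 2] is enough, since [M + e ^+ 2] is at most the square of [Num.sqrt M + e]. *)
have [N hN] := h _ (exprn_gt0 2 e0); exists N => n /hN /= /[swap] v /(_ v) hv.
rewrite -(@ler_pXn2r _ 2) ?nnegrE ?nrm_ge0 ?mulr_ge0 ?addr_ge0 ?sqrtr_ge0 ?nrm_ge0 ?(ltW e0) //.
rewrite nrm_sqr fwdE; apply: le_trans (cauchy_schwarz _ _) _.
apply: le_trans (ler_wpM2l (nrm_ge0 _) hv) _; rewrite mulrCA -expr2 exprMn ler_wpM2r ?sqr_ge0 //.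
rewrite sqrrD sqr_sqrtr // lerD2r lerDl mulrn_wge0 // mulr_ge0 ?sqrtr_ge0 //; exact: ltW.
Qed.
End OperatorSequences.

Section Completeness.
Local Open Scope ring_scope.
Variable E : prehilbert.
Implicit Types (a b : opseq E) (v : E).

Definition dist a b := norm (add_op a (opp_op b)).

Lemma dist_bound a b : asymp_bound (fun n v => fwd a n v - fwd b n v) (dist a b).
Proof. by have := normP (add_op a (opp_op b)); apply: asymp_bound_ext => n v /=; rewrite scaleN1r. Qed.

Lemma dist_le a b M : asymp_bound (fun n v => fwd a n v - fwd b n v) M -> dist a b <= M.
Proof. by move=> h; apply: opnorm_le; apply: asymp_bound_ext h => n v /=; rewrite scaleN1r. Qed.

Lemma inv_succ_lt (e : R) : 0 < e -> exists k, k.+1%:R^-1 < e.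
Proof.
move=> e0; exists (Num.bound e^-1); rewrite invf_plt ?posrE ?ltr0Sn //.
have := archi_boundP (ltW (_ : 0 < e^-1)); rewrite invr_gt0 => /(_ e0)/lt_trans; apply.
by rewrite ltr_nat.
Qed.

(** Here sequences of operators pay off. The limit takes its [n]-th operator from the member
    [b (j n)] of a fast subsequence, with [j n] growing slowly; it is adjointable because it is one
    of the given operators, so [E] itself may remain incomplete. *)
Lemma opseq_complete (u : nat -> opseq E) :
  (forall e, 0 < e -> exists N, forall m n, (N <= m)%N -> (N <= n)%N -> dist (u m) (u n) < e) ->
  exists l, forall e, 0 < e -> exists N, forall n, (N <= n)%N -> dist (u n) l < e.
Proof.
move=> cauchy; have inv0 k : 0 < k.+1%:R^-1 :> R by rewrite invr_gt0 ltr0Sn.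
have /choice[J0 J0P] k : exists N, forall m n, (N <= m)%N -> (N <= n)%N -> dist (u m) (u n) < k.+1%:R^-1.
  exact: cauchy.
pose J k := (\max_(i < k.+1) J0 i)%N.
have J0J k l : (k <= l)%N -> (J0 k <= J l)%N.
  by move=> kl; rewrite -ltnS in kl; exact: (leq_bigmax (Ordinal kl)).
pose b k := u (J k).
have /choice[N0 N0P] (p : nat * nat) : exists N, (p.1 <= p.2)%N -> forall n, (N <= n)%N -> forall v,
    nrm (fwd (b p.1) n v - fwd (b p.2) n v) <= (p.1.+1%:R^-1 + p.1.+1%:R^-1) * nrm v.
  case: p => k l /=; case: (leqP k l) => kl; last by exists 0%N.
  have [_ /(_ _ (inv0 k))[N h]] := dist_bound (b k) (b l).
  exists N => _ n /h {}h v; apply: le_trans (h v) _; rewrite ler_wpM2r ?nrm_ge0 // lerD2r ltW //.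
  by apply: J0P; apply: J0J.
pose M l := (\max_(k < l.+1) N0 (val k, l))%N.
have N0M k l : (k <= l)%N -> (N0 (k, l) <= M l)%N.
  by move=> kl; rewrite -ltnS in kl; exact: (leq_bigmax (F := fun k : 'I_l.+1 => N0 (val k, l)) (Ordinal kl)).
(* the diagonal sequence advances only once all earlier comparisons hold *)
pose j n := (\max_(l < n.+1 | M l <= n) l)%N.
have jP k n : (k <= n)%N -> (M k <= n)%N -> (k <= j n)%N && (M (j n) <= n)%N.
  move=> kn Mk; rewrite -ltnS in kn.
  have kj : (k <= j n)%N by exact: (leq_bigmax_cond (Ordinal kn)).
  rewrite kj /j; have c0 : (0 < #|[pred l : 'I_n.+1 | M l <= n]|)%N by apply/card_gt0P; exists (Ordinal kn).
  by case: (eq_bigmax_cond (fun l : 'I_n.+1 => val l) c0) => l /= lP ->.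
have close k : exists N, forall n, (N <= n)%N -> forall v,
    nrm (fwd (b k) n v - fwd (b (j n)) n v) <= (k.+1%:R^-1 + k.+1%:R^-1) * nrm v.
  exists (maxn k (M k)) => n; rewrite geq_max => /andP[kn Mk] v.
  have /andP[kj Mj] := jP k n kn Mk.
  exact: (N0P (k, j n) kj n (leq_trans (N0M _ _ kj) Mj)).
have closeB k : asymp_bound (fun n v => fwd (b k) n v - fwd (b (j n)) n v) (k.+1%:R^-1 + k.+1%:R^-1).
  split=> [|e e0]; first by rewrite addr_ge0 // ltW.
  have [N h] := close k; exists N => n /h {}h v; apply: le_trans (h v) _.
  by rewrite ler_wpM2r ?nrm_ge0 // lerDl ltW.
have Lb : exists B, asymp_bound (fun n => fwd (b (j n)) n) B.
  exists (norm (b 0%N) + (1%:R^-1 + 1%:R^-1)).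
  have := asymp_boundD (normP (b 0%N)) (asymp_boundN (closeB 0%N)).
  by apply: asymp_bound_ext => n v; rewrite opprB addrCA subrr addr0.
pose L := @Opseq E (fun n => fwd (b (j n)) n) (fun n => bwd (b (j n)) n)
  (fun n => @fwd_lin _ (b (j n)) n) (fun n => @bwd_lin _ (b (j n)) n) (fun n => @bwdE _ (b (j n)) n) Lb.
exists L => e e0; have e3 : 0 < e / 3 by lra.
have [k ke] := inv_succ_lt e3; exists (J k) => n nJ.
have d1 : dist (u n) (b k) < k.+1%:R^-1.
  by apply: J0P; [apply: leq_trans nJ|]; apply: J0J.
have : dist (u n) L <= dist (u n) (b k) + (k.+1%:R^-1 + k.+1%:R^-1).
  apply: dist_le; have := asymp_boundD (dist_bound (u n) (b k)) (closeB k).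
  by apply: asymp_bound_ext => m v; rewrite addrA subrK.
move: (k.+1%:R^-1) (dist (u n) (b k)) (dist (u n) L) d1 ke => x y z; clear; lra.
Qed.
End Completeness.

Section Quotient.
Local Open Scope ring_scope.
Variable E : prehilbert.
Implicit Types (a b : opseq E).

HB.instance Definition _ := gen_eqMixin (opseq E).
HB.instance Definition _ := gen_choiceMixin (opseq E).

Definition eqv_equiv := EquivRel (@eqv E) (@eqv_refl E) (@eqv_sym E) (@eqv_trans E).
Canonical eqv_equiv.

Definition opalg := {eq_quot (@eqv E)}%qT.
HB.instance Definition _ := Choice.on opalg.

Definition cls a : opalg := \pi_({eq_quot (@eqv E)})%qT a.
Definition rep (q : opalg) : opseq E := repr q.

Lemma clsE a b : eqv a b -> cls a = cls b.
Proof. by move=> ab; apply/eqquotP. Qed.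
Lemma rep_cls a : eqv (rep (cls a)) a.
Proof. by have /eqquotP : cls (rep (cls a)) = cls a by rewrite /cls reprK. Qed.
Lemma clsK q : cls (rep q) = q.
Proof. exact: reprK. Qed.
Lemma clsP q : exists a, q = cls a.
Proof. by exists (rep q); rewrite clsK. Qed.

Definition qadd p q := cls (add_op (rep p) (rep q)).
Definition qmul p q := cls (mul_op (rep p) (rep q)).
Definition qscale c p := cls (scale_op c (rep p)).
Definition qopp := qscale (-1).
Definition qstar p := cls (star_op (rep p)).
Definition qnorm p := norm (rep p).

Lemma cls_add a b : qadd (cls a) (cls b) = cls (add_op a b).
Proof. by apply/clsE/eqv_add; exact: rep_cls. Qed.
Lemma cls_mul a b : qmul (cls a) (cls b) = cls (mul_op a b).
Proof. by apply/clsE/eqv_mul; exact: rep_cls. Qed.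
Lemma cls_scale c a : qscale c (cls a) = cls (scale_op c a).
Proof. by apply/clsE/eqv_scale; exact: rep_cls. Qed.
Lemma cls_star a : qstar (cls a) = cls (star_op a).
Proof. by apply/clsE/eqv_star; exact: rep_cls. Qed.
Lemma cls_norm a : qnorm (cls a) = norm a.
Proof. by apply/norm_eqv; exact: rep_cls. Qed.
Definition clsS := (cls_add, cls_mul, cls_scale, cls_star, cls_norm).

Lemma qaddA : associative qadd.
Proof.
move=> p q r; have [a ->] := clsP p; have [b ->] := clsP q; have [c ->] := clsP r.
by rewrite !clsS; congr cls; apply: opseq_eq => n v /=; rewrite addrA.
Qed.
Lemma qaddC : commutative qadd.
Proof.
move=> p q; have [a ->] := clsP p; have [b ->] := clsP q.
by rewrite !clsS; congr cls; apply: opseq_eq => n v /=; rewrite addrC.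
Qed.
Lemma qadd0 : left_id (cls (zero_op E)) qadd.
Proof.
move=> p; have [a ->] := clsP p.
by rewrite !clsS; congr cls; apply: opseq_eq => n v; rewrite ?fwd_add ?bwd_add ?fwd_scale ?bwd_scale ?rmorph0 scale0r add0r.
Qed.
Lemma qaddN : left_inverse (cls (zero_op E)) qopp qadd.
Proof.
move=> p; have [a ->] := clsP p; rewrite /qopp !clsS; congr cls; apply: opseq_eq => n v.
  by rewrite fwd_add !fwd_scale scaleN1r addNr scale0r.
by rewrite bwd_add !bwd_scale rmorphN rmorph1 rmorph0 scaleN1r addNr scale0r.
Qed.
HB.instance Definition _ := GRing.isZmodule.Build opalg qaddA qaddC qadd0 qaddN.

Lemma qmulA : associative qmul.
Proof.
move=> p q r; have [a ->] := clsP p; have [b ->] := clsP q; have [c ->] := clsP r.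
by rewrite !clsS; congr cls; apply: opseq_eq.
Qed.
Lemma qmul1l : left_id (cls (one_op E)) qmul.
Proof. by move=> p; have [a ->] := clsP p; rewrite !clsS; congr cls; apply: opseq_eq. Qed.
Lemma qmul1r : right_id (cls (one_op E)) qmul.
Proof. by move=> p; have [a ->] := clsP p; rewrite !clsS; congr cls; apply: opseq_eq. Qed.
Lemma qmulDl : left_distributive qmul qadd.
Proof.
move=> p q r; have [a ->] := clsP p; have [b ->] := clsP q; have [c ->] := clsP r.
by rewrite !clsS; congr cls; apply: opseq_eq => n v //=; rewrite bwdD.
Qed.
Lemma qmulDr : right_distributive qmul qadd.
Proof.
move=> p q r; have [a ->] := clsP p; have [b ->] := clsP q; have [c ->] := clsP r.
by rewrite !clsS; congr cls; apply: opseq_eq => n v //=; rewrite fwdD.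
Qed.
Lemma qone_neq0 : cls (one_op E) != cls (zero_op E).
Proof.
apply/eqP => /eqquotP/eqvP[_ /(_ (1 / 2))[|N /(_ N (leqnn N))]]; first by lra.
have [u u0] := inner_neq0 E; move=> /(_ u) /=; rewrite scale0r subr0 => h.
suff : 0 < nrm u by move: h; lra.
rewrite lt_def nrm_ge0 andbT; apply/eqP => n0; apply: u0.
have := nrm_sqr u; rewrite n0 expr0n /= => /esym re0.
by apply/eqP; rewrite eq_complex /= re0 Im_inner !eqxx.
Qed.
HB.instance Definition _ := GRing.Zmodule_isNzRing.Build opalg qmulA qmul1l qmul1r qmulDl qmulDr qone_neq0.

Lemma qscaleA c d p : qscale c (qscale d p) = qscale (c * d) p.
Proof.
have [a ->] := clsP p; rewrite !clsS; congr cls; apply: opseq_eq => n v; rewrite ?fwd_scale ?bwd_scale scalerA //.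
by rewrite rmorphM.
Qed.
Lemma qscale1 : left_id 1 qscale.
Proof.
move=> p; have [a ->] := clsP p; rewrite !clsS; congr cls; apply: opseq_eq => n v; rewrite ?fwd_scale ?bwd_scale ?rmorph1 scale1r //.
Qed.
Lemma qscaleDr : right_distributive qscale +%R.
Proof.
move=> c p q; have [a ->] := clsP p; have [b ->] := clsP q; rewrite -[LHS]/(qscale c (qadd _ _)).
rewrite -[RHS]/(qadd _ _) !clsS; congr cls; apply: opseq_eq => n v /=; exact: scalerDr.
Qed.
Lemma qscaleDl p : {morph qscale^~ p : c d / c + d}.
Proof.
move=> c d; have [a ->] := clsP p; rewrite -[RHS]/(qadd _ _) !clsS; congr cls.
by apply: opseq_eq => n v; rewrite ?fwd_add ?bwd_add ?fwd_scale ?bwd_scale ?rmorphD scalerDl.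
Qed.
HB.instance Definition _ := GRing.Zmodule_isLmodule.Build CC opalg qscaleA qscale1 qscaleDr qscaleDl.

Lemma qscaleAl c (p q : opalg) : c *: (p * q) = (c *: p) * q.
Proof.
have [a ->] := clsP p; have [b ->] := clsP q; rewrite -[LHS]/(qscale c (qmul _ _)) -[RHS]/(qmul (qscale _ _) _).
by rewrite !clsS; congr cls; apply: opseq_eq => n v //=; rewrite bwdZ.
Qed.
HB.instance Definition _ := GRing.Lmodule_isLalgebra.Build CC opalg qscaleAl.
Lemma qscaleAr c (p q : opalg) : c *: (p * q) = p * (c *: q).
Proof.
have [a ->] := clsP p; have [b ->] := clsP q; rewrite -[LHS]/(qscale c (qmul _ _)) -[RHS]/(qmul _ (qscale _ _)).
by rewrite !clsS; congr cls; apply: opseq_eq => n v //=; rewrite fwdZ.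
Qed.
HB.instance Definition _ := GRing.Lalgebra_isAlgebra.Build CC opalg qscaleAr.

Lemma addE a b : cls a + cls b = cls (add_op a b). Proof. exact: cls_add. Qed.
Lemma mulE a b : cls a * cls b = cls (mul_op a b). Proof. exact: cls_mul. Qed.
Lemma scaleE c a : c *: cls a = cls (scale_op c a). Proof. exact: cls_scale. Qed.
Lemma oppE a : - cls a = cls (opp_op a). Proof. exact: cls_scale. Qed.

Definition operator_algebra : cstarAlg.
Proof.
refine (@CstarAlg opalg qstar qnorm _ _ _ _ _ _ _ _ _ _).
- by move=> p; have [a ->] := clsP p; rewrite !clsS; congr cls; exact: opseq_eq.
- move=> p q; have [a ->] := clsP p; have [b ->] := clsP q.
  by rewrite addE !cls_star addE; congr cls; exact: opseq_eq.
- move=> c p; have [a ->] := clsP p; rewrite scaleE !cls_star scaleE; congr cls.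
  by apply: opseq_eq => n v /=; rewrite ?conjcK.
- move=> p q; have [a ->] := clsP p; have [b ->] := clsP q.
  by rewrite mulE !cls_star mulE; congr cls; exact: opseq_eq.
- by move=> p; have [a ->] := clsP p; rewrite cls_norm => /norm_eq0/clsE.
- move=> p q; have [a ->] := clsP p; have [b ->] := clsP q.
  by rewrite addE !cls_norm; exact: norm_add.
- by move=> c p; have [a ->] := clsP p; rewrite scaleE !cls_norm norm_scale.
- move=> p q; have [a ->] := clsP p; have [b ->] := clsP q.
  by rewrite mulE !cls_norm; exact: norm_mul.
- by move=> p; have [a ->] := clsP p; rewrite cls_star mulE !cls_norm norm_cstar.
- move=> u cauchy; have dE p q : qnorm (p - q) = dist (rep p) (rep q).
    by rewrite -{1}(clsK p) -{1}(clsK q) oppE addE cls_norm.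
  have [|l lP] := @opseq_complete E (fun n => rep (u n)).
    by move=> e /cauchy[N h]; exists N => m n mN nN; rewrite -dE; exact: h.
  exists (cls l) => e /lP[N h]; exists N => n /h; rewrite dE; congr (_ < _).
  apply: norm_eqv; apply: eqv_add; first exact: eqv_refl.
  by apply: eqv_scale; rewrite eqv_sym rep_cls.
Defined.
End Quotient.

(** * The GNS construction *)

Section GNS.
Local Open Scope ring_scope.
Local Notation V := {poly CC}.
Variables (A : finType) (phi : seq A -> R).
Hypothesis phi_nil : phi [::] = 1.
Hypothesis phi_rev : forall w, phi (rev w) = phi w.
Hypothesis phi_psd : forall s : seq (R * seq A),
  0 <= \sum_(p <- s) \sum_(q <- s) p.1 * phi (rev p.2 ++ q.2) * q.1.
Hypothesis phi_dup : forall l r a, phi (l ++ a :: a :: r) = phi (l ++ a :: r).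

(** Polynomials serve as the free vector space on the basis ['X^i], and this is the linear map given
    by its values on the basis. *)
Definition extend (U : lmodType CC) (f : nat -> U) (p : V) : U := \sum_(i < size p) p`_i *: f i.

Lemma extend_widen (U : lmodType CC) (f : nat -> U) (p : V) n : (size p <= n)%N ->
  extend f p = \sum_(i < n) p`_i *: f i.
Proof.
move=> pn; rewrite /extend (big_ord_widen n (fun i => p`_i *: f i) pn) big_mkcond.
by apply: eq_bigr => i _; case: ltnP => // ip; rewrite nth_default ?scale0r.
Qed.

Lemma extend_lin (U : lmodType CC) (f : nat -> U) c (p q : V) :
  extend f (c *: p + q) = c *: extend f p + extend f q.
Proof.
pose n := maxn (size (c *: p + q)) (maxn (size p) (size q)).
rewrite !(@extend_widen _ f _ n) ?leq_max ?leqnn ?orbT // scaler_sumr -big_split.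
by apply: eq_bigr => i _; rewrite coefD coefZ scalerDl scalerA.
Qed.

Lemma extendX (U : lmodType CC) (f : nat -> U) i : extend f 'X^i = f i.
Proof.
rewrite /extend size_polyXn big_ord_recr /= coefXn eqxx scale1r big1 ?add0r // => j _.
by rewrite coefXn ltn_eqF ?scale0r.
Qed.

Lemma eq_on_monomials (s : CC -> CC) (f g : V -> CC) : s 1 = 1 ->
  (forall c p q, f (c *: p + q) = s c * f p + f q) -> (forall c p q, g (c *: p + q) = s c * g p + g q) ->
  (forall i, f 'X^i = g 'X^i) -> forall p, f p = g p.
Proof.
move=> s1 fl gl fg p.
have z0 h : (forall c p q, h (c *: p + q) = s c * h p + h q) -> h 0 = 0 :> CC.
  move=> /(_ 1 0 0); rewrite scaler0 addr0 s1 mul1r => /esym/eqP.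
  by rewrite -subr_eq0 addrK => /eqP.
rewrite -(coefK p) poly_def; elim: (index_enum _) => [|i r IH]; first by rewrite big_nil !z0.
by rewrite big_cons fl gl IH fg.
Qed.

(* Numbers that encode no word stand for the empty word; repetitions are harmless since the form need not be
   definite. *)
Definition letter_word i : seq A := odflt [::] (unpickle i).
Definition monomial (w : seq A) : V := 'X^(pickle w).
Lemma letter_wordK w : letter_word (pickle w) = w. Proof. by rewrite /letter_word pickleK. Qed.

Definition kernel i j : R := phi (rev (letter_word i) ++ letter_word j).

Definition gns_inner (p q : V) : CC :=
  \sum_(j < size q) \sum_(i < size p) conjc p`_i * q`_j * ((kernel i j)%:C)%C.

Lemma gns_inner_extend p q : gns_inner p q =
  extend (U := CC^o) (fun j => \sum_(i < size p) conjc p`_i * ((kernel i j)%:C)%C) q.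
Proof. by apply: eq_bigr => j _; rewrite [RHS]mulr_sumr; apply: eq_bigr => i _; rewrite mulrA [q`_j * _]mulrC. Qed.

Lemma gns_lin u c v w : gns_inner u (c *: v + w) = c * gns_inner u v + gns_inner u w.
Proof. by rewrite !gns_inner_extend extend_lin. Qed.

Lemma gns_conj u v : gns_inner v u = conjc (gns_inner u v).
Proof.
rewrite /gns_inner rmorph_sum exchange_big; apply: eq_bigr => j _; rewrite rmorph_sum; apply: eq_bigr => i _.
rewrite !rmorphM -[RHS]/(conjc (conjc u`_i) * conjc v`_j * conjc ((kernel i j)%:C)%C).
rewrite conjcK conjcR [conjc _ * _]mulrC; congr (_ * (_%:C)%C).
by rewrite /kernel -phi_rev rev_cat revK.
Qed.

(** The kernel is real and symmetric, so the form at a complex vector is the sum of its values at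
    the real and the imaginary part. *)
Lemma gns_ge0 u : 0 <= gns_inner u u.
Proof.
have im0 : Im (gns_inner u u) = 0.
  by have := gns_conj u u; case: (gns_inner u u) => a b [/= h]; lra.
rewrite lecE im0 eqxx /=.
have ReS n (F : 'I_n -> CC) : Re (\sum_i F i) = \sum_i Re (F i) by exact: (big_morph _ ReD erefl).
have psd (c : CC -> R) : 0 <= \sum_(j < size u) \sum_(i < size u) c u`_i * kernel i j * c u`_j.
  have := phi_psd [seq (c u`_(val i), letter_word (val i)) | i <- enum 'I_(size u)].
  rewrite big_map big_enum /=; under eq_bigr do rewrite big_map big_enum /=.
  by rewrite exchange_big.
have := addr_ge0 (psd (@complex.Re R)) (psd (@complex.Im R)); congr (0 <= _).
rewrite -big_split /gns_inner ReS; apply: eq_bigr => j _; rewrite -big_split ReS; apply: eq_bigr => i _ /=.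
by case: (u`_i) => a b; case: (u`_j) => a' b' /=; ring.
Qed.

Lemma gns_innerX i j : gns_inner 'X^i 'X^j = ((kernel i j)%:C)%C.
Proof.
rewrite gns_inner_extend extendX size_polyXn big_ord_recr /= coefXn eqxx big1 => [|k _].
  by rewrite add0r rmorph1 mul1r.
by rewrite coefXn (ltn_eqF (ltn_ord k)) conjcR mul0r.
Qed.

Lemma gns_neq0 : exists u, gns_inner u u <> 0.
Proof.
exists (monomial [::]); rewrite gns_innerX /kernel letter_wordK phi_nil => /eqP; by rewrite oner_eq0.
Qed.

Definition gns_space : prehilbert := @Prehilbert _ gns_inner gns_lin gns_conj gns_ge0 gns_neq0.

Definition left_mul a (p : V) : V := extend (fun i => monomial (a :: letter_word i)) p.

Lemma left_mul_lin a c p q : left_mul a (c *: p + q) = c *: left_mul a p + left_mul a q.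
Proof. exact: extend_lin. Qed.

Lemma left_mulX a i : left_mul a 'X^i = monomial (a :: letter_word i).
Proof. exact: extendX. Qed.

Lemma gns_linl c u v w : gns_inner (c *: u + v) w = conjc c * gns_inner u w + gns_inner v w.
Proof. exact: (@inner_linl gns_space). Qed.

Lemma gns_ext (f g : V -> V -> CC) :
  (forall u c p q, f u (c *: p + q) = c * f u p + f u q) ->
  (forall u c p q, g u (c *: p + q) = c * g u p + g u q) ->
  (forall c p q v, f (c *: p + q) v = conjc c * f p v + f q v) ->
  (forall c p q v, g (c *: p + q) v = conjc c * g p v + g q v) ->
  (forall i j, f 'X^i 'X^j = g 'X^i 'X^j) -> forall u v, f u v = g u v.
Proof.
move=> fr gr fl gl fg u v; apply: (eq_on_monomials (s := id) erefl (fr u) (gr u)) => j.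
apply: (@eq_on_monomials conjc (fun u => f u 'X^j) (fun u => g u 'X^j)) => //; exact: rmorph1.
Qed.

Definition gns_lin_simpl := (left_mul_lin, gns_lin, gns_linl).

Lemma left_mul_adj a u v : gns_inner (left_mul a u) v = gns_inner u (left_mul a v).
Proof.
apply: (@gns_ext (fun u v => gns_inner (left_mul a u) v) (fun u v => gns_inner u (left_mul a v))) u v => /=.
1-4: by move=> *; rewrite !gns_lin_simpl.
by move=> i j; rewrite !left_mulX !gns_innerX /kernel !letter_wordK rev_cons cat_rcons.
Qed.

Lemma left_mul_idem a u v : gns_inner u (left_mul a (left_mul a v)) = gns_inner u (left_mul a v).
Proof.
apply: (@gns_ext (fun u v => gns_inner u (left_mul a (left_mul a v))) (fun u v => gns_inner u (left_mul a v))) u v => /=.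
1-4: by move=> *; rewrite !gns_lin_simpl.
by move=> i j; rewrite !left_mulX !gns_innerX /kernel !letter_wordK phi_dup.
Qed.

(** For the form, [left_mul a] is a self-adjoint idempotent, so the square of [nrm x] with
    [x = left_mul a v] equals the real part of [inner v x]; Cauchy-Schwarz gives the bound one. *)
Lemma left_mul_bounded a : asymp_bound (E := gns_space) (fun _ => left_mul a) 1.
Proof.
split=> // e e0; exists 0%N => _ _ v; apply: (@le_trans _ _ (@nrm gns_space v)); last first.
  by have := nrm_ge0 (v : gns_space); nra.
set x : gns_space := left_mul a v.
case: (eqVneq (nrm x) 0) => [->|x0]; first exact: nrm_ge0.
have {}x0 : 0 < nrm x by rewrite lt_def x0 nrm_ge0.
rewrite -(ler_pM2r x0) -expr2 nrm_sqr.
have -> : inner x x = inner (v : gns_space) x by rewrite /= /x left_mul_adj left_mul_idem.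
exact: cauchy_schwarz.
Qed.

Definition letter a : opseq gns_space :=
  @Opseq gns_space (fun _ => left_mul a) (fun _ => left_mul a) (fun _ => left_mul_lin a) (fun _ => left_mul_lin a)
    (fun _ => left_mul_adj a) (ex_intro _ 1 (left_mul_bounded a)).

Definition gen a : operator_algebra gns_space := cls (letter a).

Lemma gen_star a : cstar (gen a) = gen a.
Proof. by rewrite /= cls_star; congr cls; exact: opseq_eq. Qed.

Lemma gen_idem a : gen a * gen a = gen a.
Proof. by rewrite [LHS]mulE; apply/clsE/eqv_inner => n u v; exact: left_mul_idem. Qed.

Lemma gen_mul0 a b : (forall l r, phi (l ++ a :: b :: r) = 0) -> gen a * gen b = 0.
Proof.
move=> ab0; rewrite [LHS]mulE; apply/clsE/eqv_inner => n u v.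
rewrite [fwd (zero_op _) _ _]scale0r inner0r.
apply: (@gns_ext (fun u v => gns_inner u (left_mul a (left_mul b v))) (fun _ _ => 0)) u v => /=.
1,3: by move=> *; rewrite !gns_lin_simpl.
1,2: by move=> *; rewrite mulr0 addr0.
by move=> i j; rewrite !left_mulX !gns_innerX /kernel !letter_wordK ab0.
Qed.

Lemma gen_sum (I : finType) (F : I -> A) : (forall l r, \sum_i phi (l ++ F i :: r) = phi (l ++ r)) ->
  \sum_i gen (F i) = 1.
Proof.
move=> sumF; have [b [bE fwdb]] : exists b : opseq gns_space,
    \sum_i gen (F i) = cls b /\ forall n v, fwd b n v = \sum_i left_mul (F i) v.
  elim: (index_enum I) => [|i r [b [bE fwdb]]].
    by exists (zero_op gns_space); split=> [|n v]; rewrite big_nil //= scale0r.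
  exists (add_op (letter (F i)) b); split=> [|n v]; last by rewrite big_cons -(fwdb n).
  by rewrite big_cons bE [LHS]addE.
rewrite bE; apply/clsE/eqv_inner => n u v; rewrite fwdb [RHS]/=.
have sumr w (G : I -> gns_space) : inner w (\sum_i G i) = \sum_i inner w (G i).
  exact: (big_morph _ (innerDr w) (inner0r w)).
rewrite sumr; apply: (@gns_ext (fun u v => \sum_i gns_inner u (left_mul (F i) v)) gns_inner) u v => /=.
- by move=> u c p q; rewrite mulr_sumr -big_split; apply: eq_bigr => i _; rewrite !gns_lin_simpl.
- exact: gns_lin.
- by move=> c p q v; rewrite mulr_sumr -big_split; apply: eq_bigr => i _; rewrite !gns_lin_simpl.
- exact: gns_linl.
move=> i j; rewrite gns_innerX /kernel -sumF rmorph_sum; apply: eq_bigr => k _.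
by rewrite left_mulX gns_innerX /kernel letter_wordK.
Qed.
End GNS.

(** * Conclusion: from closed words to a quantum isomorphism *)

Lemma quantum_isomorphic_of_words (G H : graph) : vertex G ->
  (forall w, wf w 0 -> ev (G := G) w [::] = ev (G := H) w [::]) -> quantum_isomorphic G H.
Proof.
move=> g0 closed_eq; pose f := phi R closed_eq.
pose nilP : f [::] = 1%R := phi_nil R closed_eq.
pose u := gen nilP (@phi_rev R G H closed_eq) (phi_psd closed_eq g0) (phi_dup R closed_eq).
exists (operator_algebra (gns_space nilP (@phi_rev R G H closed_eq) (phi_psd closed_eq g0))).
exists (fun g h => u (g, h)); split=> [g h|g|h|g g' h h' gh].
- by split; [exact: gen_star|exact: gen_idem].
- by apply: gen_sum => l r; exact: phi_sumH.
- by apply: gen_sum => l r; exact: phi_sumG.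
- by apply: gen_mul0 => l r; exact: phi_orth.
Qed.

Lemma quantum_isomorphic_empty (G H : graph) : #|vertex G| = 0 -> #|vertex H| = 0 -> quantum_isomorphic G H.
Proof.
move=> G0 H0.
have psd (s : seq (R * seq unit)) : (0 <= \sum_(p <- s) \sum_(q <- s) p.1 * 1 * q.1 :> R)%R.
  have -> : (\sum_(p <- s) \sum_(q <- s) p.1 * 1 * q.1 = (\sum_(p <- s) p.1) ^+ 2 :> R)%R.
    rewrite expr2 mulr_suml; apply: eq_bigr => p _; rewrite mulr_sumr.
    by apply: eq_bigr => q _; rewrite mulr1.
  exact: sqr_ge0.
have noG (g : vertex G) : False by have := max_card (pred1 g); rewrite card1 G0.
have noH (h : vertex H) : False by have := max_card (pred1 h); rewrite card1 H0.
(* Without vertices any C*-algebra will do; this one comes from the constant functional on words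
   over a single letter. *)
exists (operator_algebra (gns_space (erefl : (fun=> 1%R) [::] = 1%R) (fun _ => erefl) psd)).
by exists (fun _ _ => 1%R); split=> [g|g|h|g]; [case: (noG g)|case: (noG g)|case: (noH h)|case: (noG g)].
Qed.

Theorem theorem25 (L : Type) (models : graph -> L -> Prop) :
  is_logic models ->
  self_complementary models ->
  (exists Fc : graph -> Prop,
      (forall F, Fc F -> simple F) /\
      (forall G H, simple G -> simple H ->
         (hom_indist Fc G H <-> L_equiv models G H))) ->
  (forall k : nat, exists G H : graph,
      [/\ simple G, simple H, Ck_equiv k G H & ~ L_equiv models G H]) ->
  forall G H : graph, simple G -> simple H ->
    L_equiv models G H -> quantum_isomorphic G H.
Proof.
move=> logic self_compl [Fc [Fc_simple Fc_equiv]] separated G H sG sH GH.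
have L_op := @L_equiv_op L models logic self_compl Fc Fc_equiv.
have unbounded := closed_unbounded logic Fc_simple Fc_equiv separated.
case: (posnP #|vertex G|) => [G0|/card_gt0P[g _]].
  apply: (quantum_isomorphic_empty G0); rewrite -G0; apply/esym.
  (* A graph without a decomposition into empty bags has a vertex, and a closed graph with a vertex
     determines the number of vertices of [H]. *)
  have [F [cF ndec]] := unbounded 0.
  have /set0Pn[v _] : [set: vertex F] != set0.
    by apply/eqP => F0; apply: ndec; rewrite F0; apply: dec0; rewrite cards0.
  exact: (closed_card (fun G H K => @L_op G H K) sG sH GH cF v).
apply: (quantum_isomorphic_of_words g) => w.
exact: (planar_words_equal (fun G H K => @L_op G H K) unbounded sG sH GH g).
Qed.
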